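(* Let $\beta:\mathbb{R}\to\mathbb{R}$ be a non-negative $C^1$ function with $\operatorname{supp}\beta=[0,1]$ and $\int_0^1\beta=1$. Let $u\in \mathrm{Lip}(\mathbb{R}^n)$ be a stable, axially symmetric solution to $$\Delta u=\tfrac12\beta(u)\quad\text{in }\mathbb{R}^n.$$ Then, if $n\le 5$, $u$ is one-dimensional.
   Context: $\mathrm{Lip}(\mathbb{R}^n)$ is the space of globally Lipschitz functions $u:\mathbb{R}^n\to\mathbb{R}$, i.e. $\|\nabla u\|_{L^\infty(\mathbb{R}^n)}<\infty$. A solution $u$ of $\Delta u=\frac12\beta(u)$ in $\mathbb{R}^n$ is called stable if the second variation of the energy $\int\{|\nabla u|^2+\Phi(u)\}\,dx$ (with $\Phi'=\beta$) at $u$ is non-negative, i.e. $$\int_{\mathbb{R}^n}\left\{|\nabla \xi|^2+\tfrac12\beta'(u)\xi^2\right\}dx\ge 0\qquad\text{for every }\xi\in C^\infty_c(\mathbb{R}^n).$$ A function $u:\mathbb{R}^n\to\mathbb{R}$ is axially symmetric if it depends only on $s:=\sqrt{x_1^2+\dots+x_{n-1}^2}$ and $t:=x_n$, i.e. $u(x_1,\dots,x_n)=u(s,t)$ (here $n\ge 2$). A function $u:\mathbb{R}^n\to\mathbb{R}$ is one-dimensional (1D) if there exist a unit vector $e\in\mathbb{R}^n$ and a function $g:\mathbb{R}\to\mathbb{R}$ such that $u(x)=g(e\cdot x)$ for all $x\in\mathbb{R}^n$ (constants included). *)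

(* Defs.v *)
From HB Require Import structures.
From mathcomp Require Import all_boot all_order all_algebra.
From mathcomp Require Import all_classical all_reals all_analysis.
Set Implicit Arguments.
Unset Strict Implicit.
Unset Printing Implicit Defensive.
Import Order.TTheory GRing.Theory Num.Theory.
Import numFieldNormedType.Exports.
Local Open Scope classical_set_scope.
Local Open Scope ring_scope.

Section lebesgue_measure_Rn.
Context {R : realType}.
Local Notation mR := (measurableTypeR R).

Definition cons_pair n (p : mR * n.-tuple mR) : n.+1.-tuple mR :=
  [tuple of p.1 :: p.2].

Lemma measurable_cons_pair n : measurable_fun setT (@cons_pair n).
Proof. exact: measurable_cons. Qed.

Section step.
Context n (mu : {sigma_finite_measure set (n.-tuple mR) -> \bar R}).

Definition lebesgueS : set (n.+1.-tuple mR) -> \bar R :=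
  pushforward (@lebesgue_measure R \x mu)%E (@cons_pair n).

Let lebesgueS0 : lebesgueS set0 = 0%E.
Proof. by rewrite /lebesgueS /pushforward preimage_set0 measure0. Qed.

Let lebesgueS_ge0 A : (0 <= lebesgueS A)%E.
Proof. by rewrite /lebesgueS /pushforward measure_ge0. Qed.

Let lebesgueS_sigma_additive : semi_sigma_additive lebesgueS.
Proof.
move=> F mF tF mUF; rewrite /lebesgueS /pushforward preimage_bigcup.
have mP A : measurable A -> measurable (@cons_pair n @^-1` A).
  by move=> mA; rewrite -[X in measurable X]setTI; exact: measurable_cons_pair.
apply: measure_semi_sigma_additive.
- by move=> k; exact: mP.
- apply/trivIsetP => /= i j _ _ ij; rewrite -preimage_setI.
  by move/trivIsetP : tF => /(_ _ _ _ _ ij) ->//; rewrite preimage_set0.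
- by rewrite -preimage_bigcup; exact: mP.
Qed.

HB.instance Definition _ := isMeasure.Build _ _ _ lebesgueS
  lebesgueS0 lebesgueS_ge0 lebesgueS_sigma_additive.

Lemma lebesgueS_sigma_finite : sigma_finite setT lebesgueS.
Proof.
have /sigma_finiteP[F [TF ndF Foo]] := sigma_finiteT (@lebesgue_measure R).
have /sigma_finiteP[G [TG ndG Goo]] := sigma_finiteT mu.
pose g (t : n.+1.-tuple mR) : mR * n.-tuple mR := (thead t, [tuple of behead t]).
have gK : cancel (@cons_pair n) g.
  by move=> [x t]; congr pair; apply: val_inj.
have mg : measurable_fun setT g.
  apply/measurable_fun_pairP; split; last exact: measurable_behead.
  exact: measurable_tnth.
exists (fun k => g @^-1` (F k `*` G k)).
  apply/seteqP; split => // t _.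
  have [i _ Fi] : (\bigcup_k F k) (g t).1 by rewrite -TF.
  have [j _ Gj] : (\bigcup_k G k) (g t).2 by rewrite -TG.
  exists (maxn i j) => //; split.
    by move: (g t).1 Fi; exact/subsetPset/ndF/leq_maxl.
  by move: (g t).2 Gj; exact/subsetPset/ndG/leq_maxr.
move=> k; have [mF Fk] := Foo k; have [mG Gk] := Goo k; split.
  by rewrite -[X in measurable X]setTI; apply: mg => //; exact: measurableX.
rewrite /lebesgueS /pushforward.
rewrite (_ : _ @^-1` _ = F k `*` G k); last first.
  by apply/funext => p; exact: (congr1 (F k `*` G k) (gK p)).
by rewrite product_measure1E// lte_mul_pinfty// ge0_fin_numE.
Qed.

HB.instance Definition _ := Measure_isSigmaFinite.Build _ _ _ lebesgueS
  lebesgueS_sigma_finite.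

End step.

(* Lebesgue measure on R^n, as the n-fold product of the one on R; R^n is
   represented by n-tuples, on which the library puts the product
   sigma-algebra. *)
Fixpoint lebesgueRn n : {sigma_finite_measure set (n.-tuple mR) -> \bar R} :=
  if n is m.+1 then lebesgueS (lebesgueRn m)
  else \d_([tuple] : 0.-tuple mR).

Definition intRn n (f : 'rV[R]_n -> R) : \bar R :=
  (\int[lebesgueRn n]_t (f (\row_i tnth t i))%:E)%E.

End lebesgue_measure_Rn.

Section calculus.
Context {R : realType}.

Definition partial n (i : 'I_n) (f : 'rV[R]_n -> R) : 'rV[R]_n -> R :=
  fun x => 'D_(delta_mx 0 i) f x.

Definition iter_partial n (s : seq 'I_n) (f : 'rV[R]_n -> R) :=
  foldr (@partial n) f s.

(* Every iterated partial derivative of order at most k exists and is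
   continuous.  The clause on derivability is needed because the library's
   directional derivative is a total function with junk values. *)
Definition Ck n (k : nat) (f : 'rV[R]_n -> R) : Prop :=
  (forall s : seq 'I_n, (size s <= k)%N -> continuous (iter_partial s f)) /\
  (forall s : seq 'I_n, (size s < k)%N -> forall (i : 'I_n) x,
     derivable (iter_partial s f) x (delta_mx 0 i)).

Definition Cinfty n (f : 'rV[R]_n -> R) : Prop := forall k, Ck k f.

Definition C1 (f : R -> R) : Prop :=
  (forall x, derivable f x 1) /\ continuous (derive1 f).

Definition supp (T : topologicalType) (f : T -> R) : set T :=
  closure [set x | f x != 0].

Definition Cc_infty n (f : 'rV[R]_n -> R) : Prop :=
  Cinfty f /\ compact (supp f).

Definition dot n (x y : 'rV[R]_n) : R := \sum_(i < n) x 0 i * y 0 i.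

Definition sqnorm_grad n (f : 'rV[R]_n -> R) (x : 'rV[R]_n) : R :=
  \sum_(i < n) partial i f x ^+ 2.

Definition laplacian n (f : 'rV[R]_n -> R) (x : 'rV[R]_n) : R :=
  \sum_(i < n) partial i (partial i f) x.

End calculus.

Section problem.
Context {R : realType}.

(* Classical solutions: C^2 and satisfying the equation at every point. *)
Definition solution n (beta : R -> R) (u : 'rV[R]_n -> R) : Prop :=
  Ck 2 u /\ forall x, laplacian u x = 2^-1 * beta (u x).

Definition stable n (beta : R -> R) (u : 'rV[R]_n -> R) : Prop :=
  forall xi : 'rV[R]_n -> R, Cc_infty xi ->
    (0 <= intRn (fun x => sqnorm_grad xi x +
                          2^-1 * derive1 beta (u x) * xi x ^+ 2)%R)%E.

(* s and t are the cylindrical coordinates; the last coordinate of R^(n+1)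
   has index ord_max. *)
Definition axially_symmetric n (u : 'rV[R]_n.+1 -> R) : Prop :=
  exists g : R -> R -> R, forall x : 'rV[R]_n.+1,
    let s := Num.sqrt (\sum_(i < n.+1 | i != ord_max) x 0 i ^+ 2) in
    let t := x 0 ord_max in
    u x = g s t.

Definition one_dimensional n (u : 'rV[R]_n -> R) : Prop :=
  exists e : 'rV[R]_n, dot e e = 1 /\
  exists g : R -> R, forall x, u x = g (dot e x).

End problem.

(* Main.v *)
From HB Require Import structures.
Require Import Defs.
From mathcomp Require Import all_boot all_order all_algebra.
From mathcomp Require Import all_classical all_reals all_analysis.
From mathcomp Require Import measurable_realfun.
From mathcomp Require Import zify ring lra.
Set Implicit Arguments.
Unset Strict Implicit.
Unset Printing Implicit Defensive.
Import Order.TTheory GRing.Theory Num.Theory.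
Import numFieldNormedType.Exports.
Local Open Scope classical_set_scope.
Local Open Scope ring_scope.

(** Let k be the number of coordinates x' orthogonal to the axis, that is n in
    dimension n + 1, and put s = |x'| and c = beta'(u) / 2. Each partial
    derivative v of u solves the linearized equation Delta v = c v, while
    stability says that the quadratic form int (|grad xi|^2 + c xi^2) is
    nonnegative. The goal is that the radial derivative u_s vanishes; u is then
    a function of the last coordinate alone ([axial_one_dimensional]).

    Since u is only C^2, the natural test functions are C^1 with compact
    support.  Stability extends to them by mollification ([stable_C1c]), and so
    does the linearized equation in its weak form ([linearized_C1c]).  The only
    facts about the integral behind this are linearity, monotonicity, the
    volume of boxes and translation invariance; the last one makes the
    integrals of partial derivatives vanish ([integ_grad0]).

    For k >= 2, differentiating the equation for u in s shows that u_s solves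
    the linearized equation with the extra term (k - 1) u_s / s^2.  Testing
    stability with xi = s u_s eta, where s u_s = x' . grad' u is C^1 across the
    axis, therefore yields ([cylinder_ineq])

      0 <= int u_s^2 (s^2 |grad eta|^2 + 2 eta x' . grad' eta - (k - 2) eta^2).

    Take eta = (1 + s^2)^(- (1 + alpha) / 2) zeta with a cutoff zeta at scale
    r.  The terms that do not differentiate zeta contribute a negative multiple
    of k - 1 - alpha^2 ([weighted_ineq]).  As u_s is bounded, the others are
    O(r^(k - 1 - 2 alpha)) for alpha < k / 2 ([tail_decay]).  So both parts
    behave as wanted when (k - 1) / 2 < alpha < sqrt (k - 1), and such an alpha
    exists exactly for 2 <= k <= 4: this is where the restriction to dimension
    at most 5 comes from.  The choice alpha = 5 k / 12 serves the three cases at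
    once ([radial_derivative_eq0_high]).

    For k = 1 the inequality above carries no information.  Instead,
    v = d_0 u is odd in x_0, and the quadratic form nearly vanishes on |v|
    times a logarithmic cutoff, because such cutoffs of the plane have
    arbitrarily small energy ([log_cutoff]).  Perturbing |v| by a small
    multiple of a compactly supported psi >= 0 then gives
    int (c psi - Delta psi) |v| >= 0.  Let psi decay like exp (- mu |x_0|) with
    mu large.  Away from the line x_0 = 0 one has Delta psi - c psi >= psi, and
    the negative singular part of Delta psi on that line is harmless because v
    vanishes there.  So int psi |v| <= 0 and v = 0
    ([normal_derivative_eq0]).  In the proof |v| is replaced by
    sqrt (v^2 + delta^2) ([kato_ineq]) and |x_0| by sqrt (x_0^2 + tau^2)
    ([barrier_ineq]), with delta and tau tied to the size of the
    perturbation. *)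

(** * Lebesgue measure of boxes and translates *)

Section measure.
Context {R : realType}.
Local Notation mR := (measurableTypeR R).

Definition row_of n (t : n.-tuple mR) : 'rV[R]_n := \row_i tnth t i.

Lemma ler_norm_rV n (x : 'rV[R]_n) (r : R) :
  0 <= r -> (`|x| <= r) = [forall i, `|x 0 i| <= r].
Proof.
move=> r0; rewrite [`|x|]mx_normrE; apply/idP/forallP.
  by move=> /bigmax_leP[_ h] i; exact: (h (0, i)).
by move=> h; apply/bigmax_leP; split=> // -[i j] _ /=; rewrite ord1.
Qed.

Lemma ltr_norm_rV n (x : 'rV[R]_n) (r : R) :
  0 < r -> (`|x| < r) = [forall i, `|x 0 i| < r].
Proof.
move=> r0; rewrite [`|x|]mx_normrE; apply/idP/forallP.
  by move=> /bigmax_ltP[_ h] i; exact: (h (0, i)).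
by move=> h; apply/bigmax_ltP; split=> // -[i j] _ /=; rewrite ord1.
Qed.

Lemma coord_le_norm n (x : 'rV[R]_n) i : `|x 0 i| <= `|x|.
Proof. by have := lexx `|x|; rewrite ler_norm_rV// => /forallP. Qed.

Definition obox n (a : 'I_n -> R) (r : 'I_n -> R) : set (n.-tuple mR) :=
  [set t | forall i, `|tnth t i - a i| < r i].
Definition cbox n (a : 'I_n -> R) (r : 'I_n -> R) : set (n.-tuple mR) :=
  [set t | forall i, `|tnth t i - a i| <= r i].

Lemma measurable_forall_tnth n (A : 'I_n -> set mR) :
  (forall i, measurable (A i)) ->
  measurable [set t : n.-tuple mR | forall i, A i (tnth t i)].
Proof.
move=> mA.
rewrite (_ : [set t | _] = \big[setI/setT]_(i < n) ((@tnth n mR ^~ i) @^-1` A i)).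
  apply: big_ind => //; first exact: measurableI.
  move=> i _; rewrite -[X in measurable X]setTI.
  exact: (@measurable_tnth _ mR n i).
apply/seteqP; split=> t /=.
  by move=> h; rewrite -bigcap_seq => i _; exact: h.
by rewrite -bigcap_seq => h i; apply: h; rewrite /= mem_index_enum.
Qed.

Lemma measurable_cbox n a r : measurable (@cbox n a r).
Proof.
apply: (@measurable_forall_tnth n (fun i => [set y : R | `|y - a i| <= r i])) => i.
rewrite (_ : [set y | _] = `[a i - r i, a i + r i]%classic)//.
by apply/seteqP; split=> y /=; rewrite in_itv/= ler_distl.
Qed.

Lemma measurable_obox n a r : measurable (@obox n a r).
Proof.
apply: (@measurable_forall_tnth n (fun i => [set y : R | `|y - a i| < r i])) => i.
rewrite (_ : [set y | _] = `]a i - r i, a i + r i[%classic)//.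
by apply/seteqP; split=> y /=; rewrite in_itv/= ltr_distl.
Qed.

(** The sigma-algebra on tuples is generated by the coordinates and not by the
    topology of row vectors. The preimage of an open interval is open, hence
    the countable union of the boxes with rational centre and radius 1 / (k +
    1) that it contains. *)
Lemma measurable_continuous_rV n (f : 'rV[R]_n -> R) :
  continuous f -> measurable_fun setT (f \o @row_of n).
Proof.
move=> cf; apply: (measurability _ (RGenOpens.measurableE R)).
move=> /= _ [_ [a [b ->]] <-]; rewrite setTI.
set U := (X in _ @^-1` X).
have oV : open (f @^-1` U).
  by apply: open_comp; [move=> x _; exact: cf|exact: interval_open].
pose idx := ('rV[rat]_n * nat)%type.
pose good (p : idx) := `[< forall x : 'rV[R]_n,
  (forall i, `|x 0 i - ratr (p.1 0 i)| < p.2.+1%:R^-1) -> U (f x) >].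
pose F (p : idx) : set (n.-tuple mR) := if good p then
  obox (fun i => ratr (p.1 0 i)) (fun=> p.2.+1%:R^-1) else set0.
rewrite (_ : _ @^-1` U = \bigcup_p F p).
  apply: countable_bigcupT_measurable => [|p]; first exact: countableP.
  by rewrite /F; case: ifP => // _; exact: measurable_obox.
apply/seteqP; split=> t /=; last first.
  move=> [p _]; rewrite /F; case: ifP => // /asboolP gp h; apply: gp => i.
  by rewrite mxE; exact: h.
move=> Ut.
have /nbhs_ballP[e /= e0 he] : nbhs (row_of t) (f @^-1` U).
  by apply: open_nbhs_nbhs; split.
have [k ke] : exists k : nat, k.+1%:R^-1 < e / 2.
  have [k] := ltr_add_invr (y := 0) (x := e / 2) (divr_gt0 e0 (ltr0Sn R 1)).
  by rewrite add0r; exists k.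
have /choice[q hq] : forall i, exists q : rat, `|tnth t i - ratr q| < k.+1%:R^-1.
  move=> i.
  have d0 : 0 < k.+1%:R^-1 :> R by rewrite invr_gt0.
  have [q] := @rat_in_itvoo R (tnth t i - k.+1%:R^-1) (tnth t i + k.+1%:R^-1)
    ltac:(by rewrite ltrD2l gtrN).
  rewrite in_itv/= => hq; exists q; rewrite ltr_norml.
  set w := k.+1%:R^-1 in hq d0 *; set z := ratr q in hq *; set y := tnth t i in hq *.
  lra.
exists (\row_i q i, k) => //; rewrite /F; case: ifPn; last first.
  move/asboolPn => []; apply: contrapT => /= nh; apply: nh => x hx.
  apply: he; rewrite -ball_normE /= ltr_norm_rV//; apply/forallP => i.
  rewrite !mxE; have := hx i; have := hq i; rewrite mxE/= => h1 h2.
  rewrite (_ : _ - _ = (tnth t i - ratr (q i)) - (x 0 i - ratr (q i))); last by ring.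
  rewrite (le_lt_trans (ler_normB _ _))//.
  set w := k.+1%:R^-1 in h1 h2 ke *; lra.
by move=> _ i /=; rewrite mxE; exact: hq.
Qed.

Lemma lebesgueRn_cbox n a r : (forall i, 0 <= r i) ->
  lebesgueRn n (@cbox n a r) = (\prod_(i < n) (2 * r i))%:E.
Proof.
elim: n a r => [|n IH] a r r0.
  rewrite big_ord0 /= diracE mem_set//.
  by move=> -[].
rewrite [lebesgueRn _ _]/= /lebesgueS /pushforward.
rewrite (_ : _ @^-1` _ = `[a ord0 - r ord0, a ord0 + r ord0]%classic `*`
    cbox (fun i => a (lift ord0 i)) (fun i => r (lift ord0 i))); last first.
  apply/seteqP; split=> -[x t] /=.
    move=> h; split; first by have := h ord0; rewrite in_itv/= -ler_distl.
    by move=> i; have := h (lift ord0 i); rewrite tnthS.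
  move=> [h1 h2] i; have [j ->|->] := unliftP ord0 i.
    by rewrite tnthS; exact: h2.
  by move: h1; rewrite in_itv/= -ler_distl.
rewrite product_measure1E//=; last exact: measurable_cbox.
rewrite lebesgue_measure_itv/= lte_fin IH// big_ord_recl EFinM; congr (_ * _)%E.
case: ifPn => [_|]; first by rewrite -EFinB; congr EFin; ring.
rewrite -leNgt => h; congr EFin; have := r0 ord0; lra.
Qed.

Definition shift_tuple n (a : 'I_n -> R) (t : n.-tuple mR) : n.-tuple mR :=
  [tuple tnth t i + a i | i < n].

Lemma measurable_shift_tuple n a : measurable_fun setT (@shift_tuple n a).
Proof.
apply/measurable_fun_tnthP => i.
rewrite (_ : _ \o _ = fun t => tnth t i + a i); last first.
  by apply/funext => t /=; rewrite tnth_mktuple.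
by apply: measurable_funD => //; exact: measurable_tnth.
Qed.

Lemma lebesgue_measure_shift (a : R) (A : set mR) : measurable A ->
  lebesgue_measure ((fun x : mR => (x + a)%R : mR) @^-1` A) = lebesgue_measure A.
Proof.
move=> mA.
have mf : measurable_fun setT (fun x : mR => (x + a)%R : mR).
  by apply: measurable_funD.
rewrite -[LHS]/(pushforward lebesgue_measure (fun x : mR => (x + a)%R : mR) A).
apply/esym/lebesgue_measure_unique => //= _ [[b c]] _ <-.
rewrite /pushforward (_ : _ @^-1` _ = `]b - a, c - a]%classic); last first.
  by apply/seteqP; split=> x /=; rewrite !in_itv/= ltrBlDr lerBrDr.
rewrite !lebesgue_measure_itv/= !lte_fin ltrD2r; case: ifP => // _.
by rewrite -!EFinB; congr EFin; ring.
Qed.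

(** By uniqueness of product measures it suffices to translate rectangles, so
    the statement reduces by induction on n to translations of the line. *)
Lemma lebesgueRn_shift n a (A : set (n.-tuple mR)) : measurable A ->
  lebesgueRn n (@shift_tuple n a @^-1` A) = lebesgueRn n A.
Proof.
elim: n a A => [|n IH] a A mA.
  rewrite (_ : _ @^-1` A = A)//; apply/seteqP.
  by split=> t /=; rewrite (tuple0 (shift_tuple a t)) (tuple0 t).
have mB : measurable (@cons_pair R n @^-1` A).
  by rewrite -[X in measurable X]setTI; exact: measurable_cons_pair.
pose g (p : mR * n.-tuple mR) : mR * n.-tuple mR :=
  (p.1 + a ord0, shift_tuple (fun i => a (lift ord0 i)) p.2).
have mg : measurable_fun setT g.
  apply/measurable_fun_pairP; split.
    apply: (measurable_funD (f := fst)) => //; exact: measurable_fst.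
  apply: (measurableT_comp (@measurable_shift_tuple _ _)); exact: measurable_snd.
rewrite [in LHS]/= [in RHS]/= /lebesgueS /pushforward.
transitivity (pushforward (lebesgue_measure \x lebesgueRn n)%E g
   (@cons_pair R n @^-1` A)).
  rewrite /pushforward; congr (_ _); apply/seteqP; split=> -[x t] /=.
    congr A; apply: eq_from_tnth => i; rewrite tnth_mktuple.
    have [j ->|-> //] := unliftP ord0 i.
    by rewrite !tnthS /= tnth_mktuple.
  congr A; apply: eq_from_tnth => i; rewrite tnth_mktuple.
  have [j ->|-> //] := unliftP ord0 i.
  by rewrite !tnthS /= tnth_mktuple.
apply/esym; apply: product_measure_unique => // B C mBB mC.
transitivity ((lebesgue_measure \x lebesgueRn n)%E
  (((fun x : mR => (x + a ord0)%R : mR) @^-1` B)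
   `*` (shift_tuple (fun i => a (lift ord0 i)) @^-1` C))); first by [].
have mB' : measurable ((fun x : mR => (x + a ord0)%R : mR) @^-1` B).
  by rewrite -[X in measurable X]setTI; apply: measurable_funD.
have mC' : measurable (shift_tuple (fun i => a (lift ord0 i)) @^-1` C).
  by rewrite -[X in measurable X]setTI; exact: measurable_shift_tuple.
rewrite product_measure1E// IH//; congr (_ * _)%E.
exact: lebesgue_measure_shift.
Qed.

End measure.

(** * The integral of continuous compactly supported functions *)

Section functions.
Context {R : realType}.

Section cont.
Context {T : topologicalType}.
Implicit Types f g : T -> R.
Lemma contD f g : continuous f -> continuous g -> continuous (fun x => f x + g x).
Proof. by move=> cf cg x; exact: cvgD (cf x) (cg x). Qed.
Lemma contB f g : continuous f -> continuous g -> continuous (fun x => f x - g x).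
Proof. by move=> cf cg x; exact: cvgB (cf x) (cg x). Qed.
Lemma contM f g : continuous f -> continuous g -> continuous (fun x => f x * g x).
Proof. by move=> cf cg x; exact: cvgM (cf x) (cg x). Qed.
Lemma contN f : continuous f -> continuous (fun x => - f x).
Proof. by move=> cf x; apply: (@continuousN _ _ _ f x); exact: cf. Qed.
Lemma contX f k : continuous f -> continuous (fun x => f x ^+ k).
Proof.
move=> cf; elim: k => [|k IH].
  by rewrite (_ : (fun _ => _) = (fun=> 1))//; exact: cst_continuous.
rewrite (_ : (fun _ => _) = (fun x => f x * f x ^+ k)).
  exact: contM.
by apply/funext => x; rewrite exprS.
Qed.
Lemma contC (c : R) : continuous (fun _ : T => c).
Proof. exact: cst_continuous. Qed.
Lemma cont_sum (J : Type) (s : seq J) (P : pred J) (F : J -> T -> R) :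
  (forall j, P j -> continuous (F j)) -> continuous (fun x => \sum_(j <- s | P j) F j x).
Proof.
move=> cF; elim: s => [|j s IH].
  rewrite (_ : (fun _ => _) = cst 0); first exact: cst_continuous.
  by apply/funext => x; rewrite big_nil.
rewrite (_ : (fun _ => _) = (fun x => (if P j then F j x else 0) + \sum_(j <- s | P j) F j x)).
  by apply: contD => //; case Pj: (P j); [exact: cF|exact: contC].
by apply/funext => x; rewrite big_cons; case: ifP => // _; rewrite add0r.
Qed.
Lemma cont_comp (f : T -> R) (g : R -> R) :
  continuous g -> continuous f -> continuous (fun x => g (f x)).
Proof. by move=> cg cf x; apply: (@continuous_comp _ _ _ f g); [exact: cf|exact: cg]. Qed.
Lemma cont_norm f : continuous f -> continuous (fun x => `|f x|).
Proof. by move=> cf; apply: (cont_comp (g := Num.norm)) => //; exact: norm_continuous. Qed.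
Lemma contV f : (forall x, f x != 0) -> continuous f -> continuous (fun x => (f x)^-1).
Proof. by move=> f0 cf x; apply: cvgV => //; exact: cf. Qed.
End cont.

Section fixed_dim.
Context {n : nat}.
Local Notation E := 'rV[R]_n.
Local Notation e_ i := (delta_mx (0 : 'I_1) i : E).
Implicit Types (f g : E -> R) (x y : E).

Lemma cont_coord (i : 'I_n) : continuous (fun x : E => x 0 i).
Proof. exact: coord_continuous. Qed.

Lemma cube_closed (r : R) : closed [set x : E | `|x| <= r].
Proof.
apply: (@preimage_closed _ _ (fun x : E => `|x|) [set y : R | y <= r]).
  by move=> x _; exact: norm_continuous.
exact: closed_le.
Qed.

Lemma cube_compact (r : R) : compact [set x : E | `|x| <= r].
Proof.
apply: bounded_closed_compact; last exact: cube_closed.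
by exists r; split; [exact: num_real|move=> s rs x /= xr; rewrite (le_trans xr)// ltW].
Qed.

Lemma bounded_on_cube f r : continuous f ->
  exists2 M, 0 <= M & forall x, `|x| <= r -> `|f x| <= M.
Proof.
move=> cf; have : compact (f @` [set x : E | `|x| <= r]).
  apply: continuous_compact; last exact: cube_compact.
  exact: continuous_subspaceT.
move=> /compact_bounded[M [_ hM]].
exists (`|M| + 1) => [|x xr]; first by rewrite addr_ge0.
by apply: hM; [rewrite (le_lt_trans (ler_norm M))// ltrDl|exists x].
Qed.

(** Only x has to lie in the cube: near the boundary of a support the nearby y
    may be outside. *)
Lemma unif_on_cube f r (e : R) : continuous f -> 0 < e ->
  exists2 d, 0 < d & forall x y, `|x| <= r -> `|x - y| < d -> `|f x - f y| < e.
Proof.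
move=> cf e0.
have /compact_near_coveringP := @cube_compact r.
move=> /(_ _ (0^'+) (fun d x => forall y, `|x - y| < d -> `|f x - f y| < e)) h.
have {}h : \forall d \near 0^'+, [set x : E | `|x| <= r] `<=`
    (fun x => forall y, `|x - y| < d -> `|f x - f y| < e).
  apply: h => x xr.
  have /nbhs_ballP[d /= d0 hd] : \forall z \near x, `|f x - f z| < e / 2.
    have /cvgrPdist_lt := cf x; apply; exact: divr_gt0.
  exists (ball x (d / 2), [set t | 0 < t < d / 2]) => /=.
    split; first by apply: nbhsx_ballx; exact: divr_gt0.
    near=> t; apply/andP; split; near: t; first exact: nbhs_right_gt.
    by apply: nbhs_right_lt; exact: divr_gt0.
  move=> [x' t] /= [xx' /andP[t0 td]] y x'y.
  have h1 : `|f x - f x'| < e / 2.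
    by apply: hd; apply: le_ball xx'; lra.
  have h2 : `|f x - f y| < e / 2.
    apply: hd; rewrite -ball_normE/= (_ : x - y = (x - x') + (x' - y)); last first.
      by rewrite addrA subrK.
    rewrite (le_lt_trans (ler_normD _ _))//.
    move: xx'; rewrite -ball_normE/= => xx'.
    by rewrite (lt_le_trans (ltrD xx' (lt_trans x'y td)))// -splitr.
  rewrite (_ : f x' - f y = (f x - f y) - (f x - f x')); last by ring.
  rewrite (le_lt_trans (ler_normB _ _))//; lra.
have [d [d0 hd]] : exists d, 0 < d /\ [set x : E | `|x| <= r] `<=`
    (fun x => forall y, `|x - y| < d -> `|f x - f y| < e).
  near (0 : R)^'+ => d; exists d; split; first by near: d; exact: nbhs_right_gt.
  by near: d.
by exists d => // x y xr xy; exact: hd.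
Unshelve. all: by end_near. Qed.

(** Supports are measured by cubes, whose indicator functions have explicit
    integrals. *)
Definition csupp (r : R) f := forall x, r < `|x| -> f x = 0.
Definition Cc f := continuous f /\ exists2 r, 0 <= r & csupp r f.

Lemma Cc_csupp f g : continuous g -> Cc f -> (forall x, f x = 0 -> g x = 0) -> Cc g.
Proof. by move=> cg [_ [r r0 h]] fg; split=> //; exists r => // x /h/fg. Qed.

Lemma cont_shift f (a : E) : continuous f -> continuous (fun x : E => f (x + a)).
Proof.
move=> cf x; apply: (@continuous_comp _ _ _ (fun x : E => x + a) f); last exact: cf.
by apply: (continuousD (f := id) (g := cst a)); [exact: cvg_id|exact: cst_continuous].
Qed.

Lemma Cc_shift f (a : E) : Cc f -> Cc (fun x => f (x + a)).
Proof.
case=> cf [r r0 rf]; split; first exact: cont_shift.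
exists (r + `|a|); first by rewrite addr_ge0.
move=> x xr; apply: rf; have := ler_normB (x + a) a; rewrite addrK; lra.
Qed.

Lemma CcD f g : Cc f -> Cc g -> Cc (fun x => f x + g x).
Proof.
move=> [cf [r r0 rf]] [cg [s s0 sg]]; split; first exact: contD.
exists (Num.max r s) => [|x]; first by rewrite le_max r0.
by rewrite gt_max => /andP[/rf -> /sg ->]; rewrite addr0.
Qed.
Lemma CcMl f g : Cc f -> continuous g -> Cc (fun x => f x * g x).
Proof.
move=> cf cg; apply: (Cc_csupp (f := f)) => // [|x ->]; last by rewrite mul0r.
by apply: contM => //; case: cf.
Qed.
Lemma CcMr f g : continuous f -> Cc g -> Cc (fun x => f x * g x).
Proof.
move=> cf cg; apply: (Cc_csupp (f := g)) => // [|x ->]; last by rewrite mulr0.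
by apply: contM => //; case: cg.
Qed.
Lemma CcZ f k : Cc f -> Cc (fun x => k * f x).
Proof. by move=> h; apply: CcMr => //; exact: contC. Qed.
Lemma CcN f : Cc f -> Cc (fun x => - f x).
Proof.
move=> h; apply: (Cc_csupp (f := f)) => // [|x ->]; last by rewrite oppr0.
by apply: contN; case: h.
Qed.
Lemma CcB f g : Cc f -> Cc g -> Cc (fun x => f x - g x).
Proof. by move=> hf hg; apply: CcD => //; exact: CcN. Qed.
Lemma Cc0 : Cc (fun=> 0).
Proof. by split; [exact: contC|exists 0]. Qed.
Lemma Cc_sum (J : Type) (s : seq J) (P : pred J) (F : J -> E -> R) :
  (forall j, P j -> Cc (F j)) -> Cc (fun x => \sum_(j <- s | P j) F j x).
Proof.
move=> cF; elim: s => [|j s IH].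
  by rewrite (_ : (fun _ => _) = (fun=> 0)); [exact: Cc0|apply/funext => x; rewrite big_nil].
rewrite (_ : (fun _ => _) = (fun x => (if P j then F j x else 0) + \sum_(j <- s | P j) F j x)).
  by apply: CcD => //; case Pj: (P j); [exact: cF|exact: Cc0].
by apply/funext => x; rewrite big_cons; case: ifP => // _; rewrite add0r.
Qed.
Lemma Cc_sqr f : Cc f -> Cc (fun x => f x ^+ 2).
Proof.
move=> h; apply: (Cc_csupp (f := f)) => // [|x ->]; last by rewrite expr0n.
by apply: contX; case: h.
Qed.
Lemma Cc_bounded f : Cc f -> exists2 M, 0 <= M & forall x, `|f x| <= M.
Proof.
move=> [cf [r r0 rf]]; have [M M0 hM] := bounded_on_cube r cf.
exists M => // x; have [|xr] := leP `|x| r; first exact: hM.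
by rewrite rf// normr0.
Qed.

Lemma Cc_unif f (e : R) : Cc f -> 0 < e ->
  exists2 d, 0 < d & forall x y, `|x - y| < d -> `|f x - f y| < e.
Proof.
move=> [cf [r r0 rf]] e0; have [d d0 hd] := unif_on_cube (r + 1) cf e0.
exists (Num.min d 1) => [|x y]; first by rewrite lt_min d0 ltr01.
rewrite lt_min => /andP[xd x1].
have [|xr] := leP `|x| (r + 1); first by move/hd; exact.
rewrite rf ?rf ?subrr ?normr0//; last by lra.
rewrite ltNge; apply/negP => yr.
have := ler_normD (x - y) y; rewrite subrK; lra.
Qed.

Definition integ f : R := fine (intRn f).

Local Notation mu := (@lebesgueRn R n).
Local Notation row_of := (@row_of R n).

Lemma intRnE f : intRn f = (\int[mu]_t (f (row_of t))%:E)%E.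
Proof. by []. Qed.

Lemma cboxE r : 0 <= r -> @cbox R n (fun=> 0) (fun=> r) = [set t | `|row_of t| <= r].
Proof.
move=> r0; apply/seteqP; split=> t /=; rewrite ler_norm_rV//.
  by move=> h; apply/forallP => i; rewrite mxE; have := h i; rewrite subr0.
by move=> /forallP h i; have := h i; rewrite mxE subr0.
Qed.

Lemma vol_cbox a r : (forall i, 0 <= r i) ->
  (mu : {measure set _ -> \bar R}) (@cbox R n a r) = (\prod_(i < n) (2 * r i))%:E.
Proof. exact: lebesgueRn_cbox. Qed.

Lemma integrable_indic_cbox (a r : 'I_n -> R) : (forall i, 0 <= r i) ->
  mu.-integrable setT (fun t => (\1_(@cbox R n a r) t)%:E).
Proof.
move=> r0; have mb := @measurable_cbox R n a r.
apply/integrableP; split; first exact/measurable_EFinP/measurable_indic.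
rewrite (eq_integral (fun t => (\1_(@cbox R n a r) t)%:E)); last first.
  by move=> t _; rewrite gee0_abs// lee_fin.
by rewrite integral_indic// setIT vol_cbox// ltry.
Qed.

Lemma integrable_box r (M : R) : 0 <= r -> mu.-integrable setT
  (fun t => (M * \1_(@cbox R n (fun=> 0) (fun=> r)) t)%:E).
Proof.
move=> r0; have := @integrable_indic_cbox (fun=> 0) (fun=> r) (fun=> r0).
move=> /(integrableZl measurableT M).
by apply: eq_integrable => // x _; rewrite EFinM.
Qed.

(** A bounded function vanishing outside a cube is dominated by a multiple of
    the indicator of the cube. *)
Lemma Cc_integrable f : Cc f -> mu.-integrable setT (EFin \o (f \o row_of)).
Proof.
move=> /[dup] cf [ctf [r r0 rf]]; have [M M0 hM] := Cc_bounded cf.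
apply: le_integrable (integrable_box M r0) => //.
  by apply/measurable_EFinP; exact: measurable_continuous_rV.
move=> t _ /=; rewrite lee_fin (ger0_norm (mulr_ge0 M0 _))// indicE.
case: (boolP (t \in _)); first by rewrite mulr1.
rewrite notin_setE cboxE//= => /negP; rewrite -ltNge => /rf ->.
by rewrite normr0 mulr0.
Qed.

Lemma integE f : integ f = Rintegral mu setT (f \o row_of).
Proof. by []. Qed.

Lemma integD f g : Cc f -> Cc g -> integ (fun x => f x + g x) = integ f + integ g.
Proof.
by move=> cf cg; rewrite !integE -RintegralD//; exact: Cc_integrable.
Qed.
Lemma integZ k f : Cc f -> integ (fun x => k * f x) = k * integ f.
Proof.
by move=> cf; rewrite !integE -RintegralZl//; exact: Cc_integrable.
Qed.
Lemma integN f : Cc f -> integ (fun x => - f x) = - integ f.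
Proof.
move=> cf; rewrite -mulN1r -integZ//; congr integ; apply/funext => x; by rewrite mulN1r.
Qed.
Lemma integB f g : Cc f -> Cc g -> integ (fun x => f x - g x) = integ f - integ g.
Proof. by move=> cf cg; rewrite integD ?integN//; exact: CcN. Qed.
Lemma integ0 : integ (fun=> 0) = 0.
Proof.
rewrite -[RHS](mul0r (integ (fun=> 0))) -integZ//; last exact: Cc0.
by congr integ; apply/funext => x; rewrite mul0r.
Qed.
Lemma integ_sum (J : Type) (s : seq J) (P : pred J) (F : J -> E -> R) :
  (forall j, P j -> Cc (F j)) -> integ (fun x => \sum_(j <- s | P j) F j x) = \sum_(j <- s | P j) integ (F j).
Proof.
move=> cF; elim: s => [|j s IH].
  by rewrite big_nil -[RHS]integ0; congr integ; apply/funext => x; rewrite big_nil.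
rewrite big_cons; case: ifP => Pj; last first.
  by rewrite -IH; congr integ; apply/funext => x; rewrite big_cons Pj.
rewrite -IH -integD//; [|exact: cF|exact: Cc_sum].
by congr integ; apply/funext => x; rewrite big_cons Pj.
Qed.
Lemma le_integ f g : Cc f -> Cc g -> (forall x, f x <= g x) -> integ f <= integ g.
Proof.
move=> cf cg fg; rewrite !integE; apply: le_Rintegral => //; exact: Cc_integrable.
Qed.
Lemma integ_ge0 f : (forall x, 0 <= f x) -> 0 <= integ f.
Proof. by move=> f0; apply: Rintegral_ge0 => t _ /=. Qed.

(** Boxes instead of cubes, because the cutoffs used against the weight in
    [dyadic_cover] are much longer along the axis than across it. *)
Lemma integ_le_box f (r : 'I_n -> R) M : Cc f -> 0 <= M -> (forall i, 0 <= r i) ->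
  (forall x, `|f x| <= M) -> (forall x i, r i < `|x 0 i| -> f x = 0) ->
  integ f <= M * \prod_i (2 * r i).
Proof.
move=> cf M0 r0 fM rf.
have mb := @measurable_cbox R n (fun=> 0) r.
have ii : mu.-integrable setT (fun t => (M * \1_(@cbox R n (fun=> 0) r) t)%:E).
  have := integrable_indic_cbox (fun=> 0) r0.
  move=> /(integrableZl measurableT M).
  by apply: eq_integrable => // x _; rewrite EFinM.
rewrite (_ : M * _ = Rintegral mu setT (fun t => M * \1_(@cbox R n (fun=> 0) r) t)).
  rewrite integE; apply: le_Rintegral => //; first exact: Cc_integrable.
  move=> t _ /=; rewrite indicE; case: (boolP (t \in _)) => [_|].
    by rewrite mulr1 (le_trans (ler_norm _)).
  rewrite notin_setE /cbox /= => /existsNP[i /negP]; rewrite -ltNge subr0 => h.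
  by rewrite (rf _ i) ?mulr0// mxE.
rewrite RintegralZl//; last exact: integrable_indic_cbox.
by rewrite /Rintegral integral_indic// setIT vol_cbox.
Qed.

Lemma norm_integ_le f r M : Cc f -> 0 <= r -> 0 <= M ->
  csupp r f -> (forall x, `|f x| <= M) -> `|integ f| <= M * (2 * r) ^+ n.
Proof.
move=> cf r0 M0 rf fM.
have h g : Cc g -> csupp r g -> (forall x, `|g x| <= M) -> integ g <= M * (2 * r) ^+ n.
  move=> cg rg gM; have := @integ_le_box g (fun=> r) M cg M0 (fun=> r0) gM.
  rewrite prodr_const card_ord; apply => x i xi; apply: rg.
  exact: lt_le_trans xi (coord_le_norm _ _).
have hN : integ (fun x => - f x) <= M * (2 * r) ^+ n.
  apply: h; [exact: CcN|by move=> x /rf ->; rewrite oppr0|].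
  by move=> x; rewrite normrN.
by rewrite ler_norml h// andbT lerNl -integN.
Qed.

(** Change of variables for the pushforward by a translation, under which
    [lebesgueRn] is invariant. *)
Lemma integ_shift f (a : E) : Cc f -> integ (fun x => f (x + a)) = integ f.
Proof.
move=> cf; rewrite /integ !intRnE; congr fine.
pose s := shift_tuple (fun i => a 0 i) : n.-tuple (measurableTypeR R) -> _.
have ms : measurable_fun setT s by exact: measurable_shift_tuple.
transitivity (\int[mu]_t ((EFin \o (f \o row_of)) \o s) t)%E.
  apply: eq_integral => t _ /=; congr ((f _)%:E).
  by apply/rowP => i; rewrite !mxE tnth_mktuple.
have csf := Cc_shift a cf.
have isf : mu.-integrable setT ((EFin \o (f \o row_of)) \o s).
  have := Cc_integrable csf; apply: eq_integrable => // t _ /=.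
  congr ((f _)%:E).
  by apply/rowP => i; rewrite !mxE tnth_mktuple.
have mf : measurable_fun setT (EFin \o (f \o row_of)).
  by apply/measurable_EFinP; apply: measurable_continuous_rV; case: cf.
rewrite -[LHS](@integral_pushforward _ _ _ _ _ s ms mu setT _ mf isf measurableT).
by apply: eq_measure_integral => A mA _; exact: lebesgueRn_shift.
Qed.

End fixed_dim.
End functions.

(** * C^1 functions and integrals of their derivatives *)

Section calc.
Context {R : realType}.

(** Differentiability without division, which suits functions whose increments
    are only estimated, such as [flat] at 0 and mollifications. *)
Lemma is_deriveP (V : normedModType R) (f : V -> R) (x v : V) (d : R) :
  (forall e : R, 0 < e -> exists2 r : R, 0 < r &
     forall h : R, h != 0 -> `|h| < r -> `|f (h *: v + x) - f x - h * d| <= e * `|h|) ->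
  is_derive x v f d.
Proof.
move=> H.
have lm : (fun h => h^-1 *: ((f \o shift x) (h *: v) - f x)) @ 0^' --> d.
  apply/cvgrPdist_le => e e0; have [r r0 hr] := H e e0.
  near=> h.
  have h0 : h != 0 by near: h; exact: nbhs_dnbhs_neq.
  have hlt : `|h| < r.
    near: h; apply: dnbhs0_lt => //.
  have := hr _ h0 hlt; rewrite /= => hh.
  rewrite (_ : d - _ = - (h^-1 * (f (h *: v + x) - f x - h * d))); last first.
    by rewrite /GRing.scale/=; field.
  rewrite normrN normrM normfV ler_pdivrMl ?normr_gt0// (mulrC _ e); exact: hh.
apply: DeriveDef; first by apply/cvg_ex; exists d.
exact/cvg_lim.
Unshelve. all: by end_near. Qed.

Lemma is_derive_line (V : normedModType R) (f : V -> R) (x v : V) (t d : R) :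
  is_derive (x + t *: v) v f d <-> is_derive t 1 (fun s => f (x + s *: v)) d.
Proof.
have E : (fun h : R => h^-1 *: ((f \o shift (x + t *: v)) (h *: v) - f (x + t *: v)))
  = (fun h => h^-1 *: (((fun s => f (x + s *: v)) \o shift t) (h *: 1) - f (x + t *: v))).
  apply/funext => h /=; congr (_ *: (f _ - _)).
  by rewrite [h%:A]mulr1 scalerDl addrCA.
by split=> -[]; rewrite /derivable /derive => h1 h2; apply: DeriveDef;
  rewrite /derivable /derive ?E// -E.
Qed.

Lemma is_derive_line0 (V : normedModType R) (f : V -> R) (x v : V) (d : R) :
  is_derive x v f d <-> is_derive (0 : R) (1 : R) (fun s : R => f (x + s *: v)) d.
Proof. by rewrite -is_derive_line scale0r addr0. Qed.

Lemma is_derive_comp1 (V : normedModType R) (f : V -> R) (g : R -> R) (x v : V) (d e : R) :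
  is_derive x v f d -> is_derive (f x) 1 g e -> is_derive x v (fun y => g (f y)) (e * d).
Proof.
move=> /is_derive_line0 h1 h2; apply/is_derive_line0.
apply: (@is_derive1_comp _ g (fun s => f (x + s *: v)) 0 e d) => //.
by rewrite scale0r addr0.
Qed.

Lemma is_derive_continuous (g : R -> R) (x d : R) : is_derive x 1 g d -> {for x, continuous g}.
Proof.
by move=> [h _]; apply: differentiable_continuous; apply/derivable1_diffP.
Qed.

Section fixed_dim.
Context {n : nat}.
Local Notation E := 'rV[R]_n.
Local Notation e_ i := (delta_mx (0 : 'I_1) i : E).
Implicit Types (f g : E -> R) (x y : E) (df dg : 'I_n -> E -> R).

(** The partial derivatives are part of the data, so that the rules of
    calculus produce closed formulas for them. *)
Definition C1_grad f df := [/\ continuous f,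
  forall i x, is_derive x (e_ i) f (df i x) & forall i, continuous (df i)].

Lemma C1_gradE f df i x : C1_grad f df -> partial i f x = df i x.
Proof. by move=> [_ h _]; apply: derive_val. Qed.

Lemma C1_grad_ext f df g dg : C1_grad f df -> f =1 g -> df =2 dg -> C1_grad g dg.
Proof.
move=> h fg dfg; rewrite (_ : g = f); last exact/funext.
rewrite (_ : dg = df)//; apply/funext => i; apply/funext => x; exact/esym.
Qed.

Lemma C1_gradC (c : R) : C1_grad (fun=> c) (fun _ _ => 0).
Proof.
split=> [|i x|i]; [exact: contC| |exact: contC].
exact: is_derive_cst.
Qed.

Lemma C1_gradD f df g dg : C1_grad f df -> C1_grad g dg ->
  C1_grad (fun x => f x + g x) (fun i x => df i x + dg i x).
Proof.
move=> [cf hf cdf] [cg hg cdg]; split=> [|i x|i]; [exact: contD| |exact: contD].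
exact: is_deriveD.
Qed.

Lemma C1_gradM f df g dg : C1_grad f df -> C1_grad g dg ->
  C1_grad (fun x => f x * g x) (fun i x => df i x * g x + f x * dg i x).
Proof.
move=> [cf hf cdf] [cg hg cdg]; split=> [|i x|i]; [exact: contM| |].
  have := @is_deriveM _ _ f g x (e_ i) _ _ (hf i x) (hg i x).
  by rewrite addrC [g x *: _]mulrC.
by apply: contD; apply: contM.
Qed.

Lemma C1_gradZ k f df : C1_grad f df -> C1_grad (fun x => k * f x) (fun i x => k * df i x).
Proof.
move=> h; apply: (C1_grad_ext (C1_gradM (C1_gradC k) h)) => // i x; by rewrite mul0r add0r.
Qed.

Lemma C1_gradN f df : C1_grad f df -> C1_grad (fun x => - f x) (fun i x => - df i x).
Proof.
move=> h; apply: (C1_grad_ext (C1_gradZ (-1) h)) => [x|i x]; by rewrite mulN1r.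
Qed.

Lemma C1_gradB f df g dg : C1_grad f df -> C1_grad g dg ->
  C1_grad (fun x => f x - g x) (fun i x => df i x - dg i x).
Proof. by move=> hf hg; exact: C1_gradD hf (C1_gradN hg). Qed.

Lemma C1_grad_sum (J : Type) (s : seq J) (P : pred J) (F : J -> E -> R) dF :
  (forall j, P j -> C1_grad (F j) (dF j)) ->
  C1_grad (fun x => \sum_(j <- s | P j) F j x) (fun i x => \sum_(j <- s | P j) dF j i x).
Proof.
move=> h; elim: s => [|j s IH].
  by apply: (C1_grad_ext (C1_gradC 0)) => [x|i x]; rewrite big_nil.
case Pj : (P j).
  by apply: (C1_grad_ext (C1_gradD (h _ Pj) IH)) => [x|i x]; rewrite big_cons Pj.
by apply: (C1_grad_ext IH) => [x|i x]; rewrite big_cons Pj.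
Qed.

Lemma C1_grad_coord i : C1_grad (fun x => x 0 i) (fun j _ => (j == i)%:R).
Proof.
split=> [|j x|j]; [exact: cont_coord| |exact: contC].
apply: is_deriveP => e e0; exists 1 => // h _ _.
rewrite !mxE eqxx/= (eq_sym j) addrK subrr normr0.
by rewrite mulr_ge0// ltW.
Qed.

Lemma C1_grad_comp (g g' : R -> R) f df : C1_grad f df ->
  (forall x, is_derive (f x) 1 g (g' (f x))) -> continuous (fun x => g' (f x)) ->
  C1_grad (fun x => g (f x)) (fun i x => g' (f x) * df i x).
Proof.
move=> [cf hf cdf] hg cg'; split=> [x|i x|i].
- apply: (@continuous_comp _ _ _ f g); first exact: cf.
  exact: is_derive_continuous (hg x).
- exact: is_derive_comp1.
- exact: contM.
Qed.

Lemma C1_grad_sqr f df : C1_grad f df -> C1_grad (fun x => f x ^+ 2) (fun i x => 2 * f x * df i x).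
Proof.
move=> h; apply: (C1_grad_ext (C1_gradM h h)) => [x|i x]; rewrite ?expr2//; ring.
Qed.

Lemma C1_gradV f df : C1_grad f df -> (forall x, f x != 0) ->
  C1_grad (fun x => (f x)^-1) (fun i x => - (f x ^+ 2)^-1 * df i x).
Proof.
move=> h f0; have [cf _ _] := h.
refine (@C1_grad_comp (fun z : R => z^-1) (fun z : R => - (z ^+ 2)^-1) f df h _ _).
  move=> x; have := @is_deriveV _ id (f x) 1 1 (f0 x) _.
  rewrite /GRing.scale /= mulr1; apply; exact: is_derive_id.
apply: contN; apply: contV; last exact: contX.
by move=> x; rewrite expf_neq0.
Qed.

Lemma C1_grad_sqrt f df : C1_grad f df -> (forall x, 0 < f x) ->
  C1_grad (fun x => Num.sqrt (f x)) (fun i x => (2 * Num.sqrt (f x))^-1 * df i x).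
Proof.
move=> h f0; have [cf _ _] := h.
refine (@C1_grad_comp Num.sqrt (fun z : R => (2 * Num.sqrt z)^-1) f df h _ _).
  by move=> x; exact: is_derive1_sqrt.
apply: contV => [x|]; first by rewrite mulf_neq0// gt_eqF// sqrtr_gt0.
apply: contM; first exact: contC.
by apply: cont_comp => //; exact: sqrt_continuous.
Qed.

Lemma C1_grad_exp f df : C1_grad f df ->
  C1_grad (fun x => expR (f x)) (fun i x => expR (f x) * df i x).
Proof.
move=> h; have [cf _ _] := h; refine (@C1_grad_comp expR expR f df h _ _).
by apply: cont_comp => //; exact: continuous_expR.
Qed.

Lemma C1_grad_coord_comp (g g' : R -> R) i : (forall t : R, is_derive t 1 g (g' t)) -> continuous g' ->
  C1_grad (fun x : E => g (x 0 i)) (fun j x => g' (x 0 i) * (j == i)%:R).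
Proof.
move=> hg cg'; apply: (C1_grad_comp (C1_grad_coord i)) => //.
by apply: cont_comp => //; exact: cont_coord.
Qed.

Lemma norm_e i : `|e_ i| <= 1.
Proof.
rewrite ler_norm_rV//; apply/forallP => j; rewrite mxE.
by case: (_ && _); rewrite ?normr1 ?normr0.
Qed.

Lemma norm_he i (h : R) : `|h *: e_ i| <= `|h|.
Proof. by rewrite normrZ ler_piMr// norm_e. Qed.

(** The increment h may have either sign; hence the intermediate point is
    located only by |t| <= |h|. *)
Lemma MVT_dir f df i x (h : R) : C1_grad f df ->
  exists2 t, `|t| <= `|h| & f (x + h *: e_ i) - f x = df i (x + t *: e_ i) * h.
Proof.
move=> [cf hf cdf].
have hl (t : R) : is_derive t 1 (fun s => f (x + s *: e_ i)) (df i (x + t *: e_ i)).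
  exact: (is_derive_line f x (e_ i) t _).1 (hf i _).
have cl : continuous (fun s : R => f (x + s *: e_ i)).
  by move=> t; exact: is_derive_continuous (hl t).
have [h0|h0] := leP 0 h.
  have [c] := @MVT_segment R _ _ 0 h h0 (fun t _ => hl t) (continuous_subspaceT cl).
  rewrite in_itv/= => /andP[c0 ch] Ec; exists c; first by rewrite !ger0_norm.
  by move: Ec; rewrite scale0r addr0 subr0.
have [c] := @MVT_segment R _ _ h 0 (ltW h0) (fun t _ => hl t) (continuous_subspaceT cl).
rewrite in_itv/= => /andP[ch c0] Ec; exists c; first by rewrite !ler0_norm ?lerN2// ltW.
by move: Ec; rewrite scale0r addr0 sub0r mulrN => /(congr1 -%R); rewrite opprB opprK.
Qed.

(** Off the closed cube a function supported in it vanishes on a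
    neighbourhood. *)
Lemma C1_grad_csupp f df r i : C1_grad f df -> csupp r f -> csupp r (df i).
Proof.
move=> [cf hf cdf] rf x rx.
have h : is_derive x (e_ i) (fun=> 0) (df i x).
  apply: near_eq_is_derive (hf i x).
  have : \forall y \near x, r < `|y|.
    have : (fun y : E => `|y|) @ x --> `|x| by exact: norm_continuous.
    by move/cvgr_gt; apply.
  by apply: filterS => y /rf.
by rewrite -(@derive_val _ _ _ _ _ _ _ h) derive_cst.
Qed.

Lemma C1_grad_Cc f df i : C1_grad f df -> Cc f -> Cc (df i).
Proof.
move=> h [_ [r r0 rf]]; split; first by case: h.
by exists r => //; exact: C1_grad_csupp rf.
Qed.

(** Small errors are tested only for e <= 1, so that higher powers of e can be
    absorbed into the linear bound. *)
Lemma small_eq0 (a c : R) : 0 <= c -> (forall e, 0 < e -> e <= 1 -> `|a| <= c * e) -> a = 0.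
Proof.
move=> c0 h; apply/eqP; rewrite -normr_le0 leNgt; apply/negP => a0.
pose e := Num.min 1 (`|a| / (2 * (c + 1))).
have d0 : 0 < `|a| / (2 * (c + 1)) by apply: divr_gt0 => //; lra.
have := h e; rewrite /e lt_min ltr01 d0 ge_min lexx => /(_ isT isT) h1.
have h2 : c * Num.min 1 (`|a| / (2 * (c + 1))) <= c * (`|a| / (2 * (c + 1))).
  by apply: ler_wpM2l => //; rewrite ge_min lexx orbT.
have h3 : c * (`|a| / (2 * (c + 1))) <= `|a| / 2.
  rewrite mulrCA ler_wpM2l// ler_pdivrMr; last lra.
  lra.
lra.
Qed.

(** By translation invariance the difference quotients of f have integral 0,
    and they converge uniformly to the partial derivative, with supports in a
    common cube. *)
Lemma integ_grad0 f df i : C1_grad f df -> Cc f -> integ (df i) = 0.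
Proof.
move=> hf /[dup] cf [_ [r r0 rf]]; have cdf := C1_grad_Cc i hf cf.
apply: (@small_eq0 _ ((2 * (r + 1)) ^+ n)).
  by rewrite exprn_ge0//; lra.
move=> e e0 _; have [d d0 hd] := Cc_unif cdf e0.
(* The bound h <= 1 keeps the shifted support in the cube of radius r + 1. *)
pose h := Num.min (d / 2) 1.
have h0 : 0 < h by rewrite lt_min ltr01 andbT; lra.
have h1 : h <= 1 by rewrite ge_min lexx orbT.
have hd2 : h <= d / 2 by rewrite ge_min lexx.
have cs := Cc_shift (h *: e_ i) cf.
have E1 : integ (fun x => h^-1 * (f (x + h *: e_ i) - f x)) = 0.
  by rewrite integZ ?integB ?integ_shift ?subrr ?mulr0//; exact: CcB.
have cq : Cc (fun x => h^-1 * (f (x + h *: e_ i) - f x)) by apply: CcZ; exact: CcB.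
rewrite -[integ _]subr0 -E1 -integB// mulrC; apply: norm_integ_le.
- exact: CcB.
- lra.
- exact: ltW.
- move=> x xr; have rfx : f x = 0 by apply: rf; lra.
  have rfs : f (x + h *: e_ i) = 0.
    apply: rf; have := ler_normB (x + h *: e_ i) (h *: e_ i); have := norm_he i h.
    rewrite addrK (ger0_norm (ltW h0)); lra.
  by rewrite (C1_grad_csupp i hf rf) ?rfx ?rfs ?subrr ?mulr0 ?subr0//; lra.
- move=> x; have [t th ->] := MVT_dir i x h hf.
  rewrite mulrC mulfK ?gt_eqF//; apply/ltW/hd.
  rewrite opprD addrA subrr sub0r normrN (le_lt_trans (norm_he _ _))//.
  by move: th; rewrite (ger0_norm (ltW h0)); lra.
Qed.

(** A positive value at a point bounds f from below on a box around it, and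
    boxes have positive volume. *)
Lemma integ_eq0 f : Cc f -> (forall x, 0 <= f x) -> integ f = 0 -> forall x, f x = 0.
Proof.
move=> cf f0 If x0; apply/eqP; rewrite eq_le f0 andbT leNgt; apply/negP => fx0.
have [d d0 hd] := Cc_unif cf (divr_gt0 fx0 (ltr0Sn R 1)).
have mb := @measurable_cbox R n (fun i => x0 0 i) (fun=> d / 2).
have d2 : 0 <= d / 2 by lra.
have ii := @integrable_indic_cbox R n (fun i => x0 0 i) (fun=> d / 2) (fun=> d2).
have : f x0 / 2 * \prod_(i < n) (2 * (d / 2)) <= integ f.
  rewrite (_ : _ * _ = Rintegral (@lebesgueRn R n) setT
      (fun t => f x0 / 2 * \1_(@cbox R n (fun i => x0 0 i) (fun=> d / 2)) t)).
    rewrite integE; apply: le_Rintegral => //; [|exact: Cc_integrable|].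
      by have := integrableZl measurableT (f x0 / 2) ii; apply: eq_integrable => // t _; rewrite EFinM.
    move=> t _ /=; rewrite indicE; case: (boolP (t \in _)) => [|_]; last first.
      by rewrite mulr0 f0.
    rewrite inE /cbox/= => ht; rewrite mulr1.
    have : `|x0 - row_of t| < d.
      rewrite ltr_norm_rV//; apply/forallP => i; rewrite !mxE distrC.
      by have := ht i; lra.
    move=> /hd; rewrite ltr_norml; lra.
  by rewrite RintegralZl// /Rintegral integral_indic// setIT vol_cbox.
rewrite If leNgt => /negP; apply; apply: mulr_gt0; first lra.
by apply: prodr_gt0 => i _; lra.
Qed.

End fixed_dim.
End calc.

(** * Smooth functions of one variable with compact support *)

Section flat.
Context {R : realType}.

(** The polynomial makes this family stable under differentiation: the
    derivative of P(1/x) exp(-1/x) is Q(1/x) exp(-1/x) with Q = X^2 (P -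
    P'). *)
Definition flat (P : {poly R}) (x : R) : R :=
  if 0 < x then P.[x^-1] * expR (- x^-1) else 0.

Lemma horner_growth (P : {poly R}) :
  exists C N, 0 <= C /\ forall y : R, 1 <= y -> `|P.[y]| <= C * y ^+ N.
Proof.
elim/poly_ind: P => [|P c [C [N [C0 h]]]].
  by exists 0, 0%N; split=> // y _; rewrite horner0 normr0 mul0r.
exists (C + `|c|), N.+1; split; first by rewrite addr_ge0.
move=> y y1; rewrite hornerMXaddC (le_trans (ler_normD _ _))//.
have y0 : 0 <= y by lra.
rewrite mulrDl lerD//.
  by rewrite normrM (ger0_norm y0) exprSr mulrA ler_wpM2r// h.
by rewrite ler_peMr// exprn_ege1.
Qed.

(** Raise exp (y / m) >= 1 + y / m >= y / m to the power m. *)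
Lemma expR_decay (m : nat) (y : R) : 0 < y -> expR (- y) * y ^+ m <= m%:R ^+ m.
Proof.
case: m => [|m] y0; first by rewrite !expr0 mulr1 expR_le1 oppr_le0 ltW.
have h : (y / m.+1%:R) ^+ m.+1 <= expR y.
  have m0 : m.+1%:R != 0 :> R by rewrite pnatr_eq0.
  rewrite -[X in expR X](divfK m0 y) (mulrC (y / _)) expRM_natl lerXn2r// ?nnegrE ?expR_ge0 ?divr_ge0 ?(ltW y0)//.
  apply: le_trans (expR_ge1Dx _); set z := y / _; lra.
rewrite expRN ler_pdivrMl ?expR_gt0//.
move: h; rewrite expr_div_n ler_pdivrMr ?exprn_gt0//.
Qed.

(** Being O(x^2) is what makes the derivative at 0 exist and vanish. *)
Lemma flat_small (P : {poly R}) : exists2 C, 0 <= C &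
  forall x, `|x| <= 1 -> `|flat P x| <= C * x ^+ 2.
Proof.
have [C [N [C0 h]]] := horner_growth P.
exists (C * N.+2%:R ^+ N.+2); first by rewrite mulr_ge0// exprn_ge0.
move=> x x1; rewrite /flat; case: ifPn => [x0|_]; last first.
  by rewrite normr0; apply: mulr_ge0; [apply: mulr_ge0 => //; exact: exprn_ge0|exact: sqr_ge0].
have y0 : 0 < x^-1 by rewrite invr_gt0.
have y1 : 1 <= x^-1 by rewrite invf_ge1//; move: x1; rewrite gtr0_norm.
rewrite normrM (gtr0_norm (expR_gt0 _)).
apply: (le_trans (ler_wpM2r (expR_ge0 _) (h _ y1))).
rewrite [leLHS](_ : _ = C * (expR (- x^-1) * x^-1 ^+ N.+2) * x ^+ 2).
  by rewrite ler_wpM2r ?sqr_ge0// ler_wpM2l// expR_decay.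
by rewrite !exprS; field; rewrite gt_eqF.
Qed.

Lemma is_derive_flat (P : {poly R}) (x : R) :
  is_derive x (1 : R) (flat P) (flat ('X^2 * (P - P^`())) x).
Proof.
have [x0|x0|->] := ltgtP x 0.
- rewrite /flat (lt_gtF x0).
  apply: (near_eq_is_derive (f := fun=> 0)).
  near=> z; rewrite ifF//; apply/negbTE; rewrite -leNgt ltW//.
  by near: z; exact: lt_nbhsl.
- suff h : is_derive x (1 : R) (fun z : R => P.[z^-1] * expR (- z^-1))
      (flat ('X^2 * (P - P^`())) x).
    apply: (near_eq_is_derive _ h); near=> z; rewrite /flat ifT//.
    by near: z; exact: lt_nbhsr.
  rewrite /flat x0.
  have hV : is_derive x (1 : R) (fun z : R => z^-1) (- x ^- 2).
    have := @is_deriveV _ id x 1 1 (lt0r_neq0 x0) (is_derive_id _ _).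
    by rewrite /GRing.scale /= mulr1.
  have h1 : is_derive x (1 : R) (fun z => P.[z^-1]) (P^`().[x^-1] * (- x ^- 2)).
    by apply: (is_derive_comp1 (f := fun z : R => z^-1)); exact: hV.
  have h2 : is_derive x (1 : R) (fun z => expR (- z^-1)) (expR (- x^-1) * (x ^- 2)).
    apply: (is_derive_comp1 (f := fun z : R => - z^-1)).
    by rewrite -[x ^- 2]opprK; apply: is_deriveN.
  have h := @is_deriveM _ _ _ _ _ _ _ _ h1 h2.
  apply: is_derive_eq h _.
  rewrite /GRing.scale/= hornerM hornerXn hornerD hornerN exprVn.
  ring.
- have [C C0 hC] := flat_small P.
  rewrite {2}/flat ltxx; apply: is_deriveP => e e0.
  exists (Num.min 1 (e / (C + 1))); first by rewrite lt_min ltr01 divr_gt0//; lra.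
  move=> h h0; rewrite lt_min => /andP[h1 h2].
  rewrite [h *: 1]mulr1 addr0 mulr0 subr0 {2}/flat ltxx subr0.
  apply: le_trans (hC _ (ltW h1)) _.
  rewrite -normr_id -[h ^+ 2]ger0_norm ?sqr_ge0// normrX normr_id expr2 mulrA ler_wpM2r//.
  move: h2; rewrite ltr_pdivlMr; last by lra.
  by have := normr_ge0 h; nra.
Unshelve. all: by end_near. Qed.

(** An algebra of functions that is closed under differentiation and contains
    the bumps [bumpf]; membership stands for smoothness in one variable. *)
Inductive flat_alg : (R -> R) -> Prop :=
| flat_alg_flat P a b : flat_alg (fun x => flat P (a * x + b))
| flat_alg_add f g : flat_alg f -> flat_alg g -> flat_alg (fun x => f x + g x)
| flat_alg_mul f g : flat_alg f -> flat_alg g -> flat_alg (fun x => f x * g x).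

Lemma flat_alg_derive f : flat_alg f -> exists2 g, flat_alg g & forall x : R, is_derive x (1 : R) f (g x).
Proof.
elim=> [P a b|{}f g _ [f' sf hf] _ [g' sg hg]|{}f g sf [f' sf' hf] sg [g' sg' hg]].
- exists (fun x => flat (a *: ('X^2 * (P - P^`()))) (a * x + b)); first exact: flat_alg_flat.
  move=> x.
  have hl : is_derive x (1 : R) (fun z => a * z + b) a.
    have h1 := @is_deriveZ _ _ _ id a x 1 1 (is_derive_id _ _).
    have := @is_deriveD _ _ _ _ _ _ _ _ _ h1 (is_derive_cst b x (1 : R)).
    by rewrite /GRing.scale/= mulr1 addr0.
  have := is_derive_comp1 hl (is_derive_flat P (a * x + b)).
  by rewrite /flat; case: ifP => _; rewrite ?mul0r// hornerZ mulrC mulrA.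
- exists (fun x => f' x + g' x); first exact: flat_alg_add.
  by move=> x; exact: is_deriveD.
- exists (fun x => f' x * g x + f x * g' x); first by apply: flat_alg_add; exact: flat_alg_mul.
  move=> x; have := @is_deriveM _ _ _ _ _ _ _ _ (hf x) (hg x).
  by rewrite addrC [g x *: _]mulrC.
Qed.

Lemma flat_alg_derive1 f : flat_alg f -> flat_alg (derive1 f) /\ forall x : R, is_derive x (1 : R) f (derive1 f x).
Proof.
move=> /flat_alg_derive[g sg hg]; have -> : derive1 f = g.
  by apply/funext => x; rewrite derive1E; apply: derive_val.
by [].
Qed.

Lemma flat_alg_continuous f : flat_alg f -> continuous f.
Proof. by move=> /flat_alg_derive[g _ hg] x; exact: is_derive_continuous (hg x). Qed.

(** One factor is positive for x < h, the other for x > - h. *)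
Definition bumpf (h x : R) := flat 1 ((- h^-1) * x + 1) * flat 1 (h^-1 * x + 1).

Lemma bumpf_flat_alg h : flat_alg (bumpf h).
Proof. by apply: flat_alg_mul; exact: flat_alg_flat. Qed.

Lemma flat1_ge0 x : 0 <= flat 1 x.
Proof. by rewrite /flat; case: ifP => // _; rewrite hornerC mul1r expR_ge0. Qed.

Lemma bumpf_ge0 h x : 0 <= bumpf h x.
Proof. by rewrite mulr_ge0// flat1_ge0. Qed.

Lemma bumpf_supp h x : 0 < h -> h < `|x| -> bumpf h x = 0.
Proof.
move=> h0; rewrite lter_normr => /orP[hx|hx]; rewrite /bumpf.
  rewrite {1}/flat ifF ?mul0r//; apply/negbTE; rewrite -leNgt.
  have : 1 < h^-1 * x by rewrite ltr_pdivlMl// mulr1.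
  lra.
rewrite {2}/flat ifF ?mulr0//; apply/negbTE; rewrite -leNgt.
have : 1 < h^-1 * - x by rewrite ltr_pdivlMl// mulr1.
lra.
Qed.

Lemma bumpf0 h : 0 < bumpf h 0.
Proof. by rewrite /bumpf !mulr0 add0r /flat ltr01 hornerC mul1r mulr_gt0 ?expR_gt0. Qed.

End flat.

(** * Mollification of continuous compactly supported functions *)

Section mollification.
Context {R : realType} {n : nat}.
Local Notation E := 'rV[R]_n.
Local Notation e_ i := (delta_mx (0 : 'I_1) i : E).
Implicit Types (f g : E -> R) (df dg : 'I_n -> E -> R).

(** Kernels of product form: a partial derivative acts on one factor only, so
    partial derivatives stay of this form and visibly commute. *)
Definition tensor (B : 'I_n -> R -> R) (x : E) : R := \prod_i B i (x 0 i).

Definition derive_at (j : 'I_n) (B : 'I_n -> R -> R) : 'I_n -> R -> R :=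
  fun l => if l == j then derive1 (B l) else B l.

Lemma cont_prod (J : Type) (s : seq J) (F : J -> E -> R) :
  (forall j, continuous (F j)) -> continuous (fun x => \prod_(j <- s) F j x).
Proof.
move=> cF; elim: s => [|j s IH].
  rewrite (_ : (fun _ => _) = (fun=> 1)); first exact: contC.
  by apply/funext => x; rewrite big_nil.
rewrite (_ : (fun _ => _) = (fun x => F j x * \prod_(j <- s) F j x)).
  by apply: contM.
by apply/funext => x; rewrite big_cons.
Qed.

Lemma flat_alg_derive_at j B : (forall i, flat_alg (B i)) -> forall i, flat_alg (derive_at j B i).
Proof. by move=> h i; rewrite /derive_at; case: ifP => // _; apply: (flat_alg_derive1 (h i)).1. Qed.

Lemma tensor_C1_grad (B B' : 'I_n -> R -> R) :
  (forall i (t : R), is_derive t (1 : R) (B i) (B' i t)) -> (forall i, continuous (B' i)) ->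
  C1_grad (tensor B) (fun j => tensor (fun l => if l == j then B' l else B l)).
Proof.
move=> hB cB'.
have cB C : (forall i, continuous (C i)) -> continuous (tensor C).
  by move=> hC; apply: cont_prod => i; apply: cont_comp; [exact: hC|exact: cont_coord].
have ctB i : continuous (B i) by move=> t; exact: is_derive_continuous (hB i t).
split=> [|j x|j]; [exact: cB| |by apply: cB => i; case: ifP].
pose c := \prod_(i | i != j) B i (x 0 i).
apply/is_derive_line0.
rewrite (_ : (fun s : R => _) = (fun s : R => c * B j (x 0 j + s))); last first.
  apply/funext => s; rewrite /tensor (bigD1 j)//= mulrC !mxE !eqxx mulr1; congr (_ * _).
  by apply: eq_bigr => i ij; rewrite !mxE eqxx (negPf ij) mulr0 addr0.
rewrite (_ : tensor _ x = c * B' j (x 0 j)); last first.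
  rewrite /tensor (bigD1 j)//= mulrC eqxx; congr (_ * _).
  by apply: eq_bigr => i ij; rewrite (negPf ij).
have h : is_derive (0 : R) (1 : R) (fun s : R => B j (x 0 j + s)) (B' j (x 0 j)).
  have := hB j (x 0 j) => /is_derive_line0.
  by rewrite (_ : (fun s => _) = (fun s => B j (x 0 j + s)))//;
    apply/funext => s; rewrite [s *: 1]mulr1.
exact: is_deriveZ.
Qed.

Lemma tensor_flat_alg B : (forall i, flat_alg (B i)) -> C1_grad (tensor B) (fun j => tensor (derive_at j B)).
Proof.
move=> hB; apply: tensor_C1_grad => i; first by have [_] := flat_alg_derive1 (hB i).
by have [h _] := flat_alg_derive1 (hB i); exact: flat_alg_continuous.
Qed.

Lemma derive_atC i j B : derive_at i (derive_at j B) = derive_at j (derive_at i B).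
Proof.
apply/funext => l; rewrite /derive_at.
by case: (l == i); case: (l == j).
Qed.

Lemma C1_grad_shift f df (a : E) : C1_grad f df -> C1_grad (fun x => f (x + a)) (fun i x => df i (x + a)).
Proof.
move=> [cf hf cdf].
split=> [|i x|i]; [exact: cont_shift| |exact: cont_shift].
apply/is_derive_line0; have /is_derive_line0 := hf i (x + a).
by rewrite (_ : (fun s : R => f (x + a + s *: e_ i)) = (fun s : R => f (x + s *: e_ i + a)))//;
  apply/funext => s; rewrite addrAC.
Qed.

(** The kernel is reflected and not normalized: P is evaluated at y - x, which
    is responsible for the sign in [mollify_C1_grad], and [mollify_approx]
    carries the factor [integ P]. *)
Definition mollify f (P : E -> R) (x : E) : R := integ (fun y => f y * P (y - x)).

Lemma Cc_mollify_integrand f P x : Cc f -> Cc P -> Cc (fun y => f y * P (y - x)).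
Proof. by move=> cf cP; apply: CcMl => //; case: (Cc_shift (- x) cP). Qed.

Lemma ex_small_factor (M V e : R) : 0 <= M -> 0 <= V -> 0 < e -> exists2 q, 0 < q & M * q * V <= e.
Proof.
move=> M0 V0 e0; exists (e / ((M + 1) * (V + 1))).
  by rewrite divr_gt0// mulr_gt0//; lra.
rewrite mulrA mulrAC ler_pdivrMr; last by rewrite mulr_gt0//; lra.
rewrite mulrAC [in leLHS]mulrC ler_wpM2l ?(ltW e0)//; nra.
Qed.

Lemma mollify_cont f P : Cc f -> Cc P -> continuous (mollify f P).
Proof.
move=> cf cP x; have [M M0 hM] := Cc_bounded cf.
have [ctf [r r0 rf]] := cf.
pose V := (2 * r) ^+ n; have V0 : 0 <= V by rewrite exprn_ge0//; lra.
apply: (iffRL (@cvgrPdist_le R _ E (nbhs x) _ (mollify f P) (mollify f P x))) => e e0.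
have [q q0 hq] := ex_small_factor M0 V0 e0.
have [d d0 hd] := Cc_unif cP q0.
apply/nbhs_ballP; exists d => //= z; rewrite -ball_normE /= => xz.
rewrite -integB; [|exact: Cc_mollify_integrand|exact: Cc_mollify_integrand].
apply: le_trans hq; apply: norm_integ_le => //.
- by apply: CcB; exact: Cc_mollify_integrand.
- by rewrite mulr_ge0// ltW.
- by move=> y /rf ->; rewrite !mul0r subrr.
- move=> y; rewrite -mulrBr normrM ler_pM//; apply/ltW/hd.
  by rewrite opprB addrC addrA subrK distrC.
Qed.

(** By the mean value theorem the difference quotients of P (y - x) in x are
    uniformly close to its derivative, and f is bounded with compact
    support. *)
Lemma mollify_C1_grad f P dP : Cc f -> C1_grad P dP -> Cc P ->
  C1_grad (mollify f P) (fun i x => - mollify f (dP i) x).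
Proof.
move=> cf hP cP; have cdP i := C1_grad_Cc i hP cP.
split=> [|i x|i]; [exact: mollify_cont| |by apply: contN; exact: mollify_cont].
have [M M0 hM] := Cc_bounded cf; have [ctf [r r0 rf]] := cf.
pose V := (2 * r) ^+ n; have V0 : 0 <= V by rewrite exprn_ge0//; lra.
apply: is_deriveP => e e0.
have [q q0 hq] := ex_small_factor M0 V0 e0.
have [d d0 hd] := Cc_unif (cdP i) q0.
exists d => // h h0 hlt.
have cq : Cc (fun y => h * (f y * dP i (y - x))) by apply: CcZ; exact: Cc_mollify_integrand.
rewrite mulrN opprK -integB; [|exact: Cc_mollify_integrand|exact: Cc_mollify_integrand].
rewrite -integZ; last exact: Cc_mollify_integrand.
rewrite -integD//; last by apply: CcB; exact: Cc_mollify_integrand.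
apply: le_trans (ler_wpM2r (normr_ge0 h) hq).
rewrite mulrAC; apply: norm_integ_le => //.
- by apply: CcD => //; apply: CcB; exact: Cc_mollify_integrand.
- by rewrite !mulr_ge0// ltW.
- by move=> y /rf ->; rewrite !mul0r subrr mulr0 addr0.
- move=> y; rewrite -mulrBr mulrCA -mulrDr normrM -mulrA ler_pM//.
  have [t th] := MVT_dir i (y - x) (- h) hP.
  rewrite scaleNr -addrA -opprD (addrC x) => ->.
  rewrite mulrN addrC mulrC -mulrBl normrM ler_wpM2r//.
  apply/ltW/hd; rewrite opprD addrA subrr sub0r normrN.
  by apply: le_lt_trans (norm_he _ _) _; apply: le_lt_trans th _; rewrite normrN.
Qed.

(** The integral over y of the derivative of f(y) P(y - x) vanishes. *)
Lemma mollify_parts f df P dP i : C1_grad f df -> Cc f -> C1_grad P dP -> Cc P ->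
  forall x, - mollify f (dP i) x = mollify (df i) P x.
Proof.
move=> hf cf hP cP x; have cdP := C1_grad_Cc i hP cP; have cdf := C1_grad_Cc i hf cf.
have h := C1_gradM hf (C1_grad_shift (- x) hP).
have /eqP := integ_grad0 i h (Cc_mollify_integrand x cf cP).
rewrite integD; [|exact: Cc_mollify_integrand|exact: Cc_mollify_integrand].
by rewrite addr_eq0 /mollify => /eqP ->.
Qed.

Lemma mollify_approx f P e r : Cc f -> Cc P -> 0 <= r -> csupp r P -> (forall x, 0 <= P x) ->
  (forall x y, `|x - y| <= r -> `|f x - f y| <= e) ->
  forall x, `|mollify f P x - integ P * f x| <= e * integ P.
Proof.
move=> cf cP r0 rP P0 fe x.
have e0 : 0 <= e by have := fe x x; rewrite !subrr !normr0; exact.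
have cs := Cc_shift (- x) cP.
rewrite -(integ_shift (- x) cP) mulrC -!integZ// -integB//; [|exact: Cc_mollify_integrand|exact: CcZ].
have hle y : `|f y * P (y - x) - f x * P (y - x)| <= e * P (y - x).
  rewrite -mulrBl normrM (ger0_norm (P0 _)).
  have [h|h] := leP `|y - x| r; first by rewrite ler_wpM2r// fe.
  by rewrite rP// !mulr0.
rewrite ler_norml; apply/andP; split.
  rewrite lerNl -integN; last by apply: CcB; [exact: Cc_mollify_integrand|exact: CcZ].
  apply: le_integ; [by apply: CcN; apply: CcB; [exact: Cc_mollify_integrand|exact: CcZ]|exact: CcZ|].
  by move=> y; have := hle y; rewrite ler_norml lerNl => /andP[].
apply: le_integ; [by apply: CcB; [exact: Cc_mollify_integrand|exact: CcZ]|exact: CcZ|].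
by move=> y; have := hle y; rewrite ler_norml => /andP[].
Qed.

Lemma mollify_csupp f P r s : csupp r f -> csupp s P -> csupp (r + s) (mollify f P).
Proof.
move=> rf sP x xr; rewrite /mollify -[RHS](@integ0 R n); congr integ; apply/funext => y.
have [h|/rf ->] := leP `|y| r; last by rewrite mul0r.
rewrite sP ?mulr0//; have := ler_normB y (y - x); rewrite opprB addrC subrK; lra.
Qed.

(** The function f is kept while the kernel may be differentiated, which makes
    this class stable under all partial derivatives ([mollified_C1_grad]). *)
Definition mollified (phi : E -> R) : Prop := exists f, Cc f /\
  exists B (c : R), [/\ forall i, flat_alg (B i), Cc (tensor B) & phi = (fun x => c * mollify f (tensor B) x)].

Lemma mollified_C1_grad phi : mollified phi ->
  [/\ C1_grad phi (fun i => partial i phi), forall i, mollified (partial i phi) &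
      forall i j, partial i (partial j phi) = partial j (partial i phi)].
Proof.
have key f B c : Cc f -> (forall i, flat_alg (B i)) -> Cc (tensor B) ->
    C1_grad (fun x => c * mollify f (tensor B) x)
      (fun i => (fun x => - c * mollify f (tensor (derive_at i B)) x)).
  move=> cf sB cB; have h := mollify_C1_grad cf (tensor_flat_alg sB) cB.
  by apply: (C1_grad_ext (C1_gradZ c h)) => // i x; rewrite mulrN mulNr.
move=> [f [cf [B [c [sB cB ->]]]]]; have h := key f B c cf sB cB.
have E1 i : partial i (fun x => c * mollify f (tensor B) x) =
    (fun x => - c * mollify f (tensor (derive_at i B)) x).
  by apply/funext => x; rewrite (C1_gradE i x h).
have cBi i : Cc (tensor (derive_at i B)) := C1_grad_Cc i (tensor_flat_alg sB) cB.
split.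
- by apply: (C1_grad_ext h) => // i x; rewrite E1.
- move=> i; exists f; split=> //; exists (derive_at i B), (- c); split=> //.
  exact: flat_alg_derive_at.
- move=> i j; rewrite !E1; apply/funext => x.
  rewrite (C1_gradE i x (key f _ _ cf (flat_alg_derive_at j sB) (cBi j))).
  rewrite (C1_gradE j x (key f _ _ cf (flat_alg_derive_at i sB) (cBi i))).
  by rewrite derive_atC.
Qed.

Lemma mollified_Cinfty phi : mollified phi -> Cinfty phi.
Proof.
move=> h k; have hs s : mollified (iter_partial s phi).
  by elim: s => //= i s IH; have [_ + _] := mollified_C1_grad IH; apply.
split=> [s _|s _ i x]; first by have [[]] := mollified_C1_grad (hs s).
by have [[_ /(_ i x)[+ _] _] _ _] := mollified_C1_grad (hs s).
Qed.

Lemma csupp_compact f r : csupp r f -> compact (supp f).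
Proof.
move=> rf; apply: (subclosed_compact _ (@cube_compact R n r)); first exact: closed_closure.
rewrite [X in _ `<=` X](iffLR (closure_id _) (@cube_closed R n r)); apply: closureS => x /= fx.
by rewrite leNgt; apply: contra_neqN fx => /rf.
Qed.

End mollification.

(** * Stability and the linearized equation against C^1 test functions *)

Section weak.
Context {R : realType} {n : nat}.
Local Notation E := 'rV[R]_n.
Local Notation e_ i := (delta_mx (0 : 'I_1) i : E).
Implicit Types (f g : E -> R) (df dg : 'I_n -> E -> R).

Lemma small_ge0 (a c : R) : 0 <= c -> (forall e, 0 < e -> e <= 1 -> - (c * e) <= a) -> 0 <= a.
Proof.
move=> c0 h; rewrite leNgt; apply/negP => a0.
suff : Num.min a 0 = 0 by rewrite minElt a0 => aa; rewrite aa ltxx in a0.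
apply: (small_eq0 c0) => e e0 e1; rewrite minElt a0 ltr0_norm//.
by have := h e e0 e1; lra.
Qed.

(** Mollification commutes with derivatives ([mollify_parts]), so uniform
    continuity of f and of its partial derivatives gives convergence in
    C^1. *)
Lemma C1c_approx f df r (e : R) : C1_grad f df -> 0 <= r -> csupp r f -> 0 < e ->
  exists phi, [/\ mollified phi, csupp (r + 1) phi,
    forall x, `|phi x - f x| <= e & forall i x, `|partial i phi x - df i x| <= e].
Proof.
move=> hf r0 rf e0; have [ctf _ _] := hf.
have cf : Cc f by split=> //; exists r.
have cdf i := C1_grad_Cc i hf cf.
have near_unif g : Cc g -> \forall d \near (0 : R)^'+,
    forall x y : E, `|x - y| <= d -> `|g x - g y| <= e.
  move=> cg; have [d d0 hd] := Cc_unif cg e0; near=> t => x y xy.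
  apply/ltW/hd; apply: le_lt_trans xy _; near: t; exact: nbhs_right_lt.
have [h [h0 h1 hfu hdfu]] : exists h, [/\ 0 < h, h <= 1,
    forall x y : E, `|x - y| <= h -> `|f x - f y| <= e &
    forall i (x y : E), `|x - y| <= h -> `|df i x - df i y| <= e].
  near (0 : R)^'+ => h; exists h; split.
  - by near: h; exact: nbhs_right_gt.
  - by near: h; apply: nbhs_right_le.
  - near: h; exact: near_unif.
  - by near: h; apply: filter_forall => i; exact: near_unif.
pose P := tensor (n := n) (fun=> bumpf h).
have sP (i : 'I_n) : flat_alg (bumpf h) by exact: bumpf_flat_alg.
have hP := @tensor_flat_alg R n (fun=> bumpf h) sP.
have rP : csupp h P.
  move=> x; rewrite ltNge ler_norm_rV ?(ltW h0)// negb_forall => /existsP[i].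
  by rewrite -ltNge => xi; rewrite /P /tensor (bigD1 i)//= bumpf_supp// mul0r.
have cP : Cc P by split; [case: hP|exists h => //; exact: ltW].
have P0 x : 0 <= P x by apply: prodr_ge0 => i _; exact: bumpf_ge0.
have IP : 0 < integ P.
  rewrite lt0r integ_ge0// andbT; apply/eqP => /(integ_eq0 cP P0)/(_ 0).
  apply/eqP; rewrite gt_eqF//; apply: prodr_gt0 => i _; rewrite mxE; exact: bumpf0.
have IV : 0 <= (integ P)^-1 by rewrite invr_ge0 ltW.
have approx g : Cc g -> (forall x y : E, `|x - y| <= h -> `|g x - g y| <= e) ->
    forall x, `|(integ P)^-1 * mollify g P x - g x| <= e.
  move=> cg gu x; have := mollify_approx cg cP (ltW h0) rP P0 gu x => hm.
  rewrite (_ : _ * _ - _ = (integ P)^-1 * (mollify g P x - integ P * g x)).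
    by rewrite normrM (ger0_norm IV) ler_pdivrMl// (mulrC _ e).
  by rewrite mulrBr mulKf ?gt_eqF.
exists (fun x => (integ P)^-1 * mollify f P x); split.
- by exists f; split=> //; exists (fun=> bumpf h), (integ P)^-1.
- have := mollify_csupp rf rP => hs x xr; rewrite hs ?mulr0//; lra.
- exact: approx.
- move=> i x; rewrite (C1_gradE i x (C1_gradZ (integ P)^-1 (mollify_C1_grad cf hP cP))).
  by rewrite (mollify_parts i hf cf hP cP); exact: (approx _ (cdf i) (hdfu i)).
Unshelve. all: by end_near. Qed.

Lemma mollified_Cc_infty (phi : E -> R) r : mollified phi -> csupp r phi -> Cc_infty phi.
Proof. by move=> h rp; split; [exact: mollified_Cinfty|exact: csupp_compact rp]. Qed.

Lemma integ_by_parts f df g dg i : C1_grad f df -> C1_grad g dg -> Cc g ->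
  integ (fun x => df i x * g x) = - integ (fun x => f x * dg i x).
Proof.
move=> hf hg cg; have cdg := C1_grad_Cc i hg cg.
have [cf _ cdf] := hf.
have := integ_grad0 i (C1_gradM hf hg) (CcMr cf cg).
rewrite integD; [|exact: CcMr|exact: CcMr].
by move/eqP; rewrite addr_eq0 => /eqP.
Qed.

Lemma Ck_C1_grad k f : Ck k.+1 f -> C1_grad f (fun i => partial i f).
Proof.
move=> [h1 h2]; split=> [|i x|i].
- exact: (h1 [::]).
- by apply: derivableP; exact: (h2 [::]).
- exact: (h1 [:: i]).
Qed.

Lemma Ck_partial k f i : Ck k.+1 f -> Ck k (partial i f).
Proof.
move=> [h1 h2]; split=> s sk.
  by have := h1 (rcons s i); rewrite size_rcons /iter_partial foldr_rcons; apply.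
by move=> j x; have := h2 (rcons s i); rewrite size_rcons /iter_partial foldr_rcons; apply.
Qed.

(** The quadratic form is continuous for C^1 convergence with supports in a
    fixed cube, and smooth test functions are dense in that sense by
    [C1c_approx]. *)
Lemma stable_C1c (beta : R -> R) (u f : E -> R) df : continuous u -> continuous (derive1 beta) ->
  stable beta u -> C1_grad f df -> Cc f ->
  0 <= integ (fun x => \sum_j df j x ^+ 2 + 2^-1 * derive1 beta (u x) * f x ^+ 2).
Proof.
move=> cu cb st hf /[dup] cf [_ [r r0 rf]].
pose c x := 2^-1 * derive1 beta (u x).
have cc : continuous c by apply: contM; [exact: contC|exact: cont_comp].
have cdf i := C1_grad_Cc i hf cf.
have [M M0 hM] : exists2 M, 0 <= M & (forall x, `|f x| <= M) /\ forall i x, `|df i x| <= M.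
  have [M M0 hM] := Cc_bounded cf.
  have /choice[N hN] i : exists N, 0 <= N /\ forall x, `|df i x| <= N.
    by have [N ? ?] := Cc_bounded (cdf i); exists N.
  exists (M + \sum_i N i); first by rewrite addr_ge0// sumr_ge0// => i _; case: (hN i).
  split=> [x|i x].
    by rewrite (le_trans (hM x))// lerDl sumr_ge0// => i _; case: (hN i).
  rewrite (le_trans ((hN i).2 x))// (bigD1 i)//= addrCA lerDl addr_ge0//.
  by rewrite sumr_ge0// => j _; case: (hN j).
have [K K0 hK] := bounded_on_cube (r + 1) cc.
pose V := (2 * (r + 1)) ^+ n; have V0 : 0 <= V by rewrite exprn_ge0//; lra.
apply: (@small_ge0 _ ((2 * M + 1) * (n%:R + K) * V)).
  by rewrite !mulr_ge0 ?addr_ge0 ?mulr_ge0.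
move=> e e0 e1; have [phi [sphi rphi hphi hdphi]] := C1c_approx hf r0 rf e0.
have := st _ (mollified_Cc_infty sphi rphi).
have [hp _ _] := mollified_C1_grad sphi.
have r1 : 0 <= r + 1 by lra.
have cphi : Cc phi by split; [case: hp|exists (r + 1)].
have CJ g dg : C1_grad g dg -> Cc g -> Cc (fun x => \sum_j dg j x ^+ 2 + c x * g x ^+ 2).
  move=> hg cg; apply: CcD; last first.
    by apply: CcMr => //; exact: Cc_sqr.
  by apply: Cc_sum => j _; apply: Cc_sqr; exact: C1_grad_Cc hg cg.
move=> /fine_ge0 h; have {}h : 0 <= integ (fun x => \sum_j partial j phi x ^+ 2 + c x * phi x ^+ 2).
  exact: h.
suff : `|integ (fun x => \sum_j partial j phi x ^+ 2 + c x * phi x ^+ 2) -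
    integ (fun x => \sum_j df j x ^+ 2 + c x * f x ^+ 2)| <= (2 * M + 1) * (n%:R + K) * V * e.
  by rewrite ler_norml; lra.
rewrite -integB; [|exact: CJ|exact: CJ].
rewrite mulrAC; apply: norm_integ_le => //; first by apply: CcB; exact: CJ.
- by apply: mulr_ge0; [apply: mulr_ge0; [lra|exact: addr_ge0]|exact: ltW].
- move=> x xr; rewrite rphi// rf; last lra.
  rewrite !expr0n !mulr0 !addr0 -sumrB big1// => j _.
  by rewrite (C1_grad_csupp j hp rphi)// (C1_grad_csupp j hf rf) ?subrr//; lra.
- have sq (a b : R) : `|b| <= M -> `|a - b| <= e -> `|a ^+ 2 - b ^+ 2| <= (2 * M + 1) * e.
    move=> bM ab; rewrite subr_sqr mulrC normrM ler_pM//.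
    rewrite (_ : a + b = (a - b) + b *+ 2); last by ring.
    rewrite (le_trans (ler_normD _ _))// normrMn addrC lerD ?(le_trans ab)//.
    by rewrite mulr2n; lra.
  move=> x; rewrite opprD addrACA -sumrB -mulrBr (le_trans (ler_normD _ _))//.
  rewrite [leRHS]mulrAC [leRHS]mulrDr lerD//.
    apply: (le_trans (ler_norm_sum _ _ _)).
    rewrite (_ : _ * n%:R = \sum_(j < n) (2 * M + 1) * e).
      by apply: ler_sum => j _; apply: sq; [exact: hM.2|exact: hdphi].
    by rewrite sumr_const card_ord mulr_natr.
  have [xr|xr] := leP `|x| (r + 1).
    rewrite normrM mulrC ler_pM//; last exact: hK.
    by apply: sq; [exact: hM.1|exact: hphi].
  rewrite rphi// rf; last lra.
  by rewrite subrr mulr0 normr0; apply: mulr_ge0 => //; apply: mulr_ge0; lra.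
Qed.

Section linearized.
Variables (beta : R -> R) (u : E -> R) (Du : 'I_n -> E -> R) (DDu : 'I_n -> 'I_n -> E -> R).
Hypotheses (hb : C1 beta) (C1u : C1_grad u Du) (C1Du : forall i, C1_grad (Du i) (fun j => DDu j i))
  (lapu : forall x, \sum_j DDu j j x = 2^-1 * beta (u x)).
Let c x := 2^-1 * derive1 beta (u x).

Let cc : continuous c.
Proof.
apply: contM; first exact: contC.
by apply: cont_comp; [case: hb|case: C1u].
Qed.

(** The equation cannot be differentiated, as u is only C^2. Instead all
    derivatives are moved to phi, where they commute, until Delta u
    appears. *)
Lemma linearized_smooth i (phi : E -> R) r : mollified phi -> 0 <= r -> csupp r phi ->
  integ (fun x => \sum_j DDu j i x * partial j phi x + c x * Du i x * phi x) = 0.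
Proof.
move=> sphi r0 rphi.
have [hp sp comm] := mollified_C1_grad sphi.
have cphi : Cc phi by split; [case: hp|exists r].
have cp j := C1_grad_Cc j hp cphi.
have hpp j : C1_grad (partial j phi) (fun i => partial i (partial j phi)).
  by have [] := mollified_C1_grad (sp j).
have cpp j k : Cc (partial k (partial j phi)) := C1_grad_Cc k (hpp j) (cp j).
have hppp j k : C1_grad (partial k (partial j phi)) (fun i => partial i (partial k (partial j phi))).
  by have [_ /(_ k) h _] := mollified_C1_grad (sp j); have [] := mollified_C1_grad h.
have [cDu cDDu] : (forall i, continuous (Du i)) /\ (forall i j, continuous (DDu i j)).
  by split=> [k|k l]; [case: (C1Du k)|case: (C1Du l)].
rewrite integD; last first.
  by apply: CcMr => //; apply: contM.
  by apply: Cc_sum => j _; apply: CcMr.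
rewrite integ_sum; last by move=> j _; apply: CcMr.
have E1 j : integ (fun x => DDu j i x * partial j phi x) = integ (fun x => DDu j j x * partial i phi x).
  have P1 := integ_by_parts j (C1Du i) (hpp j) (cp j).
  have P2 := integ_by_parts i C1u (hppp j j) (cpp j j).
  have Q1 := integ_by_parts j (C1Du j) (hpp i) (cp i).
  have Q2 := integ_by_parts j C1u (hppp i j) (cpp i j).
  have comm3 : partial i (partial j (partial j phi)) = partial j (partial j (partial i phi)).
    by have [_ _ cj] := mollified_C1_grad (sp j); rewrite cj comm.
  (* Both sides equal the integral of u d_i d_j d_j phi. *)
  rewrite -comm3 in Q2.
  exact: etrans P1 (etrans (congr1 -%R (etrans P2 (esym Q2))) (esym Q1)).
under eq_bigr do rewrite E1.
rewrite -integ_sum; last by move=> j _; apply: CcMr.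
have hbu : C1_grad (fun x => 2^-1 * beta (u x)) (fun i x => 2^-1 * (derive1 beta (u x) * Du i x)).
  apply: C1_gradZ; apply: C1_grad_comp => //.
    by move=> x; have [hd _] := hb; rewrite derive1E; apply: derivableP.
  by apply: cont_comp; [case: hb|case: C1u].
rewrite (_ : (fun x => \sum_j _) = (fun x => 2^-1 * beta (u x) * partial i phi x)); last first.
  by apply/funext => x; rewrite -mulr_suml; congr (_ * _); rewrite -lapu.
have := integ_by_parts i hbu hp cphi => /esym/eqP; rewrite eqr_oppLR => /eqP ->.
rewrite -integN; last first.
  by apply: CcMr => //; have [_ _] := hbu; apply.
rewrite -integD; last first.
  by apply: CcMr => //; apply: contM.
  by apply: CcN; apply: CcMr => //; have [_ _] := hbu; apply.
by rewrite -[RHS](@integ0 R n); congr integ; apply/funext => x; rewrite /c; ring.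
Qed.

(** The same density argument as for [stable_C1c]. *)
Lemma linearized_C1c i f df : C1_grad f df -> Cc f ->
  integ (fun x => \sum_j DDu j i x * df j x + c x * Du i x * f x) = 0.
Proof.
move=> hf /[dup] cf [_ [r r0 rf]].
have cdf j := C1_grad_Cc j hf cf.
have [cDu cDDu] : (forall i, continuous (Du i)) /\ (forall i j, continuous (DDu i j)).
  by split=> [k|k l]; [case: (C1Du k)|case: (C1Du l)].
have /choice[N hN] j : exists N, 0 <= N /\ forall x, `|x| <= r + 1 -> `|DDu j i x| <= N.
  by have [N ? ?] := bounded_on_cube (r + 1) (cDDu j i); exists N.
have ccD : continuous (fun x => c x * Du i x) by exact: contM.
have [K K0 hK] := bounded_on_cube (r + 1) ccD.
pose V := (2 * (r + 1)) ^+ n; have V0 : 0 <= V by rewrite exprn_ge0//; lra.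
have S0 : 0 <= \sum_j N j by rewrite sumr_ge0// => j _; case: (hN j).
apply: (@small_eq0 R _ ((\sum_j N j + K) * V)); first by rewrite mulr_ge0// addr_ge0.
move=> e e0 e1; have [phi [sphi rphi hphi hdphi]] := C1c_approx hf r0 rf e0.
have r1 : 0 <= r + 1 by lra.
have [hp _ _] := mollified_C1_grad sphi.
have cphi : Cc phi by split; [case: hp|exists (r + 1)].
have CJ g dg : C1_grad g dg -> Cc g -> Cc (fun x => \sum_j DDu j i x * dg j x + c x * Du i x * g x).
  move=> hg cg; apply: CcD; last by apply: CcMr.
  by apply: Cc_sum => j _; apply: CcMr => //; exact: C1_grad_Cc hg cg.
rewrite -[integ _]subr0 -[X in _ - X](linearized_smooth i sphi r1 rphi) -integB; [|exact: CJ|exact: CJ].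
rewrite mulrAC; apply: norm_integ_le => //; first by apply: CcB; exact: CJ.
- by rewrite mulr_ge0 ?addr_ge0// ltW.
- move=> x xr; rewrite rphi// rf; last lra.
  rewrite !mulr0 !addr0 -sumrB big1// => j _.
  by rewrite (C1_grad_csupp j hp rphi)// (C1_grad_csupp j hf rf) ?subrr//; lra.
- move=> x; have [xr|xr] := leP `|x| (r + 1); last first.
    rewrite rphi// rf; last lra.
    rewrite !mulr0 !addr0 -sumrB big1 ?normr0 ?mulr_ge0 ?addr_ge0 ?(ltW e0)// => j _.
    by rewrite (C1_grad_csupp j hp rphi)// (C1_grad_csupp j hf rf) ?subrr//; lra.
  rewrite opprD addrACA -sumrB -mulrBr (le_trans (ler_normD _ _))//.
  rewrite mulrDl lerD//.
    apply: (le_trans (ler_norm_sum _ _ _)); rewrite mulr_suml.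
    apply: ler_sum => j _; rewrite -mulrBr normrM ler_pM//; first exact: (hN j).2.
    by rewrite distrC.
  by rewrite normrM ler_pM//; [exact: hK|rewrite distrC].
Qed.

End linearized.
End weak.

(** * Infinitesimal axial symmetry *)

Section axial.
Context {R : realType} {n : nat}.
Local Notation E := 'rV[R]_n.+1.
Local Notation e_ i := (delta_mx (0 : 'I_1) i : E).
Implicit Types (f g : E -> R) (df dg : 'I_n.+1 -> E -> R) (i j l : 'I_n.+1).
Local Notation m := (@ord_max n).

Lemma axial_invariant (u : E -> R) (x y : E) : axially_symmetric u ->
  \sum_(i < n.+1 | i != m) x 0 i ^+ 2 = \sum_(i < n.+1 | i != m) y 0 i ^+ 2 ->
  x 0 m = y 0 m -> u x = u y.
Proof. by move=> [G hG] hs hm; rewrite !hG hs hm. Qed.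

(** This is the derivative at angle 0 of the invariance of u under rotations
    of the (i, j)-plane. The rotation is parametrized by the tangent t of half
    the angle, which keeps everything rational, and the increment of u is
    computed one coordinate at a time. *)
Lemma axial_rot (u : E -> R) du i j (x : E) : axially_symmetric u -> C1_grad u du ->
  i != m -> j != m -> x 0 i * du j x = x 0 j * du i x.
Proof.
move=> ax hu im jm; have [->//|ij] := eqVneq i j.
have [_ _ cdu] := hu.
apply/eqP; rewrite -subr_eq0; apply/eqP.
pose X := `|x 0 i| + `|x 0 j|; have X0 : 0 <= X by rewrite addr_ge0.
pose B := `|du i x| + `|du j x| + 1; have B0 : 0 <= B by rewrite !addr_ge0.
apply: (@small_eq0 R _ (X + B * X)); first by rewrite addr_ge0// mulr_ge0.
move=> e e0 e1.
have near_du l : exists2 d, 0 < d & forall z : E, `|x - z| < d -> `|du l x - du l z| <= e.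
  have /cvgrPdist_le /(_ e e0) /nbhs_ballP[d /= d0 hd] := cdu l x.
  by exists d => // z xz; apply: hd; rewrite -ball_normE.
have [d1 d10 hd1] := near_du i; have [d2 d20 hd2] := near_du j.
pose d := Num.min d1 d2; have d0 : 0 < d by rewrite lt_min d10.
pose t := Num.min e (d / (4 * (X + 1))).
have t0 : 0 < t by rewrite lt_min e0 divr_gt0// mulr_gt0//; lra.
have te : t <= e by rewrite ge_min lexx.
have td : t * (4 * (X + 1)) <= d.
  rewrite -ler_pdivlMr; last by rewrite mulr_gt0//; lra.
  by rewrite ge_min lexx orbT.
have t1 : t <= 1 by apply: le_trans te e1.
have q0 : 0 < 1 + t ^+ 2 by rewrite ltr_pwDl// sqr_ge0.
(* With t = tan (angle / 2), s is the sine of the angle and - t s is its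
   cosine minus 1; the rotated point is x + s (a e_i + b e_j). *)
pose s := 2 * t / (1 + t ^+ 2).
have s0 : 0 < s by rewrite divr_gt0// mulr_gt0.
have st : s <= 2 * t.
  by rewrite ler_pdivrMr// ler_peMr ?mulr_ge0 ?(ltW t0)// lerDl sqr_ge0.
pose a := - t * x 0 i - x 0 j; pose b := x 0 i - t * x 0 j.
have aX : `|a| <= X.
  rewrite (le_trans (ler_normB _ _))// lerD// normrM normrN (gtr0_norm t0).
  by rewrite ler_piMl.
have bX : `|b| <= X.
  rewrite (le_trans (ler_normB _ _))// lerD// normrM (gtr0_norm t0).
  by rewrite ler_piMl.
pose y1 := x + (s * a) *: e_ i; pose y := y1 + (s * b) *: e_ j.
have uy : u y = u x.
  apply: axial_invariant => //; last first.
    by rewrite !mxE !eqxx (eq_sym m i) (eq_sym m j) (negPf im) (negPf jm) !mulr0 !addr0.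
  rewrite (bigD1 i im)/= [in RHS](bigD1 i im)/=.
  have ji : (j != m) && (j != i) by rewrite jm eq_sym.
  rewrite (bigD1 j ji)/= [in RHS](bigD1 j ji)/= !addrA; congr (_ + _).
    rewrite !mxE !eqxx (negPf ij) (eq_sym j i) (negPf ij)/= !mulr0 !mulr1 !addr0.
    by rewrite /s /a /b; field; rewrite gt_eqF.
  apply: eq_bigr => l /andP[/andP[_ li] lj]; rewrite !mxE !eqxx.
  by rewrite (negPf li) (negPf lj) !mulr0 !addr0.
have [t1' ht1 E1] := MVT_dir i x (s * a) hu.
have [t2' ht2 E2] := MVT_dir j y1 (s * b) hu.
have sab (c : R) : `|c| <= X -> `|s * c| <= 2 * t * X.
  by move=> cX; rewrite normrM (gtr0_norm s0) ler_pM// ltW.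
set p := x + t1' *: e_ i in E1; set q := y1 + t2' *: e_ j in E2.
have dp : `|du i x - du i p| <= e.
  apply: hd1; rewrite opprD addrA subrr sub0r normrN.
  rewrite (le_lt_trans (norm_he _ _))// (le_lt_trans ht1)// (le_lt_trans (sab _ aX))//.
  have : d <= d1 by rewrite ge_min lexx.
  nra.
have dq : `|du j x - du j q| <= e.
  apply: hd2; rewrite /q /y1 -addrA opprD addrA subrr sub0r normrN.
  rewrite (le_lt_trans (ler_normD _ _))//.
  have := norm_he i (s * a); have := norm_he j t2'; have := sab _ aX; have := sab _ bX.
  have : d <= d2 by rewrite ge_min lexx orbT.
  nra.
(* The increments of u along the two segments from x to the rotated point add
   up to 0. *)
have main : du i p * a + du j q * b = 0.
  apply: (mulfI (lt0r_neq0 s0)); rewrite mulr0 mulrDr !(mulrCA s).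
  by rewrite -E1 -E2 -/y -/y1 uy addrC subrKA subrr.
have -> : x 0 i * du j x - x 0 j * du i x =
    x 0 i * (du j x - du j q) - x 0 j * (du i x - du i p)
    + t * (x 0 i * du i p + x 0 j * du j q).
  have : x 0 i * du j q - x 0 j * du i p =  t * (x 0 i * du i p + x 0 j * du j q).
    by apply/eqP; rewrite -subr_eq0; apply/eqP; rewrite -main /a /b; ring.
  by move=> <-; ring.
have np : `|du i p| <= B.
  have := ler_normB (du i x) (du i x - du i p); rewrite opprB addrC subrK => h.
  have := normr_ge0 (du j x); rewrite /B; lra.
have nq : `|du j q| <= B.
  have := ler_normB (du j x) (du j x - du j q); rewrite opprB addrC subrK => h.
  have := normr_ge0 (du i x); rewrite /B; lra.
rewrite (le_trans (ler_normD _ _))// mulrDl lerD//.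
  rewrite (le_trans (ler_normB _ _))// !normrM mulrDl lerD// ler_wpM2l//.
rewrite normrM (gtr0_norm t0) [leRHS]mulrC ler_pM ?(ltW t0)//.
rewrite (le_trans (ler_normD _ _))// !normrM /X mulrDr.
by rewrite lerD// mulrC ler_wpM2r.
Qed.

End axial.

(** * The stability inequality weighted by the radial derivative *)

Section cylinder.
Context {R : realType} {n : nat}.
Local Notation E := 'rV[R]_n.+1.
Local Notation m := (@ord_max n).
Variables (beta : R -> R) (u : E -> R) (Du : 'I_n.+1 -> E -> R)
  (DDu : 'I_n.+1 -> 'I_n.+1 -> E -> R).
Hypotheses (hb : C1 beta) (C1u : C1_grad u Du) (C1Du : forall i, C1_grad (Du i) (fun j => DDu j i))
  (lapu : forall x, \sum_j DDu j j x = 2^-1 * beta (u x))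
  (st : stable beta u) (ax : axially_symmetric u).

Definition radius2 (x : E) := \sum_(i | i != m) x 0 i ^+ 2.
Definition radial_grad2 (x : E) := \sum_(i | i != m) Du i x ^+ 2.
(* This is s u_s, which is C^1 across the axis although u_s need not be. *)
Let w (x : E) := \sum_(i | i != m) x 0 i * Du i x.
Let dw j (x : E) := \sum_(i | i != m) ((j == i)%:R * Du i x + x 0 i * DDu j i x).
Let lap' (x : E) := \sum_(i | i != m) DDu i i x.

Let C1w : C1_grad w dw.
Proof. by apply: C1_grad_sum => i _; apply: C1_gradM => //; exact: C1_grad_coord. Qed.

Let rot (x : E) i j : i != m -> j != m -> x 0 i * Du j x = x 0 j * Du i x.
Proof. by move=> im jm; exact: (axial_rot x ax C1u im jm). Qed.

(** The derivative of [axial_rot] in the direction of the i-th coordinate. *)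
Lemma axial_rot_derive (x : E) i j : i != m -> j != m ->
  Du j x + x 0 i * DDu i j x - (i == j)%:R * Du i x - x 0 j * DDu i i x = 0.
Proof.
move=> im jm.
have h := C1_gradB (C1_gradM (C1_grad_coord i) (C1Du j)) (C1_gradM (C1_grad_coord j) (C1Du i)).
have e0 (y : E) : y 0 i * Du j y - y 0 j * Du i y = 0 by rewrite rot// subrr.
have h0 := @C1_grad_ext _ _ _ _ (fun=> 0) _ h e0 (fun _ _ => erefl).
have := C1_gradE i x (C1_gradC 0); rewrite (C1_gradE i x h0) eqxx mul1r => hh.
rewrite -[RHS]hh; ring.
Qed.

Let w_Du x j : j != m -> w x * Du j x = x 0 j * radial_grad2 x.
Proof.
move=> jm; rewrite mulr_suml mulr_sumr; apply: eq_bigr => i im.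
by rewrite mulrAC rot// -mulrA -expr2.
Qed.

Let w_sqr x : w x ^+ 2 = radius2 x * radial_grad2 x.
Proof.
rewrite expr2 {2}/w mulr_sumr mulr_suml; apply: eq_bigr => j jm.
by rewrite mulrCA w_Du// mulrA -expr2.
Qed.

Let card_m : \sum_(i < n.+1 | i != m) (1 : R) = n%:R.
Proof.
rewrite sumr_const (_ : #|_| = n)//.
by have := cardC1 m; rewrite card_ord; apply.
Qed.

(* In cylindrical coordinates: w = s u_s, the Laplacian in x' is u_ss + (k -
   1) u_s / s, and the scalar product is u_s (u_s + s u_ss). The computation
   below uses only [axial_rot] and its derivative, and so is valid on the axis
   as well. *)
Let pointwise x :
  w x * lap' x - \sum_(j | j != m) Du j x * dw j x = (n%:R - 2) * radial_grad2 x.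
Proof.
pose S := \sum_(j | j != m) \sum_(i | i != m) x 0 i * Du j x * DDu i j x.
have E1 : (n%:R - 1) * radial_grad2 x + S - w x * lap' x = 0.
  transitivity (\sum_(j | j != m) Du j x * \sum_(i | i != m)
    (Du j x + x 0 i * DDu i j x - (i == j)%:R * Du i x - x 0 j * DDu i i x)).
    rewrite /S /w /radial_grad2 mulr_sumr mulr_suml -big_split -sumrB/=.
    apply: eq_bigr => j jm; rewrite !sumrB big_split/=.
    rewrite (_ : \sum_(i | i != m) Du j x = n%:R * Du j x); last first.
      by rewrite -card_m mulr_suml; apply: eq_bigr => i _; rewrite mul1r.
    rewrite (_ : \sum_(i | i != m) (i == j)%:R * Du i x = Du j x); last first.
      rewrite (bigD1 j)//= eqxx mul1r big1 ?addr0// => i /andP[_ /negPf ->].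
      by rewrite mul0r.
    rewrite -mulr_sumr -/(lap' x).
    rewrite (_ : \sum_(i | i != m) x 0 i * Du j x * DDu i j x =
      Du j x * \sum_(i | i != m) x 0 i * DDu i j x); last first.
      by rewrite mulr_sumr; apply: eq_bigr => i _; rewrite mulrCA mulrA.
    ring.
  rewrite big1// => j jm; rewrite big1 ?mulr0// => i im; exact: axial_rot_derive.
have E2 : \sum_(j | j != m) Du j x * dw j x = radial_grad2 x + S.
  transitivity (\sum_(j | j != m) (Du j x ^+ 2 + \sum_(i | i != m) x 0 i * Du j x * DDu j i x)).
    apply: eq_bigr => j jm; rewrite /dw big_split/= mulrDr; congr (_ + _).
      rewrite (bigD1 j)//= eqxx mul1r big1 ?addr0// => i /andP[_ ij].
      by rewrite eq_sym (negPf ij) mul0r.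
    by rewrite mulr_sumr; apply: eq_bigr => i _; rewrite mulrCA mulrA.
  rewrite big_split/=; congr (_ + _); rewrite exchange_big/=.
  by apply: eq_bigr => i im; apply: eq_bigr => j jm; rewrite rot.
rewrite E2 mulrBl opprD addrA; move: E1; lra.
Qed.

(** Subtract from the stability inequality for w eta the linearized equations
    of the d_i u tested with x_i w eta^2. The terms with c cancel because w is
    the sum of the x_i d_i u; what remains is evaluated with [pointwise]. *)
Lemma cylinder_ineq eta deta : C1_grad eta deta -> Cc eta ->
  0 <= integ (fun x => radius2 x * radial_grad2 x * (\sum_j deta j x ^+ 2) - (n%:R - 2) * radial_grad2 x * eta x ^+ 2
    + 2 * eta x * radial_grad2 x * \sum_(i | i != m) x 0 i * deta i x).
Proof.
move=> he ce.
have [cu _ cDu] := C1u.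
have cb' : continuous (derive1 beta) by case: hb.
pose c x := 2^-1 * derive1 beta (u x).
have cc : continuous c by apply: contM; [exact: contC|exact: cont_comp].
have hxi := C1_gradM C1w he.
have cw : continuous w by case: C1w.
have cxi : Cc (fun x => w x * eta x) by exact: CcMr.
have hstab := stable_C1c cu cb' st hxi cxi.
have hz := C1_gradM C1w (C1_grad_sqr he).
have hphi i := C1_gradM (C1_grad_coord i) hz.
have cz : Cc (fun x => w x * eta x ^+ 2).
  by apply: CcMr => //; exact: Cc_sqr.
have cphi i : Cc (fun x : E => x 0 i * (w x * eta x ^+ 2)).
  by apply: CcMr => //; exact: cont_coord.
have hlin i := linearized_C1c hb C1u C1Du lapu i (hphi i) (cphi i).
have cDDu j i : continuous (DDu j i) by case: (C1Du i).
have clin i : Cc (fun x : E => \sum_j DDu j i x *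
    ((j == i)%:R * (w x * eta x ^+ 2) +
      x 0 i * (dw j x * eta x ^+ 2 + w x * (2 * eta x * deta j x)))
    + c x * Du i x * (x 0 i * (w x * eta x ^+ 2))).
  apply: CcD; last by apply: CcMr => //; exact: contM.
  by apply: Cc_sum => j _; apply: CcMr => //; exact: (C1_grad_Cc j (hphi i) (cphi i)).
have cstab : Cc (fun x : E => \sum_j (dw j x * eta x + w x * deta j x) ^+ 2 +
    c x * (w x * eta x) ^+ 2).
  apply: CcD; last first.
    by apply: CcMr => //; exact: Cc_sqr.
  by apply: Cc_sum => j _; apply: Cc_sqr; exact: C1_grad_Cc hxi cxi.
(* The functions x_i w eta^2 are the test functions for the equations of the
   d_i u. *)
have hsum : integ (fun x : E => \sum_(i | i != m) (\sum_j DDu j i x *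
    ((j == i)%:R * (w x * eta x ^+ 2) +
      x 0 i * (dw j x * eta x ^+ 2 + w x * (2 * eta x * deta j x)))
    + c x * Du i x * (x 0 i * (w x * eta x ^+ 2)))) = 0.
  by rewrite integ_sum// big1// => i _; exact: hlin.
apply: (le_trans hstab); rewrite -[X in X <= _]subr0 -[X in _ - X <= _]hsum -integB//; last first.
  exact: Cc_sum.
rewrite le_eqVlt; apply/orP; left; apply/eqP; congr integ; apply/funext => x.
pose A j := \sum_(i | i != m) x 0 i * DDu j i x.
have dwA j : dw j x = (if j != m then Du j x else 0) + A j.
  rewrite /dw big_split/=; congr (_ + _); case: ifPn => jm.
    rewrite (bigD1 j)//= eqxx mul1r big1 ?addr0// => i /andP[_ ij].
    by rewrite eq_sym (negPf ij) mul0r.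
  rewrite big1// => i im; case: eqVneq => [ji|_]; last by rewrite mul0r.
  by rewrite ji im in jm.
pose q j := dw j x * eta x ^+ 2 + w x * (2 * eta x * deta j x).
have Elin : \sum_(i | i != m) (\sum_j DDu j i x * ((j == i)%:R * (w x * eta x ^+ 2) + x 0 i * q j)
    + c x * Du i x * (x 0 i * (w x * eta x ^+ 2))) =
    lap' x * (w x * eta x ^+ 2) + \sum_j A j * q j + c x * w x ^+ 2 * eta x ^+ 2.
  rewrite big_split/=; congr (_ + _); last first.
    transitivity (w x * (c x * w x * eta x ^+ 2)); last by ring.
    by rewrite {2}/w [RHS]mulr_suml; apply: eq_bigr => i _; ring.
  under eq_bigr => i _ do (under eq_bigr => j _ do rewrite mulrDr); rewrite /=.
  under eq_bigr => i _ do rewrite big_split/=.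
  rewrite big_split/=; congr (_ + _).
    rewrite /lap' [RHS]mulr_suml; apply: eq_bigr => i _.
    rewrite (bigD1 i)//= eqxx mul1r big1 ?addr0// => j /negPf ->.
    by rewrite mul0r mulr0.
  rewrite exchange_big/=; apply: eq_bigr => j _; rewrite /A mulr_suml.
  by apply: eq_bigr => i _; ring.
rewrite Elin.
have EA : \sum_j A j * q j = \sum_j dw j x * q j - \sum_(j | j != m) Du j x * q j.
  rewrite [X in _ - X]big_mkcond -sumrB; apply: eq_bigr => j _.
  by rewrite dwA; case: ifP => _; ring.
have EP : \sum_(j | j != m) Du j x * q j =
    (\sum_(j | j != m) Du j x * dw j x) * eta x ^+ 2 +
    2 * eta x * radial_grad2 x * \sum_(j | j != m) x 0 j * deta j x.
  rewrite mulr_suml mulr_sumr -big_split/=; apply: eq_bigr => j jm; rewrite /q mulrDr.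
  congr (_ + _); first by ring.
  transitivity (2 * eta x * deta j x * (w x * Du j x)); first by ring.
  by rewrite w_Du//; ring.
have ES : \sum_j (dw j x * eta x + w x * deta j x) ^+ 2 =
    \sum_j dw j x * q j + w x ^+ 2 * \sum_j deta j x ^+ 2.
  by rewrite mulr_sumr -big_split/=; apply: eq_bigr => j _; rewrite /q; ring.
rewrite ES EA EP w_sqr.
have := pointwise x => hp.
set P := \sum_(j | j != m) Du j x * dw j x in hp *.
have {hp}-> : lap' x * (w x * eta x ^+ 2) = ((n%:R - 2) * radial_grad2 x + P) * eta x ^+ 2.
  by rewrite -hp; ring.
rewrite exprMn w_sqr /c; ring.
Qed.

End cylinder.

(** * C^1 box cutoffs *)

Section cutoff.
Context {R : realType}.

Definition pos_pow (k : nat) (y : R) : R := Num.max 0 y ^+ k.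

Lemma pos_pow_ge0 k y : 0 <= pos_pow k y.
Proof. by rewrite exprn_ge0// le_max lexx. Qed.

Lemma pos_pow_pos k y : 0 <= y -> pos_pow k y = y ^+ k.
Proof. by move=> y0; rewrite /pos_pow max_r. Qed.

Lemma pos_pow_neg k y : y <= 0 -> pos_pow k.+1 y = 0.
Proof. by move=> y0; rewrite /pos_pow max_l// expr0n. Qed.

Lemma cont_pos_pow k : continuous (pos_pow k).
Proof.
apply: contX => y.
rewrite (_ : Num.max 0 = (fun x : R => (x + `|x|) / 2)).
  apply: contM; last exact: contC.
  by apply: contD; [move=> z; exact: cvg_id|exact: norm_continuous].
apply/funext => x; rewrite maxEle; case: (lerP 0 x) => x0.
  by rewrite ger0_norm//; lra.
by rewrite ltr0_norm//; lra.
Qed.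

Lemma is_derive_pos_pow k (y : R) :
  is_derive y (1 : R) (pos_pow k.+2) (k.+2%:R * pos_pow k.+1 y).
Proof.
have [y0|y0|->] := ltgtP y 0.
- rewrite (pos_pow_neg _ (ltW y0)) mulr0.
  have h := is_derive_cst (0 : R) y (1 : R).
  apply: (near_eq_is_derive _ h); near=> z; rewrite pos_pow_neg// ltW//.
  by near: z; exact: lt_nbhsl.
- have h : is_derive y (1 : R) (fun z : R => z ^+ k.+2) (k.+2%:R * pos_pow k.+1 y).
    rewrite pos_pow_pos ?ltW//.
    have := @is_deriveX _ _ id k.+2 y 1 1 (is_derive_id _ _).
    by rewrite /GRing.scale/= mulr1 exprfctE.
  apply: (near_eq_is_derive _ h); near=> z; rewrite pos_pow_pos// ltW//.
  by near: z; exact: lt_nbhsr.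
- rewrite (pos_pow_neg _ (lexx _)) mulr0; apply: is_deriveP => e e0.
  exists (Num.min 1 e); first by rewrite lt_min ltr01.
  move=> h h0; rewrite lt_min => /andP[h1 he].
  rewrite [h *: 1]mulr1 addr0 mulr0 subr0 (pos_pow_neg _ (lexx 0)) subr0.
  have hm : `|Num.max 0 h| <= `|h|.
    by rewrite maxEle; case: ifP => // _; rewrite normr0.
  rewrite /pos_pow normrX exprSr ler_pM ?exprn_ge0//.
  rewrite exprS (le_trans _ (ltW he))// (le_trans _ hm)//.
  by rewrite ler_piMr// exprn_ile1// (le_trans hm)// ltW.
Unshelve. all: by end_near. Qed.

(** The inner power vanishes for |x| <= 1 and is at least 9 for |x| >= 2, so
    that chi passes from 1 to 0 in between. *)
Definition chi (x : R) : R := pos_pow 2 (1 - pos_pow 2 (x ^+ 2 - 1)).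
Definition dchi (x : R) : R :=
  2 * pos_pow 1 (1 - pos_pow 2 (x ^+ 2 - 1)) * - (2 * pos_pow 1 (x ^+ 2 - 1) * (2 * x)).

Lemma is_derive_chi (x : R) : is_derive x (1 : R) chi (dchi x).
Proof.
have h1 : is_derive x (1 : R) (fun z : R => z ^+ 2 - 1) (2 * x).
  have h := @is_deriveX _ _ id 2 x 1 1 (is_derive_id _ _).
  have := @is_deriveB _ _ _ _ _ _ _ _ _ h (is_derive_cst (1 : R) x (1 : R)).
  by rewrite /GRing.scale/= mulr1 expr1 subr0 exprfctE.
have h2 := is_derive_comp1 h1 (is_derive_pos_pow 0 (x ^+ 2 - 1)).
have h3 : is_derive x (1 : R) (fun z : R => 1 - pos_pow 2 (z ^+ 2 - 1))
    (- (2 * pos_pow 1 (x ^+ 2 - 1) * (2 * x))).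
  have := @is_deriveB _ _ _ _ _ _ _ _ _ (is_derive_cst (1 : R) x (1 : R)) h2.
  by rewrite sub0r.
exact: (is_derive_comp1 h3 (is_derive_pos_pow 0 (1 - pos_pow 2 (x ^+ 2 - 1)))).
Qed.

Lemma cont_dchi : continuous dchi.
Proof.
have c1 : continuous (fun x : R => x ^+ 2 - 1).
  by apply: contB; [apply: contX => x; exact: cvg_id|exact: contC].
apply: contM.
  apply: contM; first exact: contC.
  apply: (cont_comp (@cont_pos_pow 1)); apply: contB; first exact: contC.
  exact: (cont_comp (@cont_pos_pow 2)).
apply: contN; apply: contM.
  by apply: contM; [exact: contC|exact: (cont_comp (@cont_pos_pow 1))].
by apply: contM; [exact: contC|move=> x; exact: cvg_id].
Qed.

Lemma chi_ge0 x : 0 <= chi x. Proof. exact: pos_pow_ge0. Qed.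

Lemma chi_le1 x : chi x <= 1.
Proof.
rewrite /chi; set y := 1 - _; have y1 : y <= 1 by rewrite gerBl pos_pow_ge0.
have [y0|y0] := leP 0 y; first by rewrite pos_pow_pos// exprn_ile1.
by rewrite pos_pow_neg// ltW.
Qed.

Lemma chi1 x : `|x| <= 1 -> chi x = 1.
Proof.
move=> x1; have x21 : x ^+ 2 - 1 <= 0.
  by rewrite subr_le0 -(real_normK (num_real x)) exprn_ile1.
by rewrite /chi (pos_pow_neg 1 x21) subr0 pos_pow_pos// expr1n.
Qed.

Lemma chi_arg_le0 x : 2 <= `|x| -> 1 - pos_pow 2 (x ^+ 2 - 1) <= 0.
Proof.
move=> x2; have h : 4 <= x ^+ 2 by rewrite -(real_normK (num_real x)); nra.
rewrite pos_pow_pos; last by lra.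
nra.
Qed.

Lemma chi0 x : 2 <= `|x| -> chi x = 0.
Proof. by move=> /chi_arg_le0 h; rewrite /chi pos_pow_neg. Qed.

Lemma dchi_near x : `|x| <= 1 -> dchi x = 0.
Proof.
move=> x1; have x21 : x ^+ 2 - 1 <= 0.
  by rewrite subr_le0 -(real_normK (num_real x)) exprn_ile1.
by rewrite /dchi (pos_pow_neg 0 x21) mulr0 mul0r oppr0 mulr0.
Qed.

Lemma dchi_far x : 2 <= `|x| -> dchi x = 0.
Proof. by move=> /chi_arg_le0 h; rewrite /dchi (pos_pow_neg 0 h) mulr0 mul0r. Qed.

Lemma dchi_bound x : `|dchi x| <= 16.
Proof.
(* Where the derivative is nonzero, both truncated powers are at most 1 and
   |x| <= 2: this gives 2 * 2 * 2 * 2. *)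
have [h|h] := leP (1 - pos_pow 2 (x ^+ 2 - 1)) 0.
  by rewrite /dchi (pos_pow_neg 0 h) mulr0 mul0r normr0.
have x2 : `|x| <= 2.
  by rewrite leNgt; apply/negP => /ltW/chi_arg_le0; rewrite leNgt h.
have p1 : pos_pow 1 (1 - pos_pow 2 (x ^+ 2 - 1)) <= 1.
  by rewrite (pos_pow_pos 1 (ltW h)) expr1 gerBl pos_pow_ge0.
have p2 : pos_pow 1 (x ^+ 2 - 1) <= 1.
  have [y0|y0] := leP (x ^+ 2 - 1) 0; first by rewrite pos_pow_neg.
  move: h; rewrite !pos_pow_pos ?(ltW y0)// expr1; nra.
rewrite /dchi mulrN normrN !normrM !(ger0_norm (pos_pow_ge0 _ _)) !(ger0_norm (ler0n R 2)).
have a0 := pos_pow_ge0 1 (1 - pos_pow 2 (x ^+ 2 - 1)); have b0 := pos_pow_ge0 1 (x ^+ 2 - 1).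
set a := pos_pow 1 (1 - _) in p1 a0 *; set b := pos_pow 1 _ in p2 b0 *.
have ab0 := mulr_ge0 a0 b0; have ab1 := mulr_ile1 a0 b0 p1 p2.
rewrite [leLHS](_ : _ = a * b * (8 * `|x|)); last by ring.
have y0 := normr_ge0 x; set y := `|x| in x2 y0 *; set z := a * b in ab0 ab1 *.
nra.
Qed.

Section boxcut.
Context {n : nat}.
Local Notation E := 'rV[R]_n.

Definition boxcut (r : 'I_n -> R) (x : E) : R := \prod_i chi ((r i)^-1 * x 0 i).
Definition dboxcut (r : 'I_n -> R) (j : 'I_n) (x : E) : R :=
  \prod_i (if i == j then (r i)^-1 * dchi ((r i)^-1 * x 0 i) else chi ((r i)^-1 * x 0 i)).

Lemma boxcut_C1_grad r : C1_grad (boxcut r) (dboxcut r).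
Proof.
apply: (C1_grad_ext (@tensor_C1_grad R n (fun i y => chi ((r i)^-1 * y))
  (fun i y => (r i)^-1 * dchi ((r i)^-1 * y)) _ _)).
- move=> i t.
  have hl : is_derive t (1 : R) (fun z => (r i)^-1 * z) (r i)^-1.
    have := @is_deriveZ _ _ _ id (r i)^-1 t 1 1 (is_derive_id _ _).
    by rewrite /GRing.scale/= mulr1.
  by have := is_derive_comp1 hl (is_derive_chi ((r i)^-1 * t)); rewrite mulrC.
- move=> i; apply: contM; first exact: contC.
  apply: (cont_comp cont_dchi); apply: contM; first exact: contC.
  by move=> x; exact: cvg_id.
- by [].
- by move=> j x; apply: eq_bigr => i _; case: ifP.
Qed.

Lemma boxcut_ge0 r x : 0 <= boxcut r x.
Proof. by apply: prodr_ge0 => i _; exact: chi_ge0. Qed.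

Lemma boxcut_le1 r x : boxcut r x <= 1.
Proof. by apply: prodr_ile1 => i _; rewrite chi_ge0 chi_le1. Qed.

Lemma boxcut1 r (x : E) : (forall i, 0 < r i) -> (forall i, `|x 0 i| <= r i) -> boxcut r x = 1.
Proof.
move=> r0 xr; apply: big1 => i _; rewrite chi1// normrM gtr0_norm ?invr_gt0//.
by rewrite ler_pdivrMl// mulr1.
Qed.

Lemma boxcut0 r (x : E) i : (forall i, 0 < r i) -> 2 * r i <= `|x 0 i| -> boxcut r x = 0.
Proof.
move=> r0 xr; rewrite /boxcut (bigD1 i)//= chi0 ?mul0r// normrM gtr0_norm ?invr_gt0//.
by rewrite ler_pdivlMl// mulrC.
Qed.

Lemma dboxcutE r j x : dboxcut r j x = (r j)^-1 * dchi ((r j)^-1 * x 0 j) *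
   \prod_(i | i != j) chi ((r i)^-1 * x 0 i).
Proof.
rewrite /dboxcut (bigD1 j)//= eqxx; congr (_ * _); apply: eq_bigr => i /negPf ->.
by [].
Qed.

Lemma dboxcut_far r j (x : E) i : (forall i, 0 < r i) -> 2 * r i <= `|x 0 i| -> dboxcut r j x = 0.
Proof.
move=> r0 xr; have h : 2 <= `|(r i)^-1 * x 0 i|.
  by rewrite normrM gtr0_norm ?invr_gt0// ler_pdivlMl// mulrC.
rewrite /dboxcut (bigD1 i)//=; case: ifP => _; first by rewrite dchi_far// mulr0 mul0r.
by rewrite chi0// mul0r.
Qed.

Lemma dboxcut_near r j (x : E) : (forall i, 0 < r i) -> `|x 0 j| <= r j -> dboxcut r j x = 0.
Proof.
move=> r0 xr; rewrite dboxcutE dchi_near ?mulr0 ?mul0r// normrM gtr0_norm ?invr_gt0//.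
by rewrite ler_pdivrMl// mulr1.
Qed.

Lemma dboxcut_bound r j x : (forall i, 0 < r i) -> `|dboxcut r j x| <= 16 / r j.
Proof.
move=> r0; rewrite dboxcutE normrM -[leRHS]mulr1 ler_pM//.
  rewrite normrM gtr0_norm ?invr_gt0// mulrC ler_wpM2r ?dchi_bound//.
  by rewrite invr_ge0 ltW.
rewrite ger0_norm; last by apply: prodr_ge0 => i _; exact: chi_ge0.
by apply: prodr_ile1 => i _; rewrite chi_ge0 chi_le1.
Qed.

Lemma boxcut_Cc r : (forall i, 0 < r i) -> Cc (boxcut r).
Proof.
move=> r0; split; first by case: (boxcut_C1_grad r).
have s0 : 0 <= \sum_i 2 * r i.
  by rewrite sumr_ge0// => i _; rewrite mulr_ge0// ltW.
exists (\sum_i 2 * r i) => // x; rewrite ltNge ler_norm_rV// negb_forall => /existsP[i].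
rewrite -ltNge => xi; apply: (@boxcut0 _ _ i) => //.
apply: le_trans (ltW xi); rewrite (bigD1 i)//= lerDl sumr_ge0// => j _.
by rewrite mulr_ge0// ltW.
Qed.

Lemma integ_boxcut r : (forall i, 0 < r i) -> integ (boxcut r) <= \prod_i (4 * r i).
Proof.
move=> r0; have := @integ_le_box R n (boxcut r) (fun i => 2 * r i) 1 (boxcut_Cc r0) ler01.
rewrite mul1r (_ : \prod_i (2 * (2 * r i)) = \prod_i (4 * r i)); last first.
  by apply: eq_bigr => i _; rewrite mulrA; congr (_ * _); ring.
apply.
- by move=> i; rewrite mulr_ge0// ltW.
- by move=> x; rewrite ger0_norm ?boxcut_ge0// boxcut_le1.
- by move=> x i /ltW; exact: boxcut0.
Qed.

End boxcut.
End cutoff.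

(** * Two to four radial dimensions *)

Section high.
Context {R : realType} {n : nat}.
Local Notation E := 'rV[R]_n.+1.
Local Notation m := (@ord_max n).

Lemma C1_grad_radius2 : C1_grad (@radius2 R n) (fun j x => if j != m then 2 * x 0 j else 0).
Proof.
apply: (C1_grad_ext (C1_grad_sum (index_enum _) (fun i _ => C1_grad_sqr (C1_grad_coord i)))) => // j x.
case: ifPn => jm.
  rewrite (bigD1 j)//= eqxx mulr1 big1 ?addr0// => i /andP[_ ij].
  by rewrite eq_sym (negPf ij) mulr0.
rewrite big1// => i im; case: eqVneq => [ji|_]; last by rewrite mulr0.
by rewrite ji im in jm.
Qed.

Lemma radius2_ge0 (x : E) : 0 <= radius2 x.
Proof. by rewrite sumr_ge0// => i _; rewrite sqr_ge0. Qed.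

Lemma radius2p1_gt0 (x : E) : 0 < 1 + radius2 x.
Proof. by rewrite ltr_pwDl// radius2_ge0. Qed.

(** The real power (1 + s^2)^(- p / 2). *)
Definition weight (p : R) (x : E) := expR (- (p / 2) * ln (1 + radius2 x)).

Lemma weight_C1_grad p : C1_grad (weight p)
  (fun j x => if j != m then - (p / (1 + radius2 x)) * x 0 j * weight p x else 0).
Proof.
have h1 := C1_gradD (C1_gradC 1) C1_grad_radius2.
have h2 : C1_grad (fun x : E => ln (1 + radius2 x))
    (fun j x => (1 + radius2 x)^-1 * (0 + if j != m then 2 * x 0 j else 0)).
  refine (@C1_grad_comp _ _ (@ln R) (fun z => z^-1) _ _ h1 _ _).
    by move=> x; apply: is_derive1_ln; exact: radius2p1_gt0.
  apply: contV => [x|]; first by rewrite gt_eqF// radius2p1_gt0.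
  by case: h1.
apply: (C1_grad_ext (C1_grad_exp (C1_gradZ (- (p / 2)) h2))) => // j x.
rewrite /weight; case: ifP => _; last by rewrite addr0 !mulr0.
by field; rewrite gt_eqF// radius2p1_gt0.
Qed.

Lemma weight_gt0 p x : 0 < weight p x. Proof. exact: expR_gt0. Qed.

Variables (beta : R -> R) (u : E -> R) (Du : 'I_n.+1 -> E -> R)
  (DDu : 'I_n.+1 -> 'I_n.+1 -> E -> R).
Hypotheses (hb : C1 beta) (C1u : C1_grad u Du) (C1Du : forall i, C1_grad (Du i) (fun j => DDu j i))
  (lapu : forall x, \sum_j DDu j j x = 2^-1 * beta (u x))
  (st : stable beta u) (ax : axially_symmetric u).

Let g (x : E) := radial_grad2 Du x.
(* Radial differentiation of the weight brings out this factor: x' . grad'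
   (weight p) = - p theta weight p. *)
Let theta (x : E) := radius2 x / (1 + radius2 x).

Let g_ge0 x : 0 <= g x. Proof. by rewrite sumr_ge0// => i _; rewrite sqr_ge0. Qed.

Let cg : continuous g.
Proof. by apply: cont_sum => i _; apply: contX; case: (C1Du i). Qed.

Let cradius2 : continuous (@radius2 R n). Proof. by case: C1_grad_radius2. Qed.

Let ctheta : continuous theta.
Proof.
apply: contM; first exact: cradius2.
apply: contV => [x|]; first by rewrite gt_eqF// radius2p1_gt0.
by apply: contD; [exact: contC|exact: cradius2].
Qed.

Let cweight p : continuous (weight p). Proof. by case: (weight_C1_grad p). Qed.

Let theta01 x : 0 <= theta x <= 1.
Proof.
have := radius2_ge0 x; have := radius2p1_gt0 x => h1 h2; rewrite divr_ge0 ?(ltW h1)//=.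
by rewrite ler_pdivrMr// mul1r lerDr.
Qed.

Lemma young (e y z : R) : 0 < e -> 2 * y * z <= e * y ^+ 2 + z ^+ 2 / e.
Proof.
move=> e0; rewrite -subr_ge0.
rewrite (_ : _ - _ = (e * y - z) ^+ 2 / e); first by rewrite divr_ge0 ?sqr_ge0// ltW.
by field; rewrite gt_eqF.
Qed.

(** Insert eta = weight * zeta in [cylinder_ineq]. The coefficient of zeta^2
    is at most - c0 theta, and Young's inequality absorbs half of it against
    the terms that contain one derivative of zeta. For p = 1 + alpha the
    constant c0 is k - 1 - alpha^2. *)
Lemma weighted_ineq (p c0 : R) zeta dzeta : 1 <= p <= 3 -> 2 <= n%:R :> R ->
  c0 = n%:R - 2 + 2 * p - p ^+ 2 -> 0 < c0 -> C1_grad zeta dzeta -> Cc zeta ->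
  c0 / 2 * integ (fun x => g x * theta x * weight p x ^+ 2 * zeta x ^+ 2) <=
  (8 / c0 + 1) * integ (fun x => g x * weight p x ^+ 2 * (1 + radius2 x) * \sum_j dzeta j x ^+ 2).
Proof.
move=> /andP[p1 p3] n2 c0E c00 hz cz.
have heta := C1_gradM (weight_C1_grad p) hz.
have ceta : Cc (fun x => weight p x * zeta x) by exact: CcMr.
have hT := cylinder_ineq hb C1u C1Du lapu st ax heta ceta.
set T := (X in integ X) in hT.
have cdz j := C1_grad_Cc j hz cz.
have cT : Cc T.
  have cde j := C1_grad_Cc j heta ceta.
  apply: CcD; first apply: CcB.
  - by apply: CcMr; [exact: contM|apply: Cc_sum => j _; exact: (Cc_sqr (cde j))].
  - by apply: CcMr; [apply: contM => //; exact: contC|exact: (Cc_sqr ceta)].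
  - apply: CcMr; first by apply: contM => //; apply: contM; [exact: contC|case: ceta].
    by apply: Cc_sum => i _; apply: CcMr; [exact: cont_coord|exact: (cde i)].
have c1 : Cc (fun x => g x * theta x * weight p x ^+ 2 * zeta x ^+ 2).
  apply: CcMr; last exact: Cc_sqr.
  by apply: contM; [exact: contM|exact: contX].
have c2 : Cc (fun x => g x * weight p x ^+ 2 * (1 + radius2 x) * \sum_j dzeta j x ^+ 2).
  apply: CcMr; last by apply: Cc_sum => j _; apply: Cc_sqr.
  by apply: contM; [apply: contM => //; exact: contX|apply: contD => //; exact: contC].
have key x : c0 / 2 * (g x * theta x * weight p x ^+ 2 * zeta x ^+ 2) + T x <=
    (8 / c0 + 1) * (g x * weight p x ^+ 2 * (1 + radius2 x) * \sum_j dzeta j x ^+ 2).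
  have q0 := radius2p1_gt0 x; have s0 := radius2_ge0 x.
  pose a := p / (1 + radius2 x); pose h := weight p x; pose z := zeta x.
  pose X := \sum_(i | i != m) x 0 i * dzeta i x; pose Z := \sum_j dzeta j x ^+ 2.
  pose th := theta x.
  have ath : a * radius2 x = p * th by rewrite /a /th /theta mulrAC mulrA.
  have Es : \sum_j ((if j != m then - a * x 0 j * h else 0) * z + h * dzeta j x) ^+ 2 =
      h ^+ 2 * (a ^+ 2 * radius2 x * z ^+ 2 - 2 * a * z * X + Z).
    transitivity (\sum_j (h ^+ 2 * a ^+ 2 * z ^+ 2 * (if j != m then x 0 j ^+ 2 else 0) -
      2 * h ^+ 2 * a * z * (if j != m then x 0 j * dzeta j x else 0) + h ^+ 2 * dzeta j x ^+ 2)).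
      by apply: eq_bigr => j _; case: ifP => _; ring.
    rewrite big_split sumrB/= -!mulr_sumr -!big_mkcond -/X -/Z -/(radius2 x); ring.
  have Ex : \sum_(i | i != m) x 0 i * ((if i != m then - a * x 0 i * h else 0) * z + h * dzeta i x) =
      h * (- a * radius2 x * z + X).
    transitivity (\sum_(i | i != m) (- h * a * z * x 0 i ^+ 2 + h * (x 0 i * dzeta i x))).
      by apply: eq_bigr => j ->; ring.
    by rewrite big_split/= -!mulr_sumr -/X -/(radius2 x); ring.
  have TE : T x = g x * h ^+ 2 * (radius2 x * (a ^+ 2 * radius2 x * z ^+ 2 - 2 * a * z * X + Z)
      - (n%:R - 2) * z ^+ 2 + 2 * z * (- a * radius2 x * z + X)).
    by rewrite /T Es Ex; rewrite -/h -/z -/(g x); ring.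
  have /andP[th0 th1] := theta01 x; rewrite -/th in th0 th1.
  (* Young's inequality coordinate by coordinate, with the parameter chosen so
     that the squares of z x_i add up to c0 / 2 * theta * z^2. *)
  have XB : 2 * (1 - p * th) * z * X <= c0 / 2 * th * z ^+ 2 + 8 / c0 * (1 + radius2 x) * Z.
    have b4 : (1 - p * th) ^+ 2 <= 4.
      have y0 : 0 <= p * th by rewrite mulr_ge0//; lra.
      have y3 : p * th <= 3 by rewrite -[leRHS]mulr1 ler_pM//; lra.
      by rewrite -subr_ge0 (_ : _ - _ = (1 + p * th) * (3 - p * th)); [apply: mulr_ge0; lra|ring].
    pose e := c0 / 2 / (1 + radius2 x).
    have e0 : 0 < e by rewrite !divr_gt0.
    apply: (@le_trans _ _ (\sum_(i | i != m) (e * (z * x 0 i) ^+ 2 +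
       ((1 - p * th) * dzeta i x) ^+ 2 / e))).
      rewrite /X mulr_sumr; apply: ler_sum => i _.
      by apply: le_trans (young _ _ e0); rewrite le_eqVlt; apply/orP; left; apply/eqP; ring.
    rewrite big_split/=; apply: lerD.
      rewrite le_eqVlt; apply/orP; left; apply/eqP.
      rewrite /th /theta /radius2 -mulr_sumr.
      transitivity (e * (z ^+ 2 * radius2 x)).
        by congr (_ * _); rewrite /radius2 mulr_sumr; apply: eq_bigr => i _; rewrite exprMn.
      by rewrite /e -/(radius2 x); field; rewrite gt_eqF.
    apply: (@le_trans _ _ (\sum_(i | i != m) 8 / c0 * (1 + radius2 x) * dzeta i x ^+ 2)).
      apply: ler_sum => i _; rewrite exprMn.
      rewrite (_ : _ / e = (1 - p * th) ^+ 2 * (2 / c0 * (1 + radius2 x) * dzeta i x ^+ 2)); last first.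
        by rewrite /e; field; rewrite !gt_eqF.
      rewrite (_ : 8 / c0 * _ * _ = 4 * (2 / c0 * (1 + radius2 x) * dzeta i x ^+ 2)); last first.
        by field; rewrite gt_eqF.
      rewrite ler_wpM2r// mulr_ge0 ?sqr_ge0// mulr_ge0 ?(ltW q0)// divr_ge0 ?(ltW c00)//.
    rewrite -mulr_sumr ler_wpM2l//; first by rewrite mulr_ge0 ?(ltW q0)// divr_ge0 ?(ltW c00).
    by rewrite /Z [leRHS](bigD1 m)//= lerDr sqr_ge0.
  rewrite TE (_ : _ + _ = g x * h ^+ 2 * (c0 / 2 * th * z ^+ 2 +
      (radius2 x * (a ^+ 2 * radius2 x * z ^+ 2 - 2 * a * z * X + Z)
      - (n%:R - 2) * z ^+ 2 + 2 * z * (- a * radius2 x * z + X)))); last first.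
    by rewrite -/h -/z -/th; ring.
  rewrite (_ : (8 / c0 + 1) * _ = g x * h ^+ 2 * ((8 / c0 + 1) * (1 + radius2 x) * Z)); last first.
    by rewrite -/h -/Z; ring.
  apply: ler_wpM2l; first by rewrite mulr_ge0 ?sqr_ge0 ?g_ge0.
  have -> : radius2 x * (a ^+ 2 * radius2 x * z ^+ 2 - 2 * a * z * X + Z)
      - (n%:R - 2) * z ^+ 2 + 2 * z * (- a * radius2 x * z + X) =
      (a * radius2 x) ^+ 2 * z ^+ 2 - 2 * (a * radius2 x) * z * X + radius2 x * Z
      - (n%:R - 2) * z ^+ 2 - 2 * (a * radius2 x) * z ^+ 2 + 2 * z * X by ring.
  rewrite ath.
  have Z0 : 0 <= Z by rewrite sumr_ge0// => j _; exact: sqr_ge0.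
  (* The two sides differ by terms with the factor th (1 - th) or 1 - th. *)
  have K1 : c0 * th <= (n%:R - 2) + 2 * (p * th) - (p * th) ^+ 2.
    rewrite c0E -subr_ge0.
    rewrite (_ : _ - _ = (n%:R - 2) * (1 - th) + p ^+ 2 * (th * (1 - th))); last by ring.
    have t1 : 0 <= 1 - th by rewrite subr_ge0.
    apply: addr_ge0; first by apply: mulr_ge0 => //; rewrite subr_ge0.
    by apply: mulr_ge0; [exact: sqr_ge0|exact: mulr_ge0].
  have z20 := sqr_ge0 z.
  have K2 := ler_wpM2r z20 K1.
  have K3 : (8 / c0 + 1) * (1 + radius2 x) * Z = 8 / c0 * (1 + radius2 x) * Z + radius2 x * Z + Z by ring.
  rewrite K3.
  have E4 : 2 * (1 - p * th) * z * X = 2 * z * X - 2 * (p * th) * z * X by ring.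
  rewrite E4 in XB.
  have E5 : ((n%:R - 2) + 2 * (p * th) - (p * th) ^+ 2) * z ^+ 2 =
    (n%:R - 2) * z ^+ 2 + 2 * (p * th) * z ^+ 2 - (p * th) ^+ 2 * z ^+ 2 by ring.
  rewrite E5 in K2.
  have E6 : c0 / 2 * th * z ^+ 2 = c0 * th * z ^+ 2 / 2 by field.
  rewrite E6 in XB *.
  set A1 := 2 * z * X in XB *; set A2 := 2 * (p * th) * z * X in XB *.
  set A3 := c0 * th * z ^+ 2 in XB K2 *; set A4 := 8 / c0 * (1 + radius2 x) * Z in XB *.
  lra.
have cc1 := CcZ (c0 / 2) c1; have cc2 := CcZ (8 / c0 + 1) c2.
rewrite -!integZ//; have hle := le_integ (CcD cc1 cT) cc2 key.
by move: hle; rewrite integD//; move: hT; lra.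
Qed.

Let ln2 : R := ln 2.
Let ln2_gt0 : 0 < ln2. Proof. by rewrite ln_gt0// ltr1n. Qed.

Let pow2E j : 2 ^+ j = expR (j%:R * ln2) :> R.
Proof. by rewrite expRM_natl lnK// posrE. Qed.

(** Half-lengths 2^J along the axis and 2^j across it. *)
Definition cyl_radius (J j : nat) (i : 'I_n.+1) : R := if i == m then 2 ^+ J else 2 ^+ j.

Let radius_gt0 J j i : 0 < cyl_radius J j i.
Proof. by rewrite /cyl_radius; case: ifP => _; rewrite exprn_gt0. Qed.

(** The j-th cylinder accounts for the points at distance about 2^j from the
    axis, where (1 + s^2)^(- al) is at most 2^(- 2 al (j - 1)). *)
Lemma dyadic_cover (al : R) (J : nat) (x : E) : 0 <= al -> (forall i, `|x 0 i| <= 2 ^+ J) ->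
  expR (- (al * ln (1 + radius2 x))) <= \sum_(j < J.+1)
    expR (al * (2 * ln2)) * expR (- (al * (2 * j%:R * ln2))) * boxcut (cyl_radius J j) x.
Proof.
move=> al0 xJ.
pose P j := [forall i : 'I_n.+1, (i != m) ==> (`|x 0 i| <= 2 ^+ j)].
have PJ : P J by apply/forallP => i; apply/implyP => _; exact: xJ.
(* For the least j such that x' lies in the cube of radius 2^j, some
   coordinate exceeds 2^(j - 1) unless j = 0. *)
case: (ex_minnP (ex_intro P J PJ)) => j Pj jmin.
have jJ : (j < J.+1)%N by rewrite ltnS jmin.
rewrite (bigD1 (Ordinal jJ))//= boxcut1//; last first.
  move=> i; rewrite /cyl_radius; case: eqVneq => [->//|im].
  by have /forallP/(_ i)/implyP := Pj; apply.
apply: ler_wpDr.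
  apply: sumr_ge0 => i _; apply: mulr_ge0; last exact: boxcut_ge0.
  by rewrite mulr_ge0// expR_ge0.
rewrite mulr1 -expRD ler_expR -mulrBr -mulrN ler_wpM2l//.
have s0 := radius2_ge0 x.
case: j Pj jmin jJ => [|j] Pj jmin jJ.
  rewrite mulr0 mul0r subr0 (@le_trans _ _ 0)// ?oppr_le0 ?ln_ge0//; first by rewrite lerDl.
  by rewrite mulr_ge0// ltW.
have : ~~ P j by apply/negP => /jmin; rewrite ltnn.
rewrite negb_forall => /existsP[i]; rewrite negb_imply -ltNge => /andP[im xi].
have h4 : expR (2 * j%:R * ln2) <= 1 + radius2 x.
  rewrite -mulrA mulr2n mulrDl !mul1r expRD -pow2E.
  apply: (@le_trans _ _ (x 0 i ^+ 2)).
    rewrite -[x 0 i ^+ 2](real_normK (num_real _)) -expr2 lerXn2r ?nnegrE ?exprn_ge0//.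
    exact: ltW.
  rewrite /radius2 (bigD1 i)//= addrCA lerDl addr_ge0// sumr_ge0// => l _; exact: sqr_ge0.
have : ln (expR (2 * j%:R * ln2)) <= ln (1 + radius2 x).
  by rewrite ler_ln ?posrE ?expR_gt0// radius2p1_gt0.
rewrite expRK -[j.+1%:R]natr1; lra.
Qed.

Lemma cyl_volume J j : \prod_i (4 * cyl_radius J j i) = 4 ^+ n.+1 * (2 ^+ J * 2 ^+ j ^+ n).
Proof.
rewrite big_split/= prodr_const card_ord; congr (_ * _).
rewrite (bigD1 m)//= /cyl_radius eqxx; congr (_ * _).
rewrite (eq_bigr (fun=> 2 ^+ j)); last by move=> i /negPf ->.
rewrite prodr_const (_ : #|_| = n)//.
by have := cardC1 m; rewrite card_ord; apply.
Qed.

Lemma weight_sqr p x : weight p x ^+ 2 * (1 + radius2 x) = expR (- ((p - 1) * ln (1 + radius2 x))).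
Proof.
rewrite /weight -expRM_natl -{2}(@lnK _ (1 + radius2 x)) ?posrE ?radius2p1_gt0// -expRD; congr expR.
by field.
Qed.

(** At scale 2^J the squared gradient of the cutoff is of order 4^(- J). By
    [dyadic_cover] the weight costs at most 2^(J + (k - 2 alpha) j) for each j
    <= J + 1, and k - 2 alpha = k / 6 <= 2 / 3. Altogether this is J 2^(- J /
    3), for which the cruder bound 1 / J is enough. *)
Lemma tail_decay G (J : nat) : (n <= 4)%N -> (0 < J)%N -> 0 <= G -> (forall x, g x <= G) ->
  integ (fun x => g x * weight (1 + 5 * n%:R / 12) x ^+ 2 * (1 + radius2 x) *
     \sum_j dboxcut (fun=> 2 ^+ J) j x ^+ 2) <=
  G * (n.+1%:R * 16 ^+ 2) * expR (5 * n%:R / 12 * (2 * ln2)) * 4 ^+ n.+1 * 2 *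
   expR (2 / 3 * ln2) * (108 / ln2 ^+ 2) / J%:R.
Proof.
move=> n4 J0 G0 gG.
set al := 5 * n%:R / 12; set p := 1 + al.
have al0 : 0 <= al by rewrite /al divr_ge0// mulr_ge0.
pose r : 'I_n.+1 -> R := fun=> 2 ^+ J.
have r0 i : 0 < r i by rewrite exprn_gt0.
have hcut := boxcut_C1_grad r; have ccut := boxcut_Cc r0.
pose A := expR (al * (2 * ln2)).
pose b (j : nat) := expR (- (al * (2 * j%:R * ln2))).
pose K := G * (n.+1%:R * (16 / 2 ^+ J) ^+ 2).
have K0 : 0 <= K by rewrite mulr_ge0// mulr_ge0// sqr_ge0.
have A0 : 0 <= A by exact: expR_ge0.
have b0 j : 0 <= b j by exact: expR_ge0.
have cl : Cc (fun x => g x * weight p x ^+ 2 * (1 + radius2 x) * \sum_j dboxcut r j x ^+ 2).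
  apply: CcMr.
    apply: contM; last by apply: contD => //; exact: contC.
    by apply: contM => //; exact: contX.
  by apply: Cc_sum => j _; apply: Cc_sqr; exact: C1_grad_Cc hcut ccut.
have cr : Cc (fun x => \sum_(j < J.+2) K * (A * b j) * boxcut (cyl_radius J.+1 j) x).
  by apply: Cc_sum => j _; apply: CcZ; exact: boxcut_Cc.
apply: (le_trans (le_integ cl cr _)).
  move=> x.
  have [[i xi]|hx] := pselect (exists i, 2 ^+ J.+1 < `|x 0 i|).
    rewrite [X in _ * X]big1 ?mulr0; last first.
      move=> j _; rewrite (@dboxcut_far _ _ _ _ _ i) ?expr0n// /r -exprS; exact: ltW.
    apply: sumr_ge0 => j _; apply: mulr_ge0; last exact: boxcut_ge0.
    by rewrite !mulr_ge0.
  have xJ i : `|x 0 i| <= 2 ^+ J.+1.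
    by rewrite leNgt; apply/negP => xi; apply: hx; exists i.
  have Zb : \sum_j dboxcut r j x ^+ 2 <= n.+1%:R * (16 / 2 ^+ J) ^+ 2.
    apply: (@le_trans _ _ (\sum_(j < n.+1) (16 / 2 ^+ J) ^+ 2)).
      apply: ler_sum => j _; rewrite -[dboxcut r j x ^+ 2](real_normK (num_real _)).
      by rewrite lerXn2r ?nnegrE ?divr_ge0 ?exprn_ge0//; exact: dboxcut_bound.
    by rewrite sumr_const card_ord -[leLHS]mulr_natl.
  have hc := dyadic_cover al0 xJ.
  rewrite -(mulrA (g x)) weight_sqr (_ : p - 1 = al); last by rewrite /p addrC addKr.
  rewrite mulrAC; apply: (@le_trans _ _ (K * expR (- (al * ln (1 + radius2 x))))).
    rewrite ler_wpM2r ?expR_ge0// /K ler_pM// sumr_ge0// => j _; exact: sqr_ge0.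
  apply: (le_trans (ler_wpM2l K0 hc)); rewrite mulr_sumr le_eqVlt; apply/orP; left; apply/eqP.
  by apply: eq_bigr => j _; rewrite -[RHS]mulrA.
rewrite integ_sum; last by move=> j _; apply: CcZ; exact: boxcut_Cc.
have term (j : 'I_J.+2) : integ (fun x => K * (A * b j) * boxcut (cyl_radius J.+1 j) x) <=
    K * A * (4 ^+ n.+1 * 2 ^+ J.+1) * expR (2 / 3 * (J.+1%:R * ln2)).
  rewrite integZ; last exact: boxcut_Cc.
  have KA0 : 0 <= K * (A * b j) by rewrite !mulr_ge0.
  apply: (le_trans (ler_wpM2l KA0 (integ_boxcut (radius_gt0 _ _)))).
  rewrite cyl_volume.
  rewrite [leLHS](_ : _ = K * A * (4 ^+ n.+1 * 2 ^+ J.+1) * (b j * 2 ^+ j ^+ n)); last by ring.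
  apply: ler_wpM2l; first by rewrite !mulr_ge0 ?exprn_ge0.
  rewrite pow2E -expRM_natl /b -expRD ler_expR.
  have jJ : j%:R <= J.+1%:R :> R by rewrite ler_nat -ltnS.
  have nn : n%:R <= 4 :> R by rewrite (ler_nat R n 4).
  have n0 : 0 <= n%:R :> R by [].
  have jl : 0 <= j%:R * ln2 by rewrite mulr_ge0// ltW.
  apply: (@le_trans _ _ (2 / 3 * (j%:R * ln2))).
    rewrite /al (_ : _ + _ = n%:R / 6 * (j%:R * ln2)); last by field.
    by rewrite ler_wpM2r//; lra.
  by rewrite ler_wpM2l ?ler_wpM2r ?(ltW ln2_gt0)//; lra.
apply: (le_trans (ler_sum _ (fun j _ => term j))).
rewrite sumr_const card_ord -[_ *+ _]mulr_natr.
have Jp : 0 < J%:R :> R by rewrite ltr0n.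
(* The exponential factor 2^(- J / 3) beats J^2: y = J ln 2 / 3 has exp (- y)
   y^2 <= 4, and 108 = 3 * 4 * 9 after J + 2 <= 3 J. *)
have dec := @expR_decay R 2 (J%:R * ln2 / 3) ltac:(by rewrite divr_gt0 ?mulr_gt0).
have e23 : expR (2 / 3 * (J.+1%:R * ln2)) = expR (2 / 3 * ln2) * 2 ^+ J * expR (- (J%:R * ln2 / 3)).
  by rewrite pow2E -!expRD -natr1; congr expR; field.
rewrite e23 /K (exprS 2 J).
have P0 : 0 < 2 ^+ J :> R by rewrite exprn_gt0.
rewrite [leLHS](_ : _ = G * (n.+1%:R * 16 ^+ 2) * A * 4 ^+ n.+1 * 2 *
   expR (2 / 3 * ln2) * (expR (- (J%:R * ln2 / 3)) * J.+2%:R)); last first.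
  by set P := 2 ^+ J in P0 *; field; rewrite gt_eqF.
rewrite -/A -[leRHS]mulrA; apply: ler_wpM2l.
  by do 3 (apply: mulr_ge0 => //; rewrite ?expR_ge0 ?exprn_ge0//); rewrite !mulr_ge0.
have J2 : J.+2%:R <= 3 * J%:R :> R.
  by rewrite -natrM ler_nat; case: (J) J0 => // k _; rewrite mulnS; lia.
apply: (le_trans (ler_wpM2l (expR_ge0 _) J2)).
rewrite ler_pdivlMr// ler_pdivlMr ?exprn_gt0//.
move: dec; rewrite (_ : 2%:R ^+ 2 = 4 :> R); last by ring.
rewrite (_ : (J%:R * ln2 / 3) ^+ 2 = J%:R ^+ 2 * ln2 ^+ 2 / 9); last by field.
move=> dec.
rewrite [leLHS](_ : _ = 27 * (expR (- (J%:R * ln2 / 3)) * (J%:R ^+ 2 * ln2 ^+ 2 / 9))); last by field.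
lra.
Qed.

(** By [weighted_ineq] and [tail_decay] the integral of g theta weight^2 over
    a fixed cube is O(1 / J) for all J, hence 0. So the radial gradient
    vanishes off the axis; on the axis the symmetry alone forces it to
    vanish. *)
Lemma radial_derivative_eq0_high G : (2 <= n <= 4)%N -> (forall x, g x <= G) ->
  forall x i, i != m -> Du i x = 0.
Proof.
move=> /andP[n2 n4] gG x0 i im.
have G0 : 0 <= G := le_trans (g_ge0 x0) (gG x0).
pose al : R := 5 * n%:R / 12; pose p := 1 + al.
pose c0 : R := n%:R - 2 + 2 * p - p ^+ 2.
have [n2R n4R] : 2 <= n%:R :> R /\ n%:R <= 4 :> R.
  by split; [rewrite (ler_nat R 2 n)|rewrite (ler_nat R n 4)].
(* Here c0 = k - 1 - (5 k / 12)^2, evaluated for k = 2, 3, 4. *)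
have c00 : 0 < c0.
  rewrite /c0 /p /al; move: n2 n4; case: (n) => [|[|[|[|[|//]]]]] // _ _.
  - by rewrite (_ : _ - _ = 11 / 36); [lra|field].
  - by rewrite (_ : _ - _ = 7 / 16); [lra|field].
  - by rewrite (_ : _ - _ = 2 / 9); [lra|field].
have p13 : 1 <= p <= 3 by rewrite /p /al; apply/andP; split; lra.
pose C := (8 / c0 + 1) * (G * (n.+1%:R * 16 ^+ 2) * expR (5 * n%:R / 12 * (2 * ln2)) * 4 ^+ n.+1 * 2 *
   expR (2 / 3 * ln2) * (108 / ln2 ^+ 2)) * (2 / c0).
have bound (J : nat) : (0 < J)%N ->
    integ (fun x => g x * theta x * weight p x ^+ 2 * boxcut (fun=> 2 ^+ J) x ^+ 2) <= C / J%:R.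
  move=> J0; pose r : 'I_n.+1 -> R := fun=> 2 ^+ J.
  have r0 i' : 0 < r i' by rewrite exprn_gt0.
  have h1 := weighted_ineq p13 n2R erefl c00 (boxcut_C1_grad r) (boxcut_Cc r0).
  have h2 := tail_decay n4 J0 G0 gG.
  have c8 : 0 <= 8 / c0 + 1 by rewrite addr_ge0// divr_ge0// ltW.
  have h3 := le_trans h1 (ler_wpM2l c8 h2).
  rewrite (_ : C / J%:R = (c0 / 2)^-1 * ((8 / c0 + 1) * (G * (n.+1%:R * 16 ^+ 2) *
    expR (5 * n%:R / 12 * (2 * ln2)) * 4 ^+ n.+1 * 2 *
    expR (2 / 3 * ln2) * (108 / ln2 ^+ 2) / J%:R))).
    by rewrite ler_pdivlMl ?divr_gt0.
  by rewrite /C; field; rewrite !gt_eqF ?ltr0n.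
have W0 y : 0 <= g y * theta y * weight p y ^+ 2.
  have /andP[t0 _] := theta01 y.
  exact: (mulr_ge0 (mulr_ge0 (g_ge0 y) t0) (sqr_ge0 _)).
have zero (J0 : nat) : integ (fun x => g x * theta x * weight p x ^+ 2 * boxcut (fun=> 2 ^+ J0) x ^+ 2) = 0.
  pose r (J : nat) : 'I_n.+1 -> R := fun=> 2 ^+ J.
  have r0 J i' : 0 < r J i' by rewrite exprn_gt0.
  have cF J : Cc (fun x => g x * theta x * weight p x ^+ 2 * boxcut (r J) x ^+ 2).
    apply: CcMr; first by apply: contM; [exact: contM|exact: contX].
    exact: Cc_sqr (boxcut_Cc (r0 J)).
  have F0 J x : 0 <= g x * theta x * weight p x ^+ 2 * boxcut (r J) x ^+ 2.
    exact: mulr_ge0 (W0 x) (sqr_ge0 _).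
  apply/eqP; rewrite eq_le integ_ge0 ?andbT//; last exact: F0.
  rewrite leNgt; apply/negP; set a := integ _ => a0.
  (* The integrals increase with the scale, so the one at scale J0 is at most
     C / J for every J > J0. *)
  pose J := (maxn J0.+1 (Num.truncn (C / a)).+1).
  have Jp : (0 < J)%N by rewrite leq_max.
  have : a <= C / J%:R.
    apply: le_trans (bound J Jp); apply: le_integ; [exact: (cF J0)|exact: (cF J)|].
    move=> x; have [[i' xi]|hx] := pselect (exists i', 2 * 2 ^+ J0 < `|x 0 i'|).
      by rewrite (@boxcut0 _ _ (r J0) x i' (r0 J0) (ltW xi)) expr0n mulr0 F0.
    rewrite [in leRHS]boxcut1 //.
      rewrite expr1n mulr1 ler_piMr//.
      by rewrite exprn_ile1 ?boxcut_ge0 ?boxcut_le1.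
    move=> i'; rewrite leNgt; apply/negP => xi; apply: hx; exists i'.
    apply: le_lt_trans xi; rewrite -exprS ler_eXn2l ?ltr1n// /J leq_maxl//.
  rewrite ler_pdivlMr ?ltr0n// mulrC -ler_pdivlMr// leNgt => /negP; apply.
  apply: (lt_le_trans (truncnS_gt _)); rewrite ler_nat leq_maxr//.
have gt0 x : g x * theta x = 0.
  pose J := (Num.truncn `|x|).+1.
  have xJ : `|x| <= 2 ^+ J.
    apply/ltW/(lt_le_trans (truncnS_gt _)).
    by rewrite -natrX ler_nat ltnW// ltn_expl.
  pose r : 'I_n.+1 -> R := fun=> 2 ^+ J.
  have r0 i' : 0 < r i' by rewrite exprn_gt0.
  have cF : Cc (fun x => g x * theta x * weight p x ^+ 2 * boxcut r x ^+ 2).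
    apply: CcMr; first by apply: contM; [exact: contM|exact: contX].
    exact: Cc_sqr (boxcut_Cc r0).
  have F0 y : 0 <= g y * theta y * weight p y ^+ 2 * boxcut r y ^+ 2.
    exact: mulr_ge0 (W0 y) (sqr_ge0 _).
  have := integ_eq0 cF F0 (zero J) x.
  rewrite boxcut1// => [|i']; last exact: le_trans (coord_le_norm _ _) xJ.
  by rewrite expr1n mulr1 => /eqP; rewrite mulf_eq0 expf_eq0/= (gt_eqF (weight_gt0 _ _)) orbF => /eqP.
(* On the axis theta vanishes; there the differentiated symmetry relation,
   used with a second radial index j, gives the claim. *)
have [s0|s0] := eqVneq (radius2 x0) 0.
  have x00 j : j != m -> x0 0 j = 0.
    move=> jm; have := psumr_eq0P (fun j _ => sqr_ge0 (x0 0 j)) s0 jm.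
    by move=> /eqP; rewrite sqrf_eq0 => /eqP.
  have [j jm ij] : exists2 j : 'I_n.+1, j != m & j != i.
    have n0 : (0 < n.+1)%N by []. have n1 : (1 < n.+1)%N by apply: ltnW.
    pose j0 := Ordinal n0; pose j1 := Ordinal n1.
    have j0m : j0 != m by rewrite -val_eqE/= eq_sym -lt0n ltnW.
    have j1m : j1 != m by rewrite -val_eqE/= eq_sym neq_ltn n2 orbT.
    have [ij|ij] := eqVneq j0 i; last by exists j0.
    by exists j1 => //; rewrite -ij -val_eqE.
  have := axial_rot_derive C1u C1Du ax x0 jm im.
  by rewrite !x00// (negPf ij) !mul0r addr0 !subr0.
have := gt0 x0 => /eqP; rewrite mulf_eq0 /theta mulf_eq0 invr_eq0 (negPf s0) (gt_eqF (radius2p1_gt0 _)) !orbF.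
move=> /eqP g0; have := psumr_eq0P (fun j _ => sqr_ge0 (Du j x0)) g0 im.
by move=> /eqP; rewrite sqrf_eq0 => /eqP.
Qed.

End high.

(** * A Kato-type inequality *)

Section kato.
Context {R : realType} {n : nat}.
Local Notation E := 'rV[R]_n.
Variables (beta : R -> R) (u : E -> R) (Du : 'I_n -> E -> R)
  (DDu : 'I_n -> 'I_n -> E -> R).
Hypotheses (hb : C1 beta) (C1u : C1_grad u Du) (C1Du : forall i, C1_grad (Du i) (fun j => DDu j i))
  (lapu : forall x, \sum_j DDu j j x = 2^-1 * beta (u x)) (st : stable beta u).
Let c x := 2^-1 * derive1 beta (u x).

(** A quantitative form of the fact that |v|, v = d_i u, is a subsolution of
    the linearized equation: stability tested with p zeta, where sqrt (v^2 +
    delta^2) regularizes |v| and eps psi perturbs it. What survives is the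
    energy of the cutoff, an error from the regularization, and the first
    variation in the direction psi. *)
Lemma kato_ineq (K delta eps : R) i zeta dzeta psi dpsi ddpsi (p : E -> R) :
  p = (fun x => Num.sqrt (Du i x ^+ 2 + delta ^+ 2) + eps * psi x) ->
  (forall x, `|c x| <= K) -> 0 < delta -> 0 <= eps ->
  C1_grad zeta dzeta -> Cc zeta -> C1_grad psi dpsi -> (forall x, 0 <= psi x) ->
  (forall j, C1_grad (dpsi j) (fun k => ddpsi k j)) ->
  0 <= integ (fun x => p x ^+ 2 * (\sum_j dzeta j x ^+ 2) +
    K * delta * (p x * zeta x ^+ 2) +
    eps * ((c x * psi x - \sum_j ddpsi j j x) * (p x * zeta x ^+ 2))).
Proof.
move=> pE cK d0 e0 hz cz hpsi psi0 hdpsi.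
pose v := Du i; pose G x := Num.sqrt (v x ^+ 2 + delta ^+ 2).
have q0 x : 0 < v x ^+ 2 + delta ^+ 2 by rewrite ltr_wpDl ?sqr_ge0// exprn_gt0.
have G0 x : 0 < G x by rewrite sqrtr_gt0.
have Gn x : G x != 0 by rewrite gt_eqF.
have G2 x : G x ^+ 2 = v x ^+ 2 + delta ^+ 2 by rewrite sqr_sqrtr// ltW.
have dG x : delta <= G x.
  by rewrite -[leLHS](ger0_norm (ltW d0)) -sqrtr_sqr ler_sqrt ?(ltW (q0 x))// lerDr sqr_ge0.
have hG : C1_grad G (fun j x => v x / G x * DDu j i x).
  apply: (C1_grad_ext (C1_grad_sqrt (C1_gradD (C1_grad_sqr (C1Du i)) (C1_gradC (delta ^+ 2))) q0)) => // j x.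
  by rewrite /= -/(v x) -/(G x) addr0; field; exact: Gn.
have hp : C1_grad p (fun j x => v x / G x * DDu j i x + eps * dpsi j x).
  by rewrite pE; exact: C1_gradD hG (C1_gradZ eps hpsi).
have pGE x : p x = G x + eps * psi x by rewrite pE.
have p0 x : 0 < p x by rewrite pGE ltr_wpDr ?mulr_ge0.
have hxi := C1_gradM hp hz.
have [cp _ _] := hp; have [cv _ cvj] := C1Du i; have [cpsi _ cdpsi] := hpsi.
have [ctz _ _] := hz; have [cG _ _] := hG.
have cxi : Cc (fun x => p x * zeta x) by exact: CcMr.
have cz2 : Cc (fun x => zeta x ^+ 2) by exact: Cc_sqr.
pose phi x := p x * zeta x ^+ 2.
have cphi : Cc phi by exact: CcMr.
have phi0 x : 0 <= phi x by rewrite mulr_ge0 ?sqr_ge0// ltW.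
have hphi : C1_grad phi _ := C1_gradM hp (C1_grad_sqr hz).
set dphi := (X in C1_grad phi X) in hphi.
have [_ _ cdphi] := hphi.
have hT := C1_gradM (C1_gradM (C1Du i) (C1_gradV hG Gn)) hphi.
have cvG : continuous (fun x => v x * (G x)^-1) by apply: contM => //; exact: contV.
have cT : Cc (fun x => v x * (G x)^-1 * phi x) by exact: CcMr.
have ctc : continuous c.
  by apply: contM; [exact: contC|apply: cont_comp; [case: hb|case: C1u]].
have cu : continuous u by case: C1u.
have cb' : continuous (derive1 beta) by case: hb.
have hstab := stable_C1c cu cb' st hxi cxi.
set S := (X in integ X) in hstab.
have hlin := linearized_C1c hb C1u C1Du lapu i hT cT.
set L := (X in integ X) in hlin.
have hdiv : integ (fun x => \sum_j (ddpsi j j x * phi x + dpsi j x * dphi j x)) = 0.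
  rewrite integ_sum; last first.
    move=> j _; have [h1 _ h2] := hdpsi j; apply: CcD; first exact: CcMr.
    by apply: CcMr => //; exact: (C1_grad_Cc j hphi cphi).
  rewrite big1// => j _; apply: (integ_grad0 j (C1_gradM (hdpsi j) hphi)).
  exact: CcMr.
set Q := (X in integ X) in hdiv.
have cS : Cc S.
  apply: CcD; last by apply: CcMr => //; exact: Cc_sqr.
  by apply: Cc_sum => j _; apply: Cc_sqr; exact: C1_grad_Cc hxi cxi.
have cL : Cc L.
  apply: CcD; last by apply: CcMr => //; exact: contM.
  by apply: Cc_sum => j _; apply: CcMr => //; exact: (C1_grad_Cc j hT cT).
have cQ : Cc Q.
  apply: Cc_sum => j _; have [h1 _ h2] := hdpsi j; apply: CcD; first exact: CcMr.
  by apply: CcMr => //; exact: (C1_grad_Cc j hphi cphi).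
have cdz j := C1_grad_Cc j hz cz.
(* S is the stability density of p zeta, L the linearized equation tested with
   (v / G) p zeta^2, and Q the divergence of phi grad psi; the integrals of L
   and Q vanish. *)
apply: (@le_trans _ _ (integ (fun x => S x - L x - eps * Q x))).
  rewrite integB ?integB ?integZ ?hlin ?hdiv ?mulr0 ?subr0//; [exact: CcB|exact: CcZ].
apply: le_integ.
- by apply: CcB; [exact: CcB|exact: CcZ].
- apply: CcD; first apply: CcD.
  + apply: CcMr; first exact: contX.
    by apply: Cc_sum => j _; exact: Cc_sqr.
  + exact: CcZ.
  + apply: CcZ; apply: CcMr => //; apply: contB; first exact: contM.
    by apply: cont_sum => j _; have [_ _] := hdpsi j; apply.
move=> x; rewrite -/(phi x).
have -> : S x - L x - eps * Q x = p x ^+ 2 * (\sum_j dzeta j x ^+ 2)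
    - \sum_j (delta ^+ 2 * DDu j i x ^+ 2 / G x ^+ 3 * phi x)
    + c x * (delta ^+ 2 / G x + eps * psi x) * phi x
    - eps * (\sum_j ddpsi j j x) * phi x.
  have Gx := Gn x.
  have E0 : c x * (p x * zeta x) ^+ 2 - c x * v x * (v x * (G x)^-1 * phi x) =
      c x * (delta ^+ 2 / G x + eps * psi x) * phi x.
    have -> : delta ^+ 2 = G x ^+ 2 - v x ^+ 2 by rewrite G2 addrC addKr.
    by rewrite /phi pGE; field.
  have E1 : \sum_j ((v x / G x * DDu j i x + eps * dpsi j x) * zeta x + p x * dzeta j x) ^+ 2
      - \sum_j DDu j i x * ((DDu j i x * (G x)^-1 + v x * (- (G x ^+ 2)^-1 * (v x / G x * DDu j i x)))
        * phi x + v x * (G x)^-1 * dphi j x)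
      - eps * \sum_j (ddpsi j j x * phi x + dpsi j x * dphi j x) =
      p x ^+ 2 * (\sum_j dzeta j x ^+ 2)
      - \sum_j (delta ^+ 2 * DDu j i x ^+ 2 / G x ^+ 3 * phi x)
      - eps * (\sum_j ddpsi j j x) * phi x.
    rewrite -[X in _ = _ - X]mulrA (mulr_suml _ _ _ (phi x)) !mulr_sumr -!sumrB.
    apply: eq_bigr => j _.
    have -> : delta ^+ 2 = G x ^+ 2 - v x ^+ 2 by rewrite G2 addrC addKr.
    by rewrite /dphi /phi; field.
  rewrite -E0; move: E1; rewrite /S /L /Q -/(v x) -/(c x).
  set s1 := \sum_j (_ + p x * _) ^+ 2; set s3 := \sum_j (ddpsi j j x * _ + _).
  set s2 := \sum_j (DDu j i x * _).
  set t1 := \sum_j dzeta _ _ ^+ 2; set t2 := \sum_j (_ * phi x); set t3 := \sum_j ddpsi j j x.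
  lra.
have Gx := G0 x; have ph := phi0 x.
(* This term is |grad v|^2 - |grad G|^2, up to the factor phi / G; the
   regularization gives it the good sign. *)
have M0 : 0 <= \sum_j (delta ^+ 2 * DDu j i x ^+ 2 / G x ^+ 3 * phi x).
  apply: sumr_ge0 => j _; apply: mulr_ge0 => //.
  by rewrite divr_ge0 ?exprn_ge0 ?(ltW Gx)// mulr_ge0// sqr_ge0.
have K1 : c x * (delta ^+ 2 / G x) * phi x <= K * delta * phi x.
  apply: ler_wpM2r => //.
  have h1 : delta ^+ 2 / G x <= delta.
    by rewrite ler_pdivrMr// expr2 ler_wpM2l// ltW.
  have h2 : 0 <= delta ^+ 2 / G x by rewrite divr_ge0 ?sqr_ge0// ltW.
  apply: (le_trans (ler_wpM2r h2 (le_trans (ler_norm _) (cK x)))).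
  by rewrite ler_wpM2l//; apply: le_trans (cK x).
have E2 : c x * (delta ^+ 2 / G x + eps * psi x) * phi x =
    c x * (delta ^+ 2 / G x) * phi x + eps * (c x * psi x) * phi x by ring.
rewrite E2; move: K1 M0; set a1 := c x * _ * phi x; set a2 := \sum_j _.
set a3 := \sum_j _; set a4 := \sum_j _ => K1 M0.
rewrite (_ : eps * ((c x * psi x - a4) * phi x) = eps * (c x * psi x) * phi x - eps * a4 * phi x).
  by set b1 := _ * phi x; set b2 := eps * a4 * phi x; lra.
ring.
Qed.
End kato.

(** * Logarithmic cutoffs in the plane *)

Section log_cutoff.
Context {R : realType}.
Local Notation E := 'rV[R]_2.

(** Average N dyadic cutoffs. In the plane each has an energy independent of
    its scale, and their gradients have disjoint supports in every direction,
    so the average has energy O(1 / N). *)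
Lemma log_cutoff (D e : R) : 0 <= D -> 0 < e -> exists zeta dzeta,
  [/\ C1_grad zeta dzeta, Cc zeta, forall x : E, 0 <= zeta x <= 1,
     forall x, `|x| <= D -> zeta x = 1 & integ (fun x => \sum_j dzeta j x ^+ 2) <= e].
Proof.
move=> D0 e0.
pose J0 := (Num.truncn D).+1.
pose r (j : nat) : 'I_2 -> R := fun=> 2 ^+ (J0 + j).
have r0 j i : 0 < r j i by rewrite exprn_gt0.
(* The energy turns out to be at most 2 * 4096 / N. *)
pose N := (Num.truncn (8192 / e)).+1.
have N0 : 0 < N%:R :> R by rewrite ltr0n.
have Ne : 8192 / N%:R <= e.
  by rewrite ler_pdivrMr// mulrC -ler_pdivrMr// ltW// truncnS_gt.
have hB j := boxcut_C1_grad (r j). have cB j := boxcut_Cc (r0 j).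
have cdB j i : Cc (dboxcut (r j) i) := C1_grad_Cc i (hB j) (cB j).
exists (fun x => N%:R^-1 * \sum_(j < N) boxcut (r j) x).
exists (fun i x => N%:R^-1 * \sum_(j < N) dboxcut (r j) i x).
split.
- by apply: C1_gradZ; apply: C1_grad_sum => j _; exact: hB.
- by apply: CcZ; apply: Cc_sum => j _; exact: cB.
- move=> x; rewrite mulr_ge0 ?invr_ge0 ?ler0n ?sumr_ge0//=; last first.
    by move=> j _; exact: boxcut_ge0.
  rewrite ler_pdivrMl// mulr1 (@le_trans _ _ (\sum_(j < N) 1))//.
    by apply: ler_sum => j _; exact: boxcut_le1.
  by rewrite sumr_const card_ord.
- move=> x xD; rewrite (eq_bigr (fun=> 1)); last first.
    move=> j _; rewrite boxcut1// => i; apply: le_trans (coord_le_norm _ _) _.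
    apply: (le_trans xD); apply: ltW; apply: (lt_le_trans (truncnS_gt _)).
    rewrite /r -natrX ler_nat (leq_trans (ltnW (ltn_expl _ (ltnSn 1))))// leq_exp2l//.
    by rewrite leq_addr.
  by rewrite sumr_const card_ord mulVf// gt_eqF.
- have disj j k i x : j != k -> dboxcut (r j) i x * dboxcut (r k) i x = 0.
    wlog jk : j k / (j < k)%N.
      move=> h jk; move: (jk); rewrite neq_ltn => /orP[kj|kj]; first exact: h.
      by rewrite mulrC h// eq_sym.
    move=> _; have [xi|xi] := leP (`|x 0 i|) (r k i).
      by rewrite (dboxcut_near _ xi) ?mulr0.
    rewrite (@dboxcut_far _ _ (r j) _ _ i) ?mul0r//; apply: le_trans (ltW xi).
    by rewrite /r -exprS ler_weXn2l ?ler1n// -addnS leq_add2l.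
  have sq i x : (N%:R^-1 * \sum_(j < N) dboxcut (r j) i x) ^+ 2 =
      N%:R^-1 ^+ 2 * \sum_(j < N) dboxcut (r j) i x ^+ 2.
    rewrite exprMn; congr (_ * _); rewrite expr2 mulr_sumr; apply: eq_bigr => j _.
    rewrite mulr_suml (bigD1 j)//= -expr2 big1 ?addr0// => k kj.
    exact: disj.
  have cdB2 j i : Cc (fun x => dboxcut (r j) i x ^+ 2).
    exact: Cc_sqr.
  (* The square of the gradient bound 16 / r times the area (4 r)^2 of the
     support. *)
  have one i j : integ (fun x => dboxcut (r j) i x ^+ 2) <= 4096.
    have := @integ_le_box R 2 _ (fun l => 2 * r j l) ((16 / r j i) ^+ 2) (cdB2 j i).
    have rji := r0 j i.
    rewrite (_ : _ * \prod_i0 _ = 4096); last first.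
      by rewrite /r prodr_const card_ord; set z := 2 ^+ _; field; rewrite gt_eqF// exprn_gt0.
    apply.
    + exact: sqr_ge0.
    + by move=> l; rewrite mulr_ge0// ltW.
    + move=> x; rewrite normrX lerXn2r ?nnegrE//; last exact: dboxcut_bound.
      by rewrite divr_ge0// ltW.
    + by move=> x l xl; rewrite (@dboxcut_far _ _ (r j) _ _ l) ?expr0n// ltW.
  rewrite (_ : (fun x => _) = (fun x => \sum_i N%:R^-1 ^+ 2 * \sum_(j < N) dboxcut (r j) i x ^+ 2)); last first.
    by apply/funext => x; apply: eq_bigr => i _; exact: sq.
  rewrite integ_sum; last by move=> i _; apply: CcZ; apply: Cc_sum => j _.
  apply: le_trans Ne.
  apply: (@le_trans _ _ (\sum_(i < 2) N%:R^-1 ^+ 2 * (4096 * N%:R))).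
    apply: ler_sum => i _; rewrite integZ; last by apply: Cc_sum.
    rewrite ler_wpM2l ?sqr_ge0// integ_sum; last by move=> j _.
    apply: (@le_trans _ _ (\sum_(j < N) 4096)); first by apply: ler_sum => j _; exact: one.
    by rewrite sumr_const card_ord mulr_natr.
  rewrite sumr_const card_ord mulr2n le_eqVlt; apply/orP; left; apply/eqP.
  by field; rewrite gt_eqF.
Qed.

End log_cutoff.

(** * One-variable profiles for the barrier *)

Section profiles.
Context {R : realType}.
Implicit Types (D mu tau s : R).

Definition well D s := pos_pow 3 (D ^+ 2 - s ^+ 2).
Definition well' D s := 3 * pos_pow 2 (D ^+ 2 - s ^+ 2) * (- (2 * s)).
Definition well'' D s := 3 * (2 * pos_pow 1 (D ^+ 2 - s ^+ 2) * (- (2 * s))) * (- (2 * s)) +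
  3 * pos_pow 2 (D ^+ 2 - s ^+ 2) * (- 2).
(** A smooth approximation of |s|; [damp] is then close to exp (- mu |s|). *)
Definition tent tau s := Num.sqrt (s ^+ 2 + tau ^+ 2).
Definition damp mu tau s := expR (- mu * tent tau s).
Definition damp' mu tau s := - mu * (s / tent tau s) * damp mu tau s.
Definition damp'' mu tau s := (mu ^+ 2 * (s / tent tau s) ^+ 2
  - mu * (tau ^+ 2 / tent tau s ^+ 3)) * damp mu tau s.

Lemma is_derive_sq D s : is_derive s (1 : R) (fun z => D ^+ 2 - z ^+ 2) (- (2 * s)).
Proof.
have h := @is_deriveX _ _ id 2 s 1 1 (is_derive_id _ _).
have := @is_deriveB _ _ _ _ _ _ _ _ _ (is_derive_cst (D ^+ 2) s (1 : R)) h.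
by rewrite /GRing.scale/= mulr1 expr1 sub0r exprfctE.
Qed.

Lemma is_derive_well D s : is_derive s (1 : R) (well D) (well' D s).
Proof. exact: (is_derive_comp1 (is_derive_sq D s) (is_derive_pos_pow 1 _)). Qed.

Lemma is_derive_mul (f g : R -> R) (s a b : R) : is_derive s (1 : R) f a ->
  is_derive s (1 : R) g b -> is_derive s (1 : R) (fun z => f z * g z) (a * g s + f s * b).
Proof.
move=> h1 h2; have := @is_deriveM _ _ _ _ _ _ _ _ h1 h2.
by rewrite addrC [g s *: _]mulrC.
Qed.

Lemma is_derive_lin (c s : R) : is_derive s (1 : R) (fun z => c * z) c.
Proof.
by have := @is_deriveZ _ _ _ id c s 1 1 (is_derive_id _ _); rewrite /GRing.scale/= mulr1.
Qed.

Lemma is_derive_well' D s : is_derive s (1 : R) (well' D) (well'' D s).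
Proof.
have h1 := is_derive_comp1 (is_derive_sq D s) (is_derive_pos_pow 0 _).
have h2 := is_derive_comp1 h1 (is_derive_lin 3 _).
have h3 : is_derive s (1 : R) (fun z => - (2 * z)) (- 2).
  by have := is_derive_lin (-2) s; under eq_fun do rewrite mulNr.
exact: is_derive_mul h2 h3.
Qed.

Lemma tent_gt0 tau s : 0 < tau -> 0 < tent tau s.
Proof. by move=> t0; rewrite sqrtr_gt0 ltr_wpDl ?sqr_ge0// exprn_gt0. Qed.

Lemma tent_sqr tau s : tent tau s ^+ 2 = s ^+ 2 + tau ^+ 2.
Proof. by rewrite sqr_sqrtr// addr_ge0 ?sqr_ge0. Qed.

Lemma is_derive_tent tau s : 0 < tau -> is_derive s (1 : R) (tent tau) (s / tent tau s).
Proof.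
move=> t0.
have h1 : is_derive s (1 : R) (fun z => z ^+ 2 + tau ^+ 2) (2 * s).
  have h := @is_deriveX _ _ id 2 s 1 1 (is_derive_id _ _).
  have := @is_deriveD _ _ _ _ _ _ _ _ _ h (is_derive_cst (tau ^+ 2) s (1 : R)).
  by rewrite /GRing.scale/= mulr1 expr1 addr0 exprfctE.
have q0 : 0 < s ^+ 2 + tau ^+ 2 by rewrite ltr_wpDl ?sqr_ge0// exprn_gt0.
have := is_derive_comp1 h1 (is_derive1_sqrt q0).
rewrite -/(tent tau s) (_ : _^-1 * _ = s / tent tau s)//.
by field; rewrite gt_eqF// tent_gt0.
Qed.

Lemma is_derive_slope tau s : 0 < tau ->
  is_derive s (1 : R) (fun z => z / tent tau z) (tau ^+ 2 / tent tau s ^+ 3).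
Proof.
move=> t0; have T0 := tent_gt0 s t0; have Tn : tent tau s != 0 by rewrite gt_eqF.
have hV : is_derive s (1 : R) (fun z => (tent tau z)^-1) (- (tent tau s ^+ 2)^-1 * (s / tent tau s)).
  have := @is_deriveV _ (tent tau) s _ 1 Tn (is_derive_tent s t0).
  by rewrite /GRing.scale/=.
have := is_derive_mul (is_derive_id s (1 : R)) hV.
rewrite (_ : 1 * _ + _ = tau ^+ 2 / tent tau s ^+ 3)//.
have -> : tau ^+ 2 = tent tau s ^+ 2 - s ^+ 2 by rewrite tent_sqr addrC addKr.
by field.
Qed.

Lemma is_derive_damp mu tau s : 0 < tau -> is_derive s (1 : R) (damp mu tau) (damp' mu tau s).
Proof.
move=> t0; have h1 := is_derive_comp1 (is_derive_tent s t0) (is_derive_lin (- mu) _).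
by have := is_derive_comp1 h1 (is_derive_expR _); rewrite mulrC.
Qed.

Lemma is_derive_damp' mu tau s : 0 < tau -> is_derive s (1 : R) (damp' mu tau) (damp'' mu tau s).
Proof.
move=> t0; have h1 := is_derive_comp1 (is_derive_slope s t0) (is_derive_lin (- mu) _).
have := is_derive_mul h1 (is_derive_damp mu s t0).
rewrite (_ : _ + _ = damp'' mu tau s)//.
by rewrite /damp'' /damp'; ring.
Qed.

Definition prof D mu tau s := well D s * damp mu tau s.
Definition prof' D mu tau s := well' D s * damp mu tau s + well D s * damp' mu tau s.
Definition prof'' D mu tau s := (well'' D s * damp mu tau s + well' D s * damp' mu tau s) +
  (well' D s * damp' mu tau s + well D s * damp'' mu tau s).

Lemma is_derive_prof D mu tau s : 0 < tau -> is_derive s (1 : R) (prof D mu tau) (prof' D mu tau s).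
Proof. by move=> t0; exact: is_derive_mul (is_derive_well D s) (is_derive_damp mu s t0). Qed.

Lemma is_derive_prof' D mu tau s : 0 < tau -> is_derive s (1 : R) (prof' D mu tau) (prof'' D mu tau s).
Proof.
move=> t0; have h1 := is_derive_mul (is_derive_well' D s) (is_derive_damp mu s t0).
have h2 := is_derive_mul (is_derive_well D s) (is_derive_damp' mu s t0).
exact: is_deriveD.
Qed.

Lemma cont_id : continuous (fun z : R => z). Proof. by move=> x; exact: cvg_id. Qed.

Lemma cont_pos_pow_sq D k : continuous (fun s => pos_pow k (D ^+ 2 - s ^+ 2)).
Proof.
apply: (cont_comp (@cont_pos_pow R k)); apply: contB; first exact: contC.
exact: contX cont_id.
Qed.

Lemma cont_m2 : continuous (fun s : R => - (2 * s)).
Proof. by apply: contN; apply: contM; [exact: contC|exact: cont_id]. Qed.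

Lemma cont_well'' D : continuous (well'' D).
Proof.
have c2 := cont_m2; have p1 := @cont_pos_pow_sq D 1; have p2 := @cont_pos_pow_sq D 2.
apply: contD.
  by apply: contM => //; apply: contM; [exact: contC|apply: contM => //; apply: contM => //; exact: contC].
by apply: contM; [apply: contM => //; exact: contC|exact: contC].
Qed.

Lemma cont_derive (f f' : R -> R) : (forall s : R, is_derive s (1 : R) f (f' s)) -> continuous f.
Proof. by move=> h s; exact: is_derive_continuous (h s). Qed.

Lemma cont_prof'' D mu tau : 0 < tau -> continuous (prof'' D mu tau).
Proof.
move=> t0.
have c1 := cont_derive (fun s => is_derive_well D s).
have c2 := cont_derive (fun s => is_derive_well' D s).
have c3 := cont_derive (fun s => is_derive_damp mu s t0).
have c4 := cont_derive (fun s => is_derive_damp' mu s t0).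
have c5 := @cont_well'' D.
have ct := cont_derive (fun s => is_derive_tent s t0).
have cs := cont_derive (fun s => is_derive_slope s t0).
have cV : continuous (fun s => (tent tau s ^+ 3)^-1).
  by apply: contV; [move=> s; rewrite expf_neq0// gt_eqF// tent_gt0|exact: contX].
have c6 : continuous (damp'' mu tau).
  apply: contM => //; apply: contB.
    by apply: contM; [exact: contC|exact: contX].
  by apply: contM; [exact: contC|apply: contM => //; exact: contC].
by apply: contD; apply: contD; exact: contM.
Qed.

Lemma well_ge0 D s : 0 <= well D s. Proof. exact: pos_pow_ge0. Qed.
Lemma damp_gt0 mu tau s : 0 < damp mu tau s. Proof. exact: expR_gt0. Qed.

(** With P = D^2 - s^2 the difference of the two sides is P (24 D^2 - 30 P +
    (10 / D^2) P^2), and with the constant 10 the quadratic in P has negative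
    discriminant. *)
Lemma well''_ge D s : 0 < D -> - (10 / D ^+ 2) * well D s <= well'' D s.
Proof.
move=> D0; rewrite /well /well''; have [y0|y0] := leP (D ^+ 2 - s ^+ 2) 0.
  rewrite !pos_pow_neg// !(mulr0, mul0r, addr0)//.
rewrite !(pos_pow_pos _ (ltW y0)) -subr_ge0.
set P := D ^+ 2 - s ^+ 2 in y0 *.
have -> : 3 * (2 * P ^+ 1 * - (2 * s)) * - (2 * s) + 3 * P ^+ 2 * -2 - - (10 / D ^+ 2) * P ^+ 3
  = P * (10 / D ^+ 2) * ((P - 3 / 2 * D ^+ 2) ^+ 2 + 3 / 20 * (D ^+ 2) ^+ 2).
  have sP : s ^+ 2 = D ^+ 2 - P by rewrite /P; ring.
  rewrite (_ : 3 * _ * _ = 24 * s ^+ 2 * P); last by ring.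
  by rewrite sP; field; rewrite gt_eqF.
apply: mulr_ge0; first by rewrite mulr_ge0 ?(ltW y0)// divr_ge0// sqr_ge0.
by rewrite addr_ge0 ?sqr_ge0// mulr_ge0 ?sqr_ge0// divr_ge0.
Qed.

End profiles.

(** * The barrier in the plane *)

Section plane.
Context {R : realType}.
Local Notation E := 'rV[R]_2.
Local Notation o0 := (ord0 : 'I_2).
Local Notation o1 := (ord_max : 'I_2).

Lemma well_le (D s : R) : 0 <= D -> well D s <= D ^+ 6.
Proof.
move=> D0; rewrite /well; have [y0|y0] := leP (D ^+ 2 - s ^+ 2) 0.
  by rewrite pos_pow_neg// exprn_ge0.
rewrite pos_pow_pos ?(ltW y0)// (_ : D ^+ 6 = (D ^+ 2) ^+ 3); last by rewrite -exprM.
by rewrite lerXn2r ?nnegrE ?(ltW y0) ?sqr_ge0// gerBl sqr_ge0.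
Qed.

Lemma well_out (D s : R) : 0 <= D -> D <= `|s| ->
  [/\ well D s = 0, well' D s = 0 & well'' D s = 0].
Proof.
move=> D0 Ds; have y0 : D ^+ 2 - s ^+ 2 <= 0.
  by rewrite subr_le0 -[s ^+ 2](real_normK (num_real s)) lerXn2r ?nnegrE.
by rewrite /well /well' /well'' !pos_pow_neg// !(mulr0, mul0r, addr0).
Qed.

Lemma well'_le (D s : R) : 0 <= D -> `|well' D s| <= 6 * D ^+ 5.
Proof.
move=> D0; have [sD|sD] := leP D `|s|.
  have [_ -> _] := well_out D0 sD.
  by rewrite normr0 mulr_ge0// exprn_ge0.
have y0 : 0 <= D ^+ 2 - s ^+ 2.
  by rewrite subr_ge0 -[s ^+ 2](real_normK (num_real s)) lerXn2r ?nnegrE// ltW.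
rewrite /well' (pos_pow_pos 2 y0) mulrN normrN !normrM !(ger0_norm (ler0n R _)).
rewrite (ger0_norm y0) -expr2.
rewrite (_ : 6 * D ^+ 5 = 3 * (D ^+ 2) ^+ 2 * (2 * D)); last by ring.
apply: ler_pM.
- by rewrite mulr_ge0// sqr_ge0.
- by rewrite mulr_ge0.
- by rewrite ler_wpM2l// lerXn2r ?nnegrE ?sqr_ge0// gerBl sqr_ge0.
- by rewrite ler_wpM2l// ltW.
Qed.

Lemma tent_ge tau s : `|s| <= tent tau s :> R.
Proof. by rewrite -sqrtr_sqr ler_sqrt ?addr_ge0 ?sqr_ge0// lerDl sqr_ge0. Qed.

Lemma tent_le tau s : 0 <= tau -> tent tau s <= `|s| + tau :> R.
Proof.
move=> t0; rewrite -[leRHS]ger0_norm ?addr_ge0// -sqrtr_sqr ler_sqrt ?sqr_ge0//.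
rewrite sqrrD (real_normK (num_real s)) -addrA lerD2l lerDr.
by rewrite mulrn_wge0// mulr_ge0.
Qed.

Lemma damp_le1 mu tau s : 0 <= mu -> damp mu tau s <= 1 :> R.
Proof. by move=> m0; rewrite expR_le1 mulNr oppr_le0 mulr_ge0// sqrtr_ge0. Qed.

Lemma slope_le1 tau s : 0 < tau -> `|s / tent tau s| <= 1 :> R.
Proof.
move=> t0; rewrite normrM normfV (gtr0_norm (tent_gt0 s t0)).
by rewrite ler_pdivrMr ?tent_gt0// mul1r tent_ge.
Qed.

(** The second derivative of [tent]: an approximation of twice the Dirac mass
    at 0. *)
Definition kink (tau s : R) := tau ^+ 2 / tent tau s ^+ 3.

Lemma kink_ge0 tau s : 0 < tau -> 0 <= kink tau s.
Proof. by move=> t0; rewrite divr_ge0 ?sqr_ge0// exprn_ge0// ltW// tent_gt0. Qed.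

(** The damping contributes mu^2 to the Laplacian, which exceeds the loss 10 /
    D^2 of each of the two wells, the potential c and the required 1. Only the
    kink of the damping at s0 = 0 has the wrong sign. *)
Lemma barrier_ineq (D K mu tau c s0 s1 : R) : 0 < D -> `|c| <= K -> 0 < tau <= 1 ->
  mu = 20 / D ^+ 2 + K + 1 ->
  c * (prof D mu tau s0 * well D s1) -
    (prof'' D mu tau s0 * well D s1 + prof D mu tau s0 * well'' D s1) <=
  (- 1 + (mu ^+ 2 * (D + 1) + mu) * kink tau s0) * (prof D mu tau s0 * well D s1).
Proof.
move=> D0 cK /andP[t0 t1] muE.
have K0 : 0 <= K by apply: le_trans cK.
have D20 : 0 <= 20 / D ^+ 2 by rewrite divr_ge0// sqr_ge0.
have m1 : 1 <= mu by rewrite muE; lra.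
have [sD|sD] := leP D `|s0|.
  have [w0 w1 w2] := well_out (ltW D0) sD.
  by rewrite /prof /prof'' w0 w1 w2 !(mul0r, mulr0, addr0, subr0).
have T0 := tent_gt0 s0 t0; have Tn : tent tau s0 != 0 by rewrite gt_eqF.
set e := damp mu tau s0; have e0 : 0 < e by exact: damp_gt0.
set w0 := well D s0; set w1 := well D s1.
have w00 : 0 <= w0 by exact: well_ge0. have w10 : 0 <= w1 by exact: well_ge0.
have A0 : - (10 / D ^+ 2) * w0 <= well'' D s0 := well''_ge s0 D0.
have A1 : - (10 / D ^+ 2) * w1 <= well'' D s1 := well''_ge s1 D0.
(* Both factors decrease away from s0 = 0. *)
have cross : 0 <= well' D s0 * damp' mu tau s0.
  rewrite /well' /damp' -/e.
  rewrite (_ : _ * _ = 6 * pos_pow 2 (D ^+ 2 - s0 ^+ 2) * (s0 ^+ 2 * mu * e / tent tau s0)); last by field.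
  apply: mulr_ge0; first by rewrite mulr_ge0// pos_pow_ge0.
  by rewrite divr_ge0 ?(ltW T0)// mulr_ge0 ?(ltW e0)// mulr_ge0 ?sqr_ge0//; lra.
have kk : kink tau s0 = tau ^+ 2 / tent tau s0 ^+ 3 by [].
have k0 := kink_ge0 s0 t0.
have TD : tent tau s0 <= D + 1.
  by apply: (le_trans (tent_le s0 (ltW t0))); rewrite lerD// ltW.
have dE : damp'' mu tau s0 = (mu ^+ 2 - mu ^+ 2 * tent tau s0 * kink tau s0 - mu * kink tau s0) * e.
  rewrite /damp'' -/e -kk; congr (_ * _).
  have -> : (s0 / tent tau s0) ^+ 2 = 1 - tent tau s0 * kink tau s0.
    have s2 : s0 ^+ 2 = tent tau s0 ^+ 2 - tau ^+ 2 by rewrite tent_sqr addrK.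
    by rewrite /kink expr_div_n s2; field.
  by ring.
have dge : (mu ^+ 2 - (mu ^+ 2 * (D + 1) + mu) * kink tau s0) * e <= damp'' mu tau s0.
  rewrite dE; apply: ler_wpM2r; first exact: ltW.
  have : mu ^+ 2 * tent tau s0 * kink tau s0 <= mu ^+ 2 * (D + 1) * kink tau s0.
    by rewrite ler_wpM2r// ler_wpM2l// sqr_ge0.
  lra.
set q := kink tau s0 in k0 dge *. set C1 := mu ^+ 2 * (D + 1) + mu in dge *.
have mm : mu <= mu ^+ 2 by rewrite expr2 ler_peMr//; lra.
have B0 : (- (10 / D ^+ 2) + mu ^+ 2 - C1 * q) * (w0 * e) <= prof'' D mu tau s0.
  rewrite /prof'' -/e -/w0.
  have h1 := ler_wpM2r (ltW e0) A0.
  have h2 := ler_wpM2l w00 dge.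
  move: cross; set z := well' D s0 * _ => z0.
  rewrite (_ : (_ + mu ^+ 2 - _) * _ = - (10 / D ^+ 2) * w0 * e + w0 * ((mu ^+ 2 - C1 * q) * e)); last by ring.
  lra.
have pE : prof D mu tau s0 = w0 * e by [].
rewrite pE.
have we0 : 0 <= w0 * e by rewrite mulr_ge0// ltW.
have h1 := ler_wpM2r w10 B0.
have h2 := ler_wpM2l we0 A1.
have h3 : c * (w0 * e * w1) <= K * (w0 * e * w1).
  by apply: ler_wpM2r; [rewrite mulr_ge0|exact: le_trans (ler_norm _) cK].
have P0 : 0 <= w0 * e * w1 by rewrite mulr_ge0.
have h4 : (K + 20 / D ^+ 2 + 1) * (w0 * e * w1) <= mu ^+ 2 * (w0 * e * w1).
  by rewrite ler_wpM2r//; lra.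
have E1 : (- (10 / D ^+ 2) + mu ^+ 2 - C1 * q) * (w0 * e) * w1 =
  - (10 / D ^+ 2) * (w0 * e * w1) + mu ^+ 2 * (w0 * e * w1) - C1 * q * (w0 * e * w1) by ring.
have E2 : w0 * e * (- (10 / D ^+ 2) * w1) = - (10 / D ^+ 2) * (w0 * e * w1) by ring.
have E3 : (K + 20 / D ^+ 2 + 1) * (w0 * e * w1) =
   K * (w0 * e * w1) + 2 * (10 / D ^+ 2 * (w0 * e * w1)) + w0 * e * w1.
  by field; rewrite gt_eqF.
rewrite E1 in h1; rewrite E2 in h2; rewrite E3 in h4.
have E4 : (- 1 + C1 * q) * (w0 * e * w1) = C1 * q * (w0 * e * w1) - w0 * e * w1 by ring.
rewrite E4; move: h1 h2 h3 h4; rewrite mulNr.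
set a1 := 10 / D ^+ 2 * _; set a2 := mu ^+ 2 * _; set a3 := C1 * q * _.
set a4 := prof'' _ _ _ _ * _; set a5 := w0 * e * well'' _ _; set a6 := K * _; set a7 := c * _.
set a8 := w0 * e * w1.
lra.
Qed.

Section barrier_function.
Variables (D mu tau : R).
Hypotheses (D0 : 0 < D) (mu0 : 0 <= mu) (tau0 : 0 < tau).

Definition barrier (x : E) := prof D mu tau (x 0 o0) * well D (x 0 o1).
Definition dbarrier (j : 'I_2) (x : E) := (j == o0)%:R * (prof' D mu tau (x 0 o0) * well D (x 0 o1)) +
  (j == o1)%:R * (prof D mu tau (x 0 o0) * well' D (x 0 o1)).
Definition ddbarrier (k j : 'I_2) (x : E) :=
  (j == o0)%:R * (prof'' D mu tau (x 0 o0) * (k == o0)%:R * well D (x 0 o1) +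
                  prof' D mu tau (x 0 o0) * (well' D (x 0 o1) * (k == o1)%:R)) +
  (j == o1)%:R * (prof' D mu tau (x 0 o0) * (k == o0)%:R * well' D (x 0 o1) +
                  prof D mu tau (x 0 o0) * (well'' D (x 0 o1) * (k == o1)%:R)).

Let cprof' : continuous (prof' D mu tau).
Proof. exact: cont_derive (fun s => is_derive_prof' D mu s tau0). Qed.
Let cprof'' : continuous (prof'' D mu tau). Proof. exact: cont_prof''. Qed.
Let cwell' : continuous (well' D).
Proof. exact: cont_derive (fun s => is_derive_well' D s). Qed.
Let cwell'' : continuous (well'' D). Proof. exact: cont_well''. Qed.

Let gprof : C1_grad (fun x : E => prof D mu tau (x 0 o0)) (fun j x => prof' D mu tau (x 0 o0) * (j == o0)%:R).
Proof. by apply: C1_grad_coord_comp => // s; exact: is_derive_prof. Qed.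
Let gprof' : C1_grad (fun x : E => prof' D mu tau (x 0 o0)) (fun j x => prof'' D mu tau (x 0 o0) * (j == o0)%:R).
Proof. by apply: C1_grad_coord_comp => // s; exact: is_derive_prof'. Qed.
Let gwell : C1_grad (fun x : E => well D (x 0 o1)) (fun j x => well' D (x 0 o1) * (j == o1)%:R).
Proof. by apply: C1_grad_coord_comp => // s; exact: is_derive_well. Qed.
Let gwell' : C1_grad (fun x : E => well' D (x 0 o1)) (fun j x => well'' D (x 0 o1) * (j == o1)%:R).
Proof. by apply: C1_grad_coord_comp => // s; exact: is_derive_well'. Qed.

Lemma barrier_C1_grad : C1_grad barrier dbarrier.
Proof. by apply: (C1_grad_ext (C1_gradM gprof gwell)) => // j x; rewrite /dbarrier; ring. Qed.

Lemma dbarrier_C1_grad j : C1_grad (dbarrier j) (fun k => ddbarrier k j).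
Proof.
exact: C1_gradD (C1_gradZ _ (C1_gradM gprof' gwell)) (C1_gradZ _ (C1_gradM gprof gwell')).
Qed.

Lemma barrier_lap x : \sum_j ddbarrier j j x =
  prof'' D mu tau (x 0 o0) * well D (x 0 o1) + prof D mu tau (x 0 o0) * well'' D (x 0 o1).
Proof.
rewrite big_ord_recl big_ord1 /ddbarrier (_ : lift ord0 ord0 = o1); last exact: val_inj.
by rewrite !eqxx (_ : (o0 == o1) = false) // (_ : (o1 == o0) = false) //=; ring.
Qed.

Lemma barrier_ge0 x : 0 <= barrier x.
Proof. by rewrite mulr_ge0 ?well_ge0// mulr_ge0 ?well_ge0// ltW// damp_gt0. Qed.

Lemma barrier_csupp : csupp D barrier.
Proof.
move=> x; rewrite ltNge ler_norm_rV ?(ltW D0)// negb_forall => /existsP[i].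
rewrite -ltNge => /ltW xi; have [w0 _ _] := well_out (ltW D0) xi.
have [ii|ii] : i = o0 \/ i = o1.
  by case: i {xi w0} => [[|[|//]] hi]; [left|right]; exact: val_inj.
- by rewrite /barrier /prof -ii w0 !mul0r.
- by rewrite /barrier -ii w0 mulr0.
Qed.

Lemma barrier_Cc : Cc barrier.
Proof. by split; [case: barrier_C1_grad|exists D; [exact: ltW|exact: barrier_csupp]]. Qed.

Lemma barrier_le x : barrier x <= D ^+ 12.
Proof.
rewrite (_ : D ^+ 12 = D ^+ 6 * 1 * D ^+ 6); last by ring.
have d0 := damp_gt0 mu tau (x 0 o0).
rewrite ler_pM ?well_ge0 ?well_le ?(ltW D0)//; first by rewrite mulr_ge0 ?well_ge0// ltW.
by rewrite ler_pM ?well_ge0 ?well_le ?damp_le1 ?(ltW D0) ?(ltW d0).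
Qed.

Lemma integ_barrier : integ barrier <= D ^+ 12 * (2 * D) ^+ 2.
Proof.
apply: (le_trans (ler_norm _)); apply: norm_integ_le => //.
- exact: barrier_Cc.
- exact: ltW.
- by rewrite exprn_ge0// ltW.
- exact: barrier_csupp.
- by move=> x; rewrite ger0_norm ?barrier_ge0// barrier_le.
Qed.

Lemma slope_C1_grad : C1_grad (fun x : E => x 0 o0 / tent tau (x 0 o0)) (fun j x => kink tau (x 0 o0) * (j == o0)%:R).
Proof.
apply: (@C1_grad_coord_comp R 2 (fun s => s / tent tau s) (kink tau) o0) => [s|].
  exact: is_derive_slope.
have ct := cont_derive (fun s => is_derive_tent s tau0).
apply: contM; first exact: contC.
by apply: contV; [move=> s; rewrite expf_neq0// gt_eqF// tent_gt0|exact: contX].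
Qed.

(** The kink is the derivative of the slope of [tent], which is bounded by 1.
    Integrating by parts therefore gives a bound that does not depend on
    tau. *)
Lemma integ_kink_barrier : integ (fun x => kink tau (x 0 o0) * barrier x) <=
  (6 * D ^+ 5 + D ^+ 6 * mu) * D ^+ 6 * (2 * D) ^+ 2.
Proof.
have := integ_by_parts o0 slope_C1_grad barrier_C1_grad barrier_Cc.
under eq_fun do rewrite eqxx mulr1.
move=> ->.
have cd := C1_grad_Cc o0 barrier_C1_grad barrier_Cc.
have cs : continuous (fun x : E => x 0 o0 / tent tau (x 0 o0)) by case: slope_C1_grad.
apply: (le_trans (ler_norm _)); rewrite normrN; apply: norm_integ_le.
- exact: CcMr.
- exact: ltW.
- by rewrite !mulr_ge0 ?addr_ge0 ?mulr_ge0 ?exprn_ge0 ?(ltW D0).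
- by move=> x /(C1_grad_csupp o0 barrier_C1_grad barrier_csupp) ->; rewrite mulr0.
- move=> x; rewrite normrM -[leRHS]mul1r ler_pM ?slope_le1//.
  rewrite /dbarrier eqxx mul1r (_ : (o0 == o1) = false)// mul0r addr0 normrM.
  apply: ler_pM => //; last by rewrite ger0_norm ?well_ge0// well_le// ltW.
  have d0 := damp_gt0 mu tau (x 0 o0); have d1 := damp_le1 tau (x 0 o0) mu0.
  rewrite (le_trans (ler_normD _ _))// lerD// normrM.
    by rewrite -[leRHS]mulr1 ler_pM ?well'_le ?(ltW D0)// gtr0_norm.
  rewrite ger0_norm ?well_ge0// ler_pM ?well_ge0 ?well_le ?(ltW D0)//.
  rewrite /damp' normrM (gtr0_norm d0) -[leRHS]mulr1 ler_pM ?(ltW d0)//.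
  by rewrite normrM normrN (ger0_norm mu0) -[leRHS]mulr1 ler_pM ?slope_le1.
Qed.

End barrier_function.
End plane.

(** * One radial dimension *)

Section plane_case.
Context {R : realType}.
Local Notation E := 'rV[R]_2.
Local Notation o0 := (ord0 : 'I_2).
Local Notation o1 := (ord_max : 'I_2).
Local Notation e_ i := (delta_mx (0 : 'I_1) i : E).
Variables (beta : R -> R) (u : E -> R) (Du : 'I_2 -> E -> R) (DDu : 'I_2 -> 'I_2 -> E -> R).
Hypotheses (hb : C1 beta) (C1u : C1_grad u Du) (C1Du : forall i, C1_grad (Du i) (fun j => DDu j i))
  (lapu : forall x, \sum_j DDu j j x = 2^-1 * beta (u x))
  (st : stable beta u) (ax : axially_symmetric u).
Variables (L0 K : R).
Hypotheses (vL : forall x, `|Du o0 x| <= L0)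
  (cK : forall x, `|2^-1 * derive1 beta (u x)| <= K).

(** In the plane axial symmetry says that u is even in x_0, so the mean value
    theorem on small symmetric segments produces zeros of d_0 u close to x. *)
Lemma even_derivative_eq0 (x : E) : x 0 o0 = 0 -> Du o0 x = 0.
Proof.
move=> x0; have [_ _ cDu] := C1u.
have /cvgrPdist_le near_x := cDu o0 x.
apply: (@small_eq0 R _ 1) => // e e0 _; rewrite mul1r.
have /nbhs_ballP[d /= d0 hd] := near_x e e0.
(* A segment of length 2 h = d / 2 centred at x; its points stay within
   distance d, even for the rough bound |h - t| <= 3 h. *)
pose h := d / 4; have h0 : 0 < h by rewrite divr_gt0.
have h20 : 0 < 2 * h by rewrite mulr_gt0.
have [t ht E1] := MVT_dir o0 (x - h *: e_ o0) (2 * h) C1u.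
have sym : u (x - h *: e_ o0 + (2 * h) *: e_ o0) = u (x - h *: e_ o0).
  apply: axial_invariant => //.
    by apply: eq_bigr => i im; rewrite !mxE eqxx /=; case: eqVneq => [->|_] /=; rewrite ?x0; ring.
  by rewrite !mxE (_ : (o1 == o0) = false)//= !mulr0 subr0 addr0.
have z : Du o0 (x - h *: e_ o0 + t *: e_ o0) = 0.
  move: E1; rewrite sym subrr => /esym/eqP; rewrite mulf_eq0 (gt_eqF h20) orbF.
  by move/eqP.
have := hd (x - h *: e_ o0 + t *: e_ o0); rewrite -ball_normE/= z subr0; apply.
rewrite (_ : x - _ = (h - t) *: e_ o0); last first.
  by rewrite opprD opprB addrA addrCA subrr addr0 -scalerBl.
apply: (le_lt_trans (norm_he _ _)); rewrite (le_lt_trans (ler_normB _ _))//.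
move: ht; rewrite (gtr0_norm h20) (gtr0_norm h0) /h; lra.
Qed.

Lemma derivative_linear_bound (D : R) : 0 <= D ->
  exists2 V, 0 <= V & forall x : E, `|x| <= D -> `|Du o0 x| <= V * `|x 0 o0|.
Proof.
move=> D0; have [_ _ /(_ o0) cDD] := C1Du o0.
(* The intermediate point of the mean value theorem is y + t e_0 with |y| <= 2
   D and |t| <= D. *)
have [V V0 hV] := bounded_on_cube (3 * D) cDD.
exists V => // x xD; pose y := x - x 0 o0 *: e_ o0.
have y0 : Du o0 y = 0 by apply: even_derivative_eq0; rewrite /y !mxE /= mulr1 subrr.
have [t ht] := MVT_dir o0 y (x 0 o0) (C1Du o0).
rewrite y0 subr0 {1}/y subrK => ->.
rewrite normrM ler_wpM2r// hV//.
have := coord_le_norm x o0; have := norm_he o0 t; have := norm_he o0 (x 0 o0).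
have := ler_normD y (t *: e_ o0); have := ler_normB x (x 0 o0 *: e_ o0); rewrite -/y.
move: (t *: e_ o0) (x 0 o0 *: e_ o0) => a b.
have := normr_ge0 (y + a); lra.
Qed.

(** Apply [kato_ineq] to v = d_0 u with perturbation e times the barrier of a
    square around x0. The first variation contributes - e low (integ F), where
    F is |v| times the two wells, and every error term is O(e^2): the energy
    of the cutoff and the regularization by choice of zeta and delta, and the
    kink because |v| <= V |x_0| near the line x_0 = 0. *)
Lemma normal_derivative_eq0 (x0 : E) : Du o0 x0 = 0.
Proof.
pose D := `|x0| + 1; have D0 : 0 < D by rewrite ltr_wpDl.
have K0 : 0 <= K := le_trans (normr_ge0 _) (cK 0).
have L00 : 0 <= L0 := le_trans (normr_ge0 _) (vL 0).
have D20 : 0 <= 20 / D ^+ 2 by rewrite divr_ge0// sqr_ge0.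
pose mu := 20 / D ^+ 2 + K + 1; have mu0 : 0 <= mu by rewrite /mu; lra.
have [V V0 hV] := derivative_linear_bound (ltW D0).
pose F (x : E) := well D (x 0 o0) * well D (x 0 o1) * `|Du o0 x|.
(* A lower bound for the damping on the square, uniform in tau <= 1. *)
pose low := expR (- mu * (D + 1)); have low0 : 0 < low by exact: expR_gt0.
pose B := D ^+ 12; have B0 : 0 <= B by rewrite exprn_ge0// ltW.
pose P := L0 + 1 + B; have P0 : 0 < P by rewrite /P; lra.
pose C1' := mu ^+ 2 * (D + 1) + mu.
have C10 : 0 <= C1' by rewrite addr_ge0// mulr_ge0 ?sqr_ge0// addr_ge0// ltW.
pose C2 := (6 * D ^+ 5 + D ^+ 6 * mu) * D ^+ 6 * (2 * D) ^+ 2.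
pose C3 := D ^+ 12 * (2 * D) ^+ 2.
have C20 : 0 <= C2.
  by rewrite !mulr_ge0 ?addr_ge0 ?mulr_ge0 ?exprn_ge0 ?(ltW D0).
have C30 : 0 <= C3 by apply: mulr_ge0; apply: exprn_ge0; [exact: ltW|rewrite mulr_ge0// ltW].
have cw : continuous (well D) := cont_derive (fun s => is_derive_well D s).
have cv : continuous (Du o0) by case: C1u.
have F0 x : 0 <= F x by apply: mulr_ge0 => //; apply: mulr_ge0; exact: well_ge0.
have Fout x : D < `|x| -> F x = 0.
  rewrite ltNge ler_norm_rV ?(ltW D0)// negb_forall => /existsP[i].
  rewrite -ltNge => /ltW xi; have [w0 _ _] := well_out (ltW D0) xi.
  have [ii|ii] : i = o0 \/ i = o1.
    by case: i {xi w0} => [[|[|//]] hi]; [left|right]; exact: val_inj.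
  - by rewrite /F -ii w0 !mul0r.
  - by rewrite /F -ii w0 mulr0 mul0r.
have cF : Cc F.
  split; last by exists D => //; exact: ltW.
  apply: contM; last exact: cont_norm.
  by apply: contM; apply: cont_comp => //; exact: cont_coord.
suff IF : integ F = 0.
  have Fx0 := integ_eq0 cF F0 IF x0.
  have wpos i : well D (x0 0 i) != 0.
    rewrite /well pos_pow_pos.
      rewrite expf_neq0// gt_eqF// subr_gt0 -[x0 0 i ^+ 2](real_normK (num_real _)).
      rewrite ltrXn2r// ?nnegrE// ?(ltW D0)//.
      by rewrite (le_lt_trans (coord_le_norm _ _))// /D ltrDl.
    rewrite subr_ge0 -[x0 0 i ^+ 2](real_normK (num_real _)) lerXn2r ?nnegrE ?(ltW D0)//.
    by rewrite (le_trans (coord_le_norm _ _))// /D lerDl.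
  apply: normr0_eq0; apply: (mulfI (mulf_neq0 (wpos o0) (wpos o1))).
  by rewrite mulr0; exact: Fx0.
have A0 : 0 <= (V + 1 + B) * C2 + V * C3.
  by apply: addr_ge0; apply: mulr_ge0 => //; lra.
apply: (@small_eq0 R _ ((2 + C1' * ((V + 1 + B) * C2 + V * C3)) / low)).
  apply: divr_ge0; last exact: ltW.
  by apply: addr_ge0 => //; exact: mulr_ge0.
move=> e e0 e1.
have eP : 0 < e ^+ 2 / P ^+ 2 by rewrite divr_gt0 ?exprn_gt0.
have [zeta [dzeta [hz cz z01 z1 zI]]] := log_cutoff (ltW D0) eP.
have cz2 : Cc (fun x => zeta x ^+ 2).
  exact: Cc_sqr.
pose Z := integ (fun x => zeta x ^+ 2).
have Z0 : 0 <= Z by apply: integ_ge0 => x; exact: sqr_ge0.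
have KPZ : 0 <= K * P * Z by rewrite !mulr_ge0// ltW.
(* The cutoff zeta, hence Z, is fixed before delta, so that delta can
   compensate the size of its support. *)
pose delta := Num.min e (e ^+ 2 / (K * P * Z + 1)).
have delta0 : 0 < delta by rewrite lt_min e0 divr_gt0 ?exprn_gt0//; lra.
have de : delta <= e by rewrite ge_min lexx.
have dZ : K * P * Z * delta <= e ^+ 2.
  have h1 : delta <= e ^+ 2 / (K * P * Z + 1) by rewrite ge_min lexx orbT.
  apply: (le_trans (ler_wpM2l KPZ h1)).
  rewrite mulrA ler_pdivrMr; last lra.
  by rewrite mulrC ler_wpM2l ?sqr_ge0//; lra.
(* This makes kink * |x_0| at most e * kink + e^2, see below. *)
pose tau := e ^+ 2; have tau0 : 0 < tau by rewrite exprn_gt0.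
have tau1 : tau <= 1 by rewrite exprn_ile1// ltW.
pose ps := barrier D mu tau.
pose p (x : E) := Num.sqrt (Du o0 x ^+ 2 + delta ^+ 2) + e * ps x.
have hk := @kato_ineq R 2 beta u Du DDu hb C1u C1Du lapu st K delta e o0 zeta dzeta ps
  (dbarrier D mu tau) (ddbarrier D mu tau) p erefl cK delta0 (ltW e0) hz cz (barrier_C1_grad D mu tau0)
  (barrier_ge0 D mu tau) (dbarrier_C1_grad D mu tau0).
set T := (X in integ X) in hk.
pose om (x : E) := kink tau (x 0 o0) * ps x.
have ps0 x : 0 <= ps x by exact: barrier_ge0.
have psB x : ps x <= B by exact: barrier_le.
have om0 x : 0 <= om x by rewrite mulr_ge0 ?kink_ge0.
have cps : Cc ps by exact: barrier_Cc.
have com : Cc om.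
  apply: CcMr => //; have [_ _ /(_ o0)] := @slope_C1_grad R tau tau0.
  by under eq_fun do rewrite eqxx mulr1.
have cdz2 : Cc (fun x => \sum_j dzeta j x ^+ 2).
  by apply: Cc_sum => j _; apply: Cc_sqr; exact: C1_grad_Cc hz cz.
have sqv x : `|Du o0 x| <= Num.sqrt (Du o0 x ^+ 2 + delta ^+ 2).
  by rewrite -sqrtr_sqr ler_sqrt ?addr_ge0 ?sqr_ge0// lerDl sqr_ge0.
have sqd x : Num.sqrt (Du o0 x ^+ 2 + delta ^+ 2) <= `|Du o0 x| + delta.
  exact: tent_le (ltW delta0).
have pv x : `|Du o0 x| <= p x by rewrite (le_trans (sqv x))// lerDl mulr_ge0// ltW.
have p0 x : 0 <= p x := le_trans (normr_ge0 _) (pv x).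
have eps_le x : e * ps x <= e * B by rewrite ler_wpM2l// ltW.
have pup x : p x <= `|Du o0 x| + e + e * B.
  by rewrite lerD// (le_trans (sqd x))// lerD2l.
have pP x : p x <= P.
  apply: (le_trans (pup x)); rewrite /P !lerD//.
  by rewrite -[leRHS]mul1r ler_wpM2r.
have z20 x : 0 <= zeta x ^+ 2 by exact: sqr_ge0.
have z21 x : zeta x ^+ 2 <= 1 by have /andP[? ?] := z01 x; rewrite exprn_ile1.
have key x : T x <= P ^+ 2 * (\sum_j dzeta j x ^+ 2) + K * P * delta * zeta x ^+ 2
    - e * low * F x + e * C1' * (e * (V + 1 + B) * om x + V * e ^+ 2 * ps x).
  have S0 : 0 <= \sum_j dzeta j x ^+ 2 by rewrite sumr_ge0// => j _; exact: sqr_ge0.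
  rewrite /T -addrA -[leRHS]addrA -[leRHS]addrA.
  have a1 : p x ^+ 2 * (\sum_j dzeta j x ^+ 2) <= P ^+ 2 * (\sum_j dzeta j x ^+ 2).
    by rewrite ler_wpM2r// lerXn2r ?nnegrE// ltW.
  have a2 : K * delta * (p x * zeta x ^+ 2) <= K * P * delta * zeta x ^+ 2.
    rewrite mulrA ler_wpM2r// mulrAC ler_wpM2r ?(ltW delta0)// ler_wpM2l//.
  have ph0 : 0 <= p x * zeta x ^+ 2 by rewrite mulr_ge0.
  have a3 : (2^-1 * beta^`()%classic (u x) * ps x - \sum_j ddbarrier D mu tau j j x) *
      (p x * zeta x ^+ 2) <= - (low * F x) + C1' * (e * (V + 1 + B) * om x + V * e ^+ 2 * ps x).
    have [xD|xD] := leP `|x| D; last first.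
      have out i := C1_grad_csupp i (barrier_C1_grad D mu tau0) (@barrier_csupp R D mu tau D0).
      have -> : \sum_j ddbarrier D mu tau j j x = 0.
        by apply: big1 => j _; apply: (C1_grad_csupp j (dbarrier_C1_grad D mu tau0 j) (out j)).
      rewrite Fout// /om (_ : ps x = 0) ?(mulr0, subr0, mul0r, oppr0, addr0)//.
      exact: barrier_csupp.
    have tau01 : 0 < tau <= 1 by rewrite tau0.
    have := barrier_ineq (x 0 o0) (x 0 o1) D0 (cK x) tau01 erefl.
    rewrite -/mu -barrier_lap -/(barrier D mu tau x) -/(ps x) -/C1' => hbar.
    apply: (le_trans (ler_wpM2r ph0 hbar)).
    have -> : (-1 + C1' * kink tau (x 0 o0)) * ps x * (p x * zeta x ^+ 2) =
       - (ps x * (p x * zeta x ^+ 2)) + C1' * (om x * (p x * zeta x ^+ 2)).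
      by rewrite /om; ring.
    apply: lerD.
      rewrite lerN2 (z1 _ xD) expr1n mulr1 /F mulrA; apply: ler_pM => //.
        by apply: mulr_ge0; [exact: ltW|apply: mulr_ge0; exact: well_ge0].
      rewrite [leLHS]mulrC /ps /barrier /prof [leRHS]mulrAC; apply: ler_wpM2l.
        by apply: mulr_ge0; exact: well_ge0.
      rewrite ler_expR !mulNr lerN2 ler_wpM2l//.
      apply: (le_trans (tent_le _ (ltW tau0))).
      by rewrite lerD// (le_trans (coord_le_norm _ _)).
    apply: ler_wpM2l => //.
    have b1 : om x * (p x * zeta x ^+ 2) <= om x * (`|Du o0 x| + e + e * B).
      rewrite ler_wpM2l// -[leRHS]mulr1 ler_pM//.
    apply: (le_trans b1).
    have T0 := tent_gt0 (x 0 o0) tau0.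
    (* Where the tent is at most e, so is |x_0|; elsewhere kink * tent = tau^2
       / tent^2 <= e^2. *)
    have b2 : kink tau (x 0 o0) * `|x 0 o0| <= e * kink tau (x 0 o0) + e ^+ 2.
      have k0 := kink_ge0 (x 0 o0) tau0.
      apply: (@le_trans _ _ (kink tau (x 0 o0) * tent tau (x 0 o0))).
        by rewrite ler_wpM2l// tent_ge.
      have [te|te] := leP (tent tau (x 0 o0)) e.
        by rewrite mulrC (le_trans (ler_wpM2r k0 te))// lerDl sqr_ge0.
      rewrite (@le_trans _ _ (e ^+ 2))//; last by rewrite lerDr mulr_ge0// ltW.
      rewrite (_ : _ * _ = tau ^+ 2 / tent tau (x 0 o0) ^+ 2); last first.
        by rewrite /kink; field; rewrite gt_eqF.
      rewrite ler_pdivrMr ?exprn_gt0// {1}/tau expr2 ler_wpM2l ?sqr_ge0//.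
      by rewrite lerXn2r ?nnegrE ?(ltW e0) ?(ltW T0) ?(ltW te).
    have b3 : om x * `|Du o0 x| <= V * (e * om x + e ^+ 2 * ps x).
      apply: (le_trans (ler_wpM2l (om0 x) (hV x xD))).
      rewrite (_ : om x * _ = V * (ps x * (kink tau (x 0 o0) * `|x 0 o0|))); last first.
        by rewrite /om; ring.
      apply: ler_wpM2l => //; apply: (le_trans (ler_wpM2l (ps0 x) b2)).
      by rewrite le_eqVlt; apply/orP; left; apply/eqP; rewrite /om; ring.
    rewrite (_ : om x * _ = om x * `|Du o0 x| + e * (1 + B) * om x); last by ring.
    rewrite (_ : _ + V * e ^+ 2 * ps x = V * (e * om x + e ^+ 2 * ps x) + e * (1 + B) * om x); last by ring.
    by rewrite lerD2r.
  apply: lerD => //; apply: lerD => //.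
  apply: (le_trans (ler_wpM2l (ltW e0) a3)).
  by rewrite le_eqVlt; apply/orP; left; apply/eqP; ring.
have c1 := CcZ (P ^+ 2) cdz2. have c2 := CcZ (K * P * delta) cz2.
have c3 := CcZ (e * low) cF.
have c4a := CcZ (e * (V + 1 + B)) com. have c4b := CcZ (V * e ^+ 2) cps.
have c4 := CcZ (e * C1') (CcD c4a c4b).
have cT : Cc T.
  have [h1 _ _] := hz.
  have cp : continuous p.
    apply: contD; last by apply: contM; [exact: contC|case: cps].
    apply: cont_comp; first exact: sqrt_continuous.
    by apply: contD; [exact: contX|exact: contC].
  apply: CcD; first apply: CcD.
  - by apply: CcMr => //; exact: contX.
  - by apply: CcZ; apply: CcMr.
  - apply: CcZ; apply: CcMr; last exact: CcMr.
    apply: contB.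
      apply: contM; last by case: cps.
      apply: contM; first exact: contC.
      by apply: cont_comp; [case: hb|case: C1u].
    by apply: cont_sum => j _; have [_ _] := dbarrier_C1_grad D mu tau0 j; apply.
have := le_trans hk (le_integ cT (CcD (CcB (CcD c1 c2) c3) c4) key).
rewrite (integD (CcB (CcD c1 c2) c3) c4) (integB (CcD c1 c2) c3) (integD c1 c2).
rewrite (integZ _ cdz2) (integZ _ cz2) (integZ _ cF) (integZ _ (CcD c4a c4b)) (integD c4a c4b) (integZ _ com) (integZ _ cps).
rewrite -/Z => hI.
have i1 : P ^+ 2 * integ (fun x => \sum_j dzeta j x ^+ 2) <= e ^+ 2.
  by move: zI; rewrite ler_pdivlMr ?exprn_gt0// mulrC.
have i2 : K * P * delta * Z <= e ^+ 2 by rewrite mulrAC.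
have i3 : integ om <= C2 by exact: integ_kink_barrier.
have i4 : integ ps <= C3 by exact: integ_barrier.
have i5 : e * (V + 1 + B) * integ om + V * e ^+ 2 * integ ps <= e * ((V + 1 + B) * C2 + V * C3).
  rewrite [leRHS]mulrDr lerD//.
    by rewrite -mulrA; apply: ler_wpM2l; [exact: ltW|apply: ler_wpM2l => //; lra].
  rewrite [leRHS]mulrCA -mulrA; apply: ler_wpM2l => //.
  apply: ler_pM => //; rewrite ?sqr_ge0//; first by apply: integ_ge0.
  by rewrite expr2 ler_piMr// ltW.
have i6 : e * C1' * (e * (V + 1 + B) * integ om + V * e ^+ 2 * integ ps) <=
    e * C1' * (e * ((V + 1 + B) * C2 + V * C3)).
  by rewrite ler_wpM2l// mulr_ge0// ltW.
have i7 : e * (low * integ F) <= e * (e * (2 + C1' * ((V + 1 + B) * C2 + V * C3))).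
  move: hI i6; set A := (V + 1 + B) * C2 + V * C3; move: i1 i2.
  rewrite (_ : e * (e * (2 + C1' * A)) = e ^+ 2 + e ^+ 2 + e * C1' * (e * A)); last by ring.
  rewrite (_ : e * (low * integ F) = e * low * integ F); last by rewrite mulrA.
  set a1 := P ^+ 2 * _; set a2 := K * P * delta * Z; set a3 := e * low * _.
  set a4 := e * C1' * _; set a5 := e * C1' * _; lra.
rewrite ler_pM2l// in i7.
rewrite ger0_norm; last exact: integ_ge0.
by rewrite mulrAC ler_pdivlMr// mulrC [leRHS]mulrC.
Qed.

End plane_case.

(** * From the vanishing radial derivative to the one-dimensional form *)

Section conclusion.
Context {R : realType}.

(** The mean value theorem provides points arbitrarily close to x where the
    derivative is bounded by the Lipschitz constant. *)
Lemma lipschitz_derivative_bound n (u : 'rV[R]_n -> R) du : lipschitz u -> C1_grad u du ->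
  exists2 M, 0 <= M & forall i x, `|du i x| <= M.
Proof.
move=> /pinfty_ex_gt0[M M0 hM] hu; exists M => [|i x]; first exact: ltW.
have [_ _ cdu] := hu.
apply/ler_addgt0Pr => e e0.
have /cvgrPdist_le /(_ e e0) /nbhs_ballP[d /= d0 hd] := cdu i x.
pose h := d / 2; have h0 : 0 < h by rewrite divr_gt0.
have [t ht E] := MVT_dir i x h hu.
have dt : `|du i (x + t *: delta_mx 0 i)| <= M.
  rewrite -(ler_pM2r h0) -{1}(gtr0_norm h0) -normrM -E.
  have := hM (x + h *: delta_mx 0 i, x) (conj Logic.I Logic.I); rewrite /= (addrC x) addrK => hl.
  apply: (le_trans hl); rewrite ler_pM2l//.
  by apply: (le_trans (norm_he _ _)); rewrite gtr0_norm.
have hx : `|du i x - du i (x + t *: delta_mx 0 i)| <= e.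
  apply: hd; rewrite -ball_normE/= opprD addrA subrr sub0r normrN.
  apply: (le_lt_trans (norm_he _ _)); apply: (le_lt_trans ht).
  by rewrite (gtr0_norm h0) /h; lra.
have := ler_normD (du i x - du i (x + t *: delta_mx 0 i)) (du i (x + t *: delta_mx 0 i)).
rewrite subrK; lra.
Qed.

Lemma derive1_bounded (beta : R -> R) (a b : R) : C1 beta -> supp beta = `[a, b]%classic ->
  exists K, forall t, `|derive1 beta t| <= K.
Proof.
move=> [_ cb] sb.
have : compact (derive1 beta @` `[a, b]).
  by apply: continuous_compact; [exact: continuous_subspaceT|exact: segment_compact].
move=> /compact_bounded[M [_ hM]]; exists (`|M| + 1) => t.
have [tab|tab] := pselect (`[a, b]%classic t).
  by apply: hM; [rewrite (le_lt_trans (ler_norm M))// ltrDl|exists t].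
have b0 z : ~ `[a, b]%classic z -> beta z = 0.
  by rewrite -sb => hz; apply: contrapT => /eqP bz; apply: hz; exact: subset_closure.
have -> : derive1 beta t = 0.
  rewrite derive1E (near_eq_derive (g := fun=> 0)) ?derive_cst//.
  have : open (~` `[a, b]%classic) by rewrite openC; exact: interval_closed.
  rewrite openE => /(_ t tab); apply: filterS => z; exact: b0.
by rewrite normr0 addr_ge0.
Qed.

(** By symmetry x can be rotated to (s, 0, ..., 0, t), and moving along the
    first coordinate to the axis does not change u. *)
Lemma axial_one_dimensional n (u : 'rV[R]_n.+2 -> R) du : axially_symmetric u -> C1_grad u du ->
  (forall x, du ord0 x = 0) -> one_dimensional u.
Proof.
move=> ax hu du0; pose em : 'rV[R]_n.+2 := delta_mx 0 ord_max.
have e0m : (ord0 == ord_max :> 'I_n.+2) = false by [].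
exists em; split.
  rewrite /dot (bigD1 ord_max)//= !mxE !eqxx mulr1 big1 ?addr0// => i im.
  by rewrite mxE eqxx (negPf im) mul0r.
exists (fun t => u (t *: em)) => x.
have dotE : dot em x = x 0 ord_max.
  rewrite /dot (bigD1 ord_max)//= !mxE !eqxx mul1r big1 ?addr0// => i im.
  by rewrite mxE eqxx (negPf im) mul0r.
pose s := Num.sqrt (\sum_(i < n.+2 | i != ord_max) x 0 i ^+ 2).
have -> : u x = u (x 0 ord_max *: em + s *: delta_mx 0 ord0).
  apply: axial_invariant => //; last by rewrite !mxE !eqxx /= mulr1 mulr0 addr0.
  have m0 : ord0 != ord_max :> 'I_n.+2 by rewrite e0m.
  rewrite [RHS](bigD1 ord0 m0)/= !mxE !eqxx e0m/= mulr0 add0r mulr1.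
  rewrite sqr_sqrtr; last by apply: sumr_ge0 => i _; exact: sqr_ge0.
  rewrite [X in _ = _ + X]big1 ?addr0// => i /andP[im i0].
  by rewrite !mxE eqxx (negPf im) (negPf i0) !mulr0 addr0 expr0n.
have [t _] := MVT_dir ord0 (x 0 ord_max *: em) s hu.
by rewrite du0 mul0r dotE => /eqP; rewrite subr_eq0 => /eqP.
Qed.

End conclusion.

(* The dimension is n.+1; Lipschitz continuity is taken with respect to the
   library's sup norm on row vectors, which is equivalent to the Euclidean
   norm. *)
Theorem theorem1p7 (R : realType) (n : nat) (hn : (2 <= n.+1 <= 5)%N)
  (beta : R -> R)
  (beta_ge0 : forall t, 0 <= beta t)
  (beta_C1 : C1 beta)
  (beta_supp : supp beta = `[0, 1]%classic)
  (beta_int : (\int[lebesgue_measure]_(t in `[0%R, 1%R]%classic) (beta t)%:E = 1)%E)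
  (u : 'rV[R]_n.+1 -> R)
  (u_lip : lipschitz u)
  (u_sol : solution beta u)
  (u_stable : stable beta u)
  (u_axial : axially_symmetric u) :
  one_dimensional u.
Proof.
have [Cu lapu] := u_sol.
have C1u := Ck_C1_grad Cu.
have C1Du i := Ck_C1_grad (Ck_partial i Cu).
have [M M0 hM] := lipschitz_derivative_bound u_lip C1u.
case: n hn u u_lip u_sol u_stable u_axial Cu lapu C1u C1Du M M0 hM => [//|n] hn u u_lip u_sol
  u_stable u_axial Cu lapu C1u C1Du M M0 hM.
apply: (axial_one_dimensional u_axial C1u).
case: n hn u u_lip u_sol u_stable u_axial Cu lapu C1u C1Du hM => [|n] hn u u_lip u_sol
  u_stable u_axial Cu lapu C1u C1Du hM x.
  have [K hK] := derive1_bounded beta_C1 beta_supp.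
  apply: (normal_derivative_eq0 beta_C1 C1u C1Du lapu u_stable u_axial (L0 := M) (K := K)).
    by move=> y; exact: hM.
  move=> y; rewrite normrM gtr0_norm ?invr_gt0// (le_trans _ (hK (u y)))//.
  by rewrite ler_piMl// invf_le1// ler1n.
apply: (radial_derivative_eq0_high beta_C1 C1u C1Du lapu u_stable u_axial
  (G := \sum_(i < n.+3 | i != ord_max) M ^+ 2)) => //.
move=> y; apply: ler_sum => i _.
by rewrite -[_ ^+ 2](real_normK (num_real _)) lerXn2r ?nnegrE.
Qed.
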